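(* Let $G$ be an LR-group with underlying Lie ring $L$ and let $H \leq \mathrm{Aut}(G)$ be a subgroup. Then $\mathrm{RF}_{G, \mathcal{P}_{H\curvearrowright G}} \approx \mathrm{RF}^{\mathrm{Gui}}_{L, \mathcal{P}_{H\curvearrowright L}}$.
   Context: LR-groups. Let $\mathfrak{u}^0(n,\mathbb{Q})$ be the Lie algebra of strictly upper triangular $n\times n$ rational matrices with bracket $[A,B]_L=AB-BA$, made into a group by $A\ast B=\log(\exp(A)\exp(B))$ (Baker-Campbell-Hausdorff). An LR-group is a finitely generated subgroup $G\le(\mathfrak{u}^0(n,\mathbb{Q}),\ast)$ (some $n$) that is also closed under addition and under the bracket $[\cdot,\cdot]_L$. A Lie ring is a free $\mathbb{Z}$-module of finite rank with an alternating bilinear bracket satisfying the Jacobi identity; the underlying Lie ring $L$ of $G$ is the set $G$ with addition and $[\cdot,\cdot]_L$ (it is nilpotent). Group automorphisms of $G$ are exactly the Lie ring automorphisms of $L$, so $H$ also acts on $L$ by Lie ring automorphisms. Growth for groups. With a finite generating set $S$ of $G$, let $\|g\|_{G,S} = \min\{k\ge 0 \mid g = s_1\cdots s_k,\ s_i\in S\cup S^{-1}\}$ (products in $\ast$). For a set $\mathcal{P}$ of normal subgroups of $G$ and $g\neq e$ put $D_{G,\mathcal{P}}(g)=\min\{[G:N]\mid N\in\mathcal{P}, g\notin N\}$, and $\mathrm{RF}_{G,\mathcal{P}}(r)=\max\{D_{G,\mathcal{P}}(g)\mid 0<\|g\|_{G,S}\le r\}$ for $r\ge1$. $\mathcal{P}_{H\curvearrowright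 G}$ is the set of normal subgroups $N$ of $G$ with $\xi(N)=N$ for all $\xi\in H$. Growth for Lie rings. Let $\mathfrak g=L\otimes_{\mathbb Z}\mathbb{R}$, of nilpotency class $c$, with lower central series $\gamma_1(\mathfrak g)=\mathfrak g$, $\gamma_{i+1}(\mathfrak g)=[\gamma_i(\mathfrak g),\mathfrak g]$. Choose subspaces $\mathfrak a_i$ with $\gamma_i(\mathfrak g)=\mathfrak a_i\oplus\cdots\oplus\mathfrak a_c$ for $1\le i\le c$ and norms $\|\cdot\|_i$ on $\mathfrak a_i$; the Guivarc'h length is $l_G(v)=\max_i \|v_i\|_i^{1/i}$ for $v=v_1+\cdots+v_c$, $v_i\in\mathfrak a_i$, restricted to $L$ (chosen so that $\{v\in L\mid l_G(v)\le1\}\ne\{0\}$ if $L\neq0$). For a set $\mathcal{P}$ of ideals of $L$ and $v\ne0$ put $D_{L,\mathcal{P}}(v)=\min\{[L:I]\mid I\in\mathcal{P}, v\notin I\}$, and $\mathrm{RF}^{\mathrm{Gui}}_{L,\mathcal{P}}(r)=\max\{D_{L,\mathcal{P}}(v)\mid v\in L,\ 0<l_G(v)\le r\}$ for $r\ge1$. $\mathcal{P}_{H\curvearrowright L}$ is the set of ideals $I$ of $L$ with $\xi(I)=I$ for all $\xi\in H$. Conventions: $\min\emptyset=\infty$, $\max\emptyset=1$. For non-decreasing $f,g:[1,\infty)\to[0,\infty]$, $f\preceq g$ means there is $C>0$ with $f(r)\le Cg(Cr)$ for all $r\ge\max\{1,1/C\}$; $f\approx g$ means $f\preceq g$ and $g\preceq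 f$. Up to $\approx$ these growth functions do not depend on the choices of $S$ or $l_G$. *)

(* Defs.v *)
(* MathComp / MathComp-Analysis *)
From HB Require Import structures.
From mathcomp Require Import all_boot all_order all_algebra.
From mathcomp Require Import all_classical all_reals all_analysis.
Set Implicit Arguments.
Unset Strict Implicit.
Unset Printing Implicit Defensive.
Import Order.TTheory GRing.Theory Num.Theory.
Local Open Scope classical_set_scope.
Local Open Scope ring_scope.

(* Subgroups, subrings, ideals, ... are sets of matrices, and the operations
   are those of the ambient space of matrices. *)

Section LRGroups.
Variable n : nat.
Local Notation M := 'M[rat]_n.
Implicit Types (A B : M) (G N L I S : set M).

Definition strictly_upper A := forall i j : 'I_n, (j <= i)%N -> A i j = 0.

(* A strictly upper triangular A has A ^+ n = 0, so that the truncated series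
   below are the full exponential of such an A and the full logarithm of a
   unipotent upper triangular matrix. *)
Definition mexp A : M := \sum_(0 <= k < n.+1) (k`!%:R)^-1 *: A ^+ k.
Definition mlog A : M :=
  \sum_(1 <= k < n.+1) ((-1) ^+ k.+1 / k%:R) *: (A - 1%:M) ^+ k.

Definition bch A B : M := mlog (mexp A *m mexp B).

Definition mlie A B : M := A *m B - B *m A.

(* In the group of strictly upper triangular matrices under bch, the identity
   is 0 and the inverse of A is - A. *)
Definition bch_subgroup G :=
  [/\ G 0, forall A B, G A -> G B -> G (bch A B) & forall A, G A -> G (- A)].

Definition is_word S (s : seq M) := forall A, A \in s -> S A \/ S (- A).

Definition bch_prod (s : seq M) : M := foldr bch 0 s.

Definition generates S G :=
  S `<=` G /\
  forall A, G A -> exists2 s : seq M, is_word S s & A = bch_prod s.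

Record LR_group G : Prop := {
  LR_upper : forall A, G A -> strictly_upper A;
  LR_subgroup : bch_subgroup G;
  LR_fg : exists2 S : set M, finite_set S & generates S G;
  LR_add : forall A B, G A -> G B -> G (A + B);
  LR_lie : forall A B, G A -> G B -> G (mlie A B) }.

(* As for permutation groups in MathComp, an automorphism of G is represented
   by its extension by the identity outside of G; distinct automorphisms are
   then distinct functions. *)
Definition is_aut G (f : M -> M) :=
  [/\ set_bij G G f, forall A, ~ G A -> f A = A
    & forall A B, G A -> G B -> f (bch A B) = bch (f A) (f B)].

Definition aut_subgroup G (H : set (M -> M)) :=
  [/\ H `<=` is_aut G, H id, forall f g, H f -> H g -> H (f \o g)
    & forall f, H f -> exists2 g, H g & cancel f g].

Definition normal_subgroup G N :=
  [/\ N `<=` G, bch_subgroup N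
    & forall g x, G g -> N x -> N (bch (bch g x) (- g))].

Definition lie_ideal L I :=
  [/\ I `<=` L, I 0 /\ (forall x y, I x -> I y -> I (x - y))
    & forall x y, I x -> L y -> I (mlie x y)].

Definition invariant_normal G (H : set (M -> M)) : set (set M) :=
  [set N | normal_subgroup G N /\ forall xi, H xi -> xi @` N = N].

Definition invariant_ideal L (H : set (M -> M)) : set (set M) :=
  [set I | lie_ideal L I /\ forall xi, H xi -> xi @` I = I].

End LRGroups.

Section Growth.
Variable R : realType.

(* The index is the number of left cosets, +oo if there are infinitely many. *)
Definition index_in (T : choiceType) (op : T -> T -> T) (G N : set T) : \bar R :=
  counting [set op g @` N | g in G].

(* As indices lie in {1, 2, ..., +oo}, the infimum is a minimum; it is +oo
   for the empty set. *)
Definition detect (T : choiceType) (op : T -> T -> T) (G : set T)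
    (P : set (set T)) (g : T) : \bar R :=
  ereal_inf [set index_in op G N | N in [set N | P N /\ ~ N g]].

(* Maximum with the convention that the maximum of the empty set is 1. *)
Definition emax (A : set (\bar R)) : \bar R :=
  if `[< A = set0 >] then 1%E else ereal_sup A.

Definition word_length n (S : set 'M[rat]_n) (g : 'M[rat]_n) : \bar R :=
  ereal_inf [set (size s)%:R%:E | s in [set s | is_word S s /\ g = bch_prod s]].

Definition RF_group n (G S : set 'M[rat]_n) (P : set (set 'M[rat]_n)) (r : R) :
    \bar R :=
  emax [set detect (@bch n) G P g |
        g in [set g | G g /\ (0 < word_length S g <= r%:E)%E]].

(* l is the length function used to measure elements of the Lie ring L. *)
Definition RF_lie n (L : set 'M[rat]_n) (l : 'M[rat]_n -> R)
    (P : set (set 'M[rat]_n)) (r : R) : \bar R :=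
  emax [set detect +%R L P v | v in [set v | L v /\ 0 < l v <= r]].

(* Only the values of f and g on [1, +oo[ matter. *)
Definition growth_le (f g : R -> \bar R) :=
  exists2 C : R, 0 < C &
    forall r : R, Num.max 1 C^-1 <= r -> (f r <= C%:E * g (C * r)%R)%E.

Definition growth_eq (f g : R -> \bar R) := growth_le f g /\ growth_le g f.

End Growth.

Section Guivarch.
Variables (R : realType) (gg : vectType R).

(* (gg, br) together with iota : L -> gg is the real Lie algebra obtained from
   the Lie ring L by extension of scalars: iota has the universal property of
   the map L -> L (x)_Z R, v |-> v (x) 1, and br is the R-bilinear extension of
   the bracket of L. Values of iota outside of L are irrelevant. *)
Record real_extension n (L : set 'M[rat]_n) (br : gg -> gg -> gg)
    (iota : 'M[rat]_n -> gg) : Prop := {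
  rext_add : forall x y, L x -> L y -> iota (x + y) = iota x + iota y;
  rext_univ : forall (W : lmodType R) (f : 'M[rat]_n -> W),
    (forall x y, L x -> L y -> f (x + y) = f x + f y) ->
    exists2 F : {linear gg -> W}, (forall x, L x -> F (iota x) = f x) &
      forall F' : {linear gg -> W},
        (forall x, L x -> F' (iota x) = f x) -> F' =1 F;
  rext_linl : forall w, linear (br^~ w);
  rext_linr : forall w, linear (br w);
  rext_lie : forall x y, L x -> L y -> br (iota x) (iota y) = iota (mlie x y) }.

Variable br : gg -> gg -> gg.

Definition brv (U V : {vspace gg}) : {vspace gg} :=
  <<[seq br x y | x <- vbasis U, y <- vbasis V]>>%VS.

(* Indexed so that lcs 1 is the whole space. *)
Definition lcs (i : nat) : {vspace gg} := iter i.-1 (brv^~ fullv) fullv.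

Definition nilpotency_class (c : nat) :=
  lcs c.+1 = 0%VS /\ forall k, lcs k.+1 = 0%VS -> (c <= k)%N.

Variable c : nat.

(* The index i : 'I_c stands for the weight i.+1, i.e. a i is the complement
   in degree i.+1 of the lower central series. *)
Definition lcs_splitting (a : 'I_c -> {vspace gg}) :=
  forall i : 'I_c,
    lcs i.+1 = (\sum_(j < c | (i <= j)%N) a j)%VS /\
    directv (\sum_(j < c | (i <= j)%N) a j).

Definition is_norm_on (V : {vspace gg}) (N : gg -> R) :=
  [/\ forall v, v \in V -> 0 <= N v,
      forall v, v \in V -> N v = 0 -> v = 0,
      forall (k : R) v, v \in V -> N (k *: v) = `|k| * N v
    & forall u v, u \in V -> v \in V -> N (u + v) <= N u + N v].

(* sumv_pi _ i v is the component of v in a i. *)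
Definition guivarch (a : 'I_c -> {vspace gg}) (N : 'I_c -> gg -> R) (v : gg) : R :=
  \big[Num.max/0]_(i < c) N i (sumv_pi (\sum_(j < c) a j)%VS i v) `^ (i.+1%:R)^-1.

End Guivarch.

(* Main.v *)
Require Import Defs.
From HB Require Import structures.
From mathcomp Require Import all_boot all_order all_algebra.
From mathcomp Require Import all_classical all_reals all_analysis.
From mathcomp Require Import ring zify.
(** Write L for the set G seen as a Lie ring. Both growth functions are suprema of
detection indices over balls of the same set, so it is enough to compare the
detection indices of one element (detect_comparable) and the two lengths of
one element (word_scaled_norm, scaled_norm_short_word), each up to a constant.

Everything rests on the Baker-Campbell-Hausdorff formula in the form bch_lie:
for fixed n, bch A B is A + B plus one fixed rational combination of brackets.
Here Z(t) = log (exp (t A) exp (t B)) is a polynomial in t with Z(0) = 0 that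
satisfies a differential equation expressed by brackets (bchpath_ode); comparing
coefficients shows inductively that those of Z are Lie polynomials in A and B.
Let d be a common denominator of the coefficients of the formula.

Detection. If J is an additive subgroup of L with [L, J] contained in d J, the
denominators of the formula are absorbed and bch x (y + j) lies in bch x y + J
(bch_perturb), so that the cosets of J for addition and for bch coincide. Every
ideal I contains such a J with d^n I inside J, the set hull, and J is a normal
subgroup. Conversely, a normal subgroup N contains D times the ideal
that it generates, with D depending only on n (malcev): modulo brackets of
higher order, commutators of elements of N are the brackets, and the error is
removed by downward induction on the nilpotent filtration. Passing from a
subgroup to a multiple of it raises indices by at most the index of E L in L
for a fixed E, which is finite because L lies in a lattice spanned by rational
multiples of brackets of generators (lattice_bound). Both constructions respect
invariance under automorphisms of G because these are additive and preserve
brackets; this follows from malcev applied to the graph of the automorphism,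
realised by block diagonal matrices.

Lengths. Let |v|_t be the sum over the weights i of N_i(v_i) / t^i. Up to
constants, |v|_t <= 1 says that the Guivarc'h length of v is at most t.
For t >= 1 the bracket satisfies |[x, y]|_t <= K |x|_t |y|_t with K independent
of t (scaled_norm_br), so that by bch_lie left multiplication by a generator,
which has norm O(1/t), increases |.|_t by O(1/t) as long as the norms are at
most 1. Hence a product of r generators has |.|_{lam r} <= 1 for a constant lam.
Conversely, let |v|_r <= 1. The leading coordinates of v in weight k have size
O(r^k), and r^k times an iterated bracket of k generators is a product of O(r)
generators up to terms of higher weight, since commutators of q-th powers
multiply coefficients by q^2 (short_word_bracket). This treats the integral parts
of the coordinates; the fractional parts take finitely many values, each treated
by a fixed word. Dividing v by the word so
obtained leaves an element of higher weight and comparable norm, and nilpotency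
ends the induction. *)

Set Implicit Arguments.
Unset Strict Implicit.
Unset Printing Implicit Defensive.
Import Order.TTheory GRing.Theory Num.Theory.
Local Open Scope classical_set_scope.
Local Open Scope ring_scope.

Local Notation su := strictly_upper.

(** * Truncated exponential and logarithm polynomials *)

Section TruncatedSeries.

Lemma dvdXnP (p : {poly rat}) (m : nat) :
  reflect (forall i, (i < m)%N -> p`_i = 0) ('X^m %| p).
Proof.
apply: (iffP idP) => [/dvdpP[q ->] i im|h].
  by rewrite coefMXn im.
apply/dvdpP; exists (\poly_(i < size p - m) p`_(i + m)); apply/polyP => i.
rewrite coefMXn coef_poly; case: ltnP => [/h//|mi]; rewrite subnK //.
case: ltnP => // h2; rewrite nth_default //; move: h2; move: (size p) => k h2; lia.
Qed.

Definition exp_poly m : {poly rat} := \poly_(k < m) (k`!%:R)^-1.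
Definition log_poly m : {poly rat} :=
  \poly_(k < m) (if k == 0%N then 0 else (-1) ^+ k.+1 / k%:R).

Lemma coef0_exp_poly m : (exp_poly m.+1)`_0 = 1.
Proof. by rewrite coef_poly /= invr1. Qed.

Lemma coef0_log_poly m : (log_poly m)`_0 = 0.
Proof. by rewrite coef_poly eqxx if_same. Qed.

Lemma deriv_exp_poly m :
  (exp_poly m.+1)^`() = exp_poly m.+1 - (m`!%:R)^-1 *: 'X^m.
Proof.
apply/polyP => i; rewrite coef_deriv coefB coefZ coefXn !coef_poly ltnS.
case: (ltngtP i m) => [im|im|->]; rewrite ?mulr0 ?subr0 ?ltnn.
- have -> : (i < m.+1)%N by lia.
  by rewrite factS natrM invfM mulrC -[LHS]mulr_natr -mulrA mulVf ?mulr1 ?pnatr_eq0.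
- by rewrite mul0rn ifF //; lia.
- by rewrite ltnSn mulr1 subrr mul0rn.
Qed.

Lemma deriv_log_poly m :
  (1 + 'X) * (log_poly m.+1)^`() = 1 - (-1) ^+ m *: 'X^m.
Proof.
apply/polyP => i; rewrite mulrDl mul1r coefD coefB coefZ coefXn coef1 coefXM.
rewrite !coef_deriv !coef_poly.
have E j : ((-1 : rat) ^+ j.+2 / j.+1%:R) *+ j.+1 = (-1) ^+ j.
  by rewrite -[LHS]mulr_natr mulfVK ?pnatr_eq0 // !exprS; ring.
case: i => [|i] /=.
  rewrite addr0 ltnS; case: m => [|m] /=; first by rewrite expr0 mulr1 subrr.
  by rewrite !mulr0 subr0 E.
rewrite !ltnS sub0r; case: (ltngtP i.+1 m) => [im|im|<-].
- by rewrite !E mulr0 oppr0 exprS mulN1r addNr.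
- by rewrite !mul0rn addr0 mulr0 oppr0.
- by rewrite E mul0rn add0r mulr1 exprS mulN1r opprK.
Qed.

(** Both polynomials have constant term 0, and modulo 'X^(m - 1) their derivatives agree
by the chain rule, since (1 + 'X) log' = 1 and exp' = exp up to the last term. *)
Lemma log_exp_poly m : 'X^m %| log_poly m \Po (exp_poly m - 1) - 'X.
Proof.
case: m => [|m]; first by rewrite expr0 dvd1p.
set f := exp_poly m.+1 - 1.
have Xf : 'X %| f.
  by rewrite -['X]expr1; apply/dvdXnP => -[|//] _;
    rewrite coefB coef0_exp_poly coef1 subrr.
have fm : 'X^m %| f ^+ m by rewrite dvdp_exp2r.
have Ed : 'X^m %| (log_poly m.+1 \Po f)^`() - 1.
  rewrite deriv_comp [f^`()]derivB derivC subr0 deriv_exp_poly.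
  have E : ((log_poly m.+1)^`() \Po f) * exp_poly m.+1 = 1 - (-1) ^+ m *: f ^+ m.
    have -> : exp_poly m.+1 = (1 + 'X) \Po f.
      by rewrite comp_polyD comp_polyX rmorph1 /f addrC subrK.
    rewrite mulrC -comp_polyM deriv_log_poly comp_polyB rmorph1.
    by rewrite comp_polyZ rmorphXn /= comp_polyX.
  rewrite mulrBr E -!mul_polyC; set a := (_ : rat)%:P; set c := _^-1%:P.
  have -> l' : 1 - a * f ^+ m - l' * (c * 'X^m) - 1
     = (- (l' * c)) * 'X^m - a * f ^+ m by ring.
  by rewrite dvdp_sub // dvdp_mull.
apply/dvdXnP => -[_|i im].
  rewrite coefB coefX subr0 -horner_coef0 horner_comp.
  rewrite [f.[0]]horner_coef0 /f coefB coef0_exp_poly coef1 subrr.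
  by rewrite horner_coef0 coef0_log_poly.
move/dvdXnP/(_ i im): Ed; rewrite coefB coef_deriv coef1 => /eqP.
rewrite coefB coefX eqSS subr_eq0 => /eqP.
case: i im => [|i] im /=; first by rewrite mulr1n => ->; rewrite subrr.
by move/eqP; rewrite mulrn_eq0 /= => /eqP ->; rewrite subr0.
Qed.

(** The composite g satisfies (1 + 'X) g' = g modulo 'X^(m - 1) and g(0) = 1, a recursion
that determines its coefficients of index below m and that 1 + 'X satisfies. *)
Lemma exp_log_poly m : (0 < m)%N -> 'X^m %| exp_poly m \Po log_poly m - (1 + 'X).
Proof.
case: m => // m _; set g := _ \Po _.
have Xl : 'X %| log_poly m.+1.
  by rewrite -['X]expr1; apply/dvdXnP => -[|//] _; rewrite coef0_log_poly.
have g0 : g`_0 = 1.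
  rewrite -horner_coef0 horner_comp [_.[0]]horner_coef0 coef0_log_poly.
  by rewrite horner_coef0 coef0_exp_poly.
have Ed : 'X^m %| (1 + 'X) * g^`() - g.
  rewrite deriv_comp deriv_exp_poly mulrCA deriv_log_poly comp_polyB -/g.
  rewrite comp_polyZ rmorphXn /= comp_polyX.
  set c := _^-1; set s := (-1) ^+ m; set l := log_poly _.
  have -> : (g - c *: l ^+ m) * (1 - s *: 'X^m) - g =
     (- (g - c *: l ^+ m) * s%:P) * 'X^m - c%:P * l ^+ m.
    by rewrite -!mul_polyC; ring.
  by rewrite dvdp_sub ?dvdp_mull ?dvdp_exp2r.
have rec i : (i < m)%N -> g`_i.+1 *+ i.+1 + g`_i *+ i = g`_i.
  move=> im; have /dvdXnP/(_ i im) := Ed.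
  rewrite coefB mulrDl mul1r coefD coefXM !coef_deriv => /eqP.
  by rewrite subr_eq0 => /eqP; case: i im => //= i im; rewrite ?mulr0n.
suff h i : (i < m.+1)%N -> g`_i = (1 + 'X)`_i.
  by apply/dvdXnP => i /h E; rewrite coefB E subrr.
elim: i => [_|i IH im]; first by rewrite coefD coefX coef1 g0 addr0.
have := rec i im; have := IH (ltnW im); case: i im {IH} => [|i] im.
  by rewrite !coefD !coefX !coef1 /= => ->; rewrite addr0 add0r mulr1n mulr0n addr0.
rewrite !coefD !coefX !coef1 /= !add0r => -> /eqP.
case: i im => [|i] im.
  by rewrite mulr1n -subr_eq0 addrK mulrn_eq0 => /eqP.
by rewrite mul0rn addr0 mulrn_eq0 => /eqP.
Qed.

End TruncatedSeries.

(** * Exponential and logarithm of strictly upper triangular matrices *)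

Section UpperMatrices.
Variables (K : comNzRingType) (n : nat).
Implicit Types X Y : 'M[K]_n.

(** The filtration of the upper triangular matrices by diagonals, in which products
add the exponents; over a general ring because the matrices below have
coefficients in rat or in {poly rat}. *)
Definition upper_by d X := forall i j : 'I_n, (j < i + d)%N -> X i j = 0.

Lemma upper_by0 d : upper_by d 0. Proof. by move=> i j _; rewrite mxE. Qed.

Lemma upper_byD d X Y : upper_by d X -> upper_by d Y -> upper_by d (X + Y).
Proof. by move=> hX hY i j ij; rewrite mxE hX // hY // addr0. Qed.

Lemma upper_byZ d a X : upper_by d X -> upper_by d (a *: X).
Proof. by move=> hX i j ij; rewrite mxE hX // mulr0. Qed.

Lemma upper_byN d X : upper_by d X -> upper_by d (- X).
Proof. by move=> hX; rewrite -scaleN1r; exact: upper_byZ. Qed.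

Lemma upper_by_sum d I (r : seq I) (P : pred I) (F : I -> 'M[K]_n) :
  (forall i, P i -> upper_by d (F i)) -> upper_by d (\sum_(i <- r | P i) F i).
Proof.
by move=> h; elim/big_ind: _ => //; [exact: upper_by0|exact: upper_byD].
Qed.

Lemma upper_byM d e X Y :
  upper_by d X -> upper_by e Y -> upper_by (d + e) (X *m Y).
Proof.
move=> hX hY i j ij; rewrite mxE big1 // => k _.
have [kd|dk] := ltnP k (i + d); first by rewrite hX // mul0r.
by rewrite hY ?mulr0 // (leq_trans ij) // addnA leq_add2r.
Qed.

Lemma upper_byW d e X : upper_by e X -> (d <= e)%N -> upper_by d X.
Proof. by move=> hX de i j ij; rewrite hX // (leq_trans ij) // leq_add2l. Qed.

Lemma upper_by_ge X : upper_by n X -> X = 0.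
Proof.
by move=> hX; apply/matrixP => i j; rewrite hX ?mxE // ltn_addl.
Qed.

End UpperMatrices.

Section MatrixExponential.
Variables (K : comNzRingType) (phi : {rmorphism rat -> K}) (n : nat).
Local Notation M := 'M[K]_n.+1.
Local Notation T := n.+2.
Implicit Types X Y Z U V : M.

Lemma upper_byX k d X : upper_by d X -> upper_by (k * d) (X ^+ k).
Proof.
move=> hX; elim: k => [|k IH].
  by move=> i j; rewrite mul0n addn0 expr0 mxE; case: eqVneq => // ->; rewrite ltnn.
by rewrite exprS mulSn; apply: upper_byM.
Qed.

Arguments upper_byX k {d X}.

Lemma upper_nil X k : upper_by 1 X -> (n < k)%N -> X ^+ k = 0.
Proof.
move=> hX nk; apply: upper_by_ge; apply: upper_byW (upper_byX k hX) _.
by rewrite muln1.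
Qed.

Lemma horner_mx_coef X (p : {poly K}) :
  horner_mx X p = \sum_(k < size p) p`_k *: X ^+ k.
Proof.
rewrite -{1}[p]coefK poly_def rmorph_sum; apply: eq_bigr => i _.
by rewrite /= horner_mxZ rmorphXn /= horner_mx_X.
Qed.

Lemma horner_mx_comp X (p q : {poly K}) :
  horner_mx X (p \Po q) = horner_mx (horner_mx X q) p.
Proof.
elim/poly_ind: p => [|p c IH]; first by rewrite comp_poly0 !rmorph0.
rewrite comp_polyD comp_polyM comp_polyX comp_polyC !rmorphD !rmorphM /= IH.
by rewrite !horner_mx_X !horner_mx_C.
Qed.

Definition series (p : {poly rat}) X := horner_mx X (map_poly phi p).

(** Nilpotency makes the value of a series depend on finitely many coefficients, so
that identities between truncated power series become identities of matrices. *)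
Lemma series_mod (p q : {poly rat}) X :
  upper_by 1 X -> 'X^T %| p - q -> series p X = series q X.
Proof.
move=> hX /dvdpP[r /eqP]; rewrite subr_eq => /eqP ->.
rewrite /series rmorphD rmorphM /= map_polyXn rmorphD rmorphM /= rmorphXn /=.
by rewrite horner_mx_X upper_nil // mulr0 add0r.
Qed.

Lemma series_poly (c : nat -> rat) m X :
  series (\poly_(k < m) c k) X = \sum_(k < m) phi (c k) *: X ^+ k.
Proof.
rewrite /series poly_def !rmorph_sum; apply: eq_bigr => i _ /=.
by rewrite map_polyZ horner_mxZ map_polyXn rmorphXn /= horner_mx_X.
Qed.

Definition gexp X := series (exp_poly T) X.
Definition glog X := series (log_poly T) (X - 1).

Lemma series_comp p q X : series (p \Po q) X = series p (series q X).
Proof. by rewrite /series map_comp_poly horner_mx_comp. Qed.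

Lemma seriesX X : series 'X X = X.
Proof. by rewrite /series map_polyX horner_mx_X. Qed.

Lemma series1 X : series 1 X = 1.
Proof. by rewrite /series !rmorph1. Qed.

Lemma seriesD p q X : series (p + q) X = series p X + series q X.
Proof. by rewrite /series !rmorphD. Qed.

Lemma seriesB p q X : series (p - q) X = series p X - series q X.
Proof. by rewrite /series !rmorphB. Qed.

Lemma gexpK X : upper_by 1 X -> glog (gexp X) = X.
Proof.
move=> hX; rewrite /glog /gexp -(series1 X) -seriesB -series_comp.
by rewrite -[RHS]seriesX; apply: series_mod => //; apply: log_exp_poly.
Qed.

Lemma glogK U : upper_by 1 (U - 1) -> gexp (glog U) = U.
Proof.
move=> hU; rewrite /glog /gexp -series_comp.
rewrite (series_mod hU (exp_log_poly _)) // seriesD series1 seriesX.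
by rewrite addrC subrK.
Qed.

Lemma glog_upper U : upper_by 1 (U - 1) -> upper_by 1 (glog U).
Proof.
move=> hU; rewrite /glog series_poly; apply: upper_by_sum => -[[|k] kp] _ /=.
  by rewrite rmorph0 scale0r; apply: upper_by0.
by apply: upper_byZ; apply: upper_byW (upper_byX _ hU) _; rewrite muln1.
Qed.

Lemma gexp_upper X : upper_by 1 X -> upper_by 1 (gexp X - 1).
Proof.
move=> hX; rewrite /gexp series_poly big_ord_recl /= invr1 rmorph1 scale1r.
rewrite expr0 addrC addKr; apply: upper_by_sum => k _.
by apply: upper_byZ; apply: upper_byW (upper_byX _ hX) _; rewrite muln1.
Qed.

Lemma unip_mul U V : upper_by 1 (U - 1) -> upper_by 1 (V - 1) ->
  upper_by 1 (U * V - 1).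
Proof.
move=> hU hV; have -> : U * V - 1 = (U - 1) * (V - 1) + ((U - 1) + (V - 1)).
  by rewrite mulrBl mul1r mulrBr mulr1 [U - 1 + _]addrC addrA subrK addrA subrK.
by apply: upper_byD; [exact: (@upper_byW _ _ 1 (1 + 1) _ (upper_byM hU hV))|apply: upper_byD].
Qed.

Definition exp_term k X : M := phi (k`!%:R)^-1 *: X ^+ k.

Lemma exp_term0 X : exp_term 0 X = 1. Proof. by rewrite /exp_term invr1 rmorph1 scale1r. Qed.

Lemma gexpE X m : upper_by 1 X -> (n < m)%N -> gexp X = \sum_(k < m) exp_term k X.
Proof.
move=> hX nm; rewrite /gexp series_poly.
have E k : (n.+1 <= k)%N ->
    \sum_(i < k) phi (i`!%:R)^-1 *: X ^+ i = \sum_(i < n.+1) exp_term i X.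
  move=> nk; rewrite [RHS](big_ord_widen _ (fun i => exp_term i X) nk).
  rewrite [RHS]big_mkcond; apply: eq_bigr => i _.
  by case: ltnP => // ni; rewrite upper_nil ?scaler0.
by rewrite !E.
Qed.

Lemma exp_termS k X : exp_term k.+1 X *+ k.+1 = X * exp_term k X.
Proof.
rewrite /exp_term -scaler_nat scalerA -scalerAr exprS; congr (_ *: _).
rewrite -[k.+1%:R](rmorph_nat phi) -rmorphM factS natrM invfM mulrA divff ?mul1r // pnatr_eq0.
Qed.

Lemma exp_termSr k X : exp_term k.+1 X *+ k.+1 = exp_term k X * X.
Proof. by rewrite exp_termS /exp_term -scalerAr -scalerAl -exprS -exprSr. Qed.

End MatrixExponential.

(** Recursion for a Cauchy product: multiplying its term of degree m + 1 by m + 1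
splits the factor between the two indices. With terms of exponential series for
F, the right-hand side is an operator applied to the term of degree m. *)
Lemma conv_rec (V : zmodType) (F : nat -> nat -> V) m :
  (\sum_(i < m.+2) F i (m.+1 - i)%N) *+ m.+1 =
  \sum_(i < m.+1) F i.+1 (m - i)%N *+ i.+1
    + \sum_(i < m.+1) F i (m - i).+1 *+ (m - i).+1.
Proof.
rewrite -sumrMnl.
have E (i : 'I_m.+2) : F i (m.+1 - i)%N *+ m.+1 =
    F i (m.+1 - i)%N *+ i + F i (m.+1 - i)%N *+ (m.+1 - i).
  by rewrite -mulrnDr subnKC // -ltnS.
rewrite (eq_bigr _ (fun i _ => E i)) big_split /=; congr (_ + _).
  by rewrite big_ord_recl mulr0n add0r; apply: eq_bigr => i _.
rewrite big_ord_recr /= subnn mulr0n addr0; apply: eq_bigr => i _.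
by rewrite subSn // -ltnS.
Qed.

(** Splits a product of two truncated series into homogeneous terms, to which conv_rec
applies. *)
Lemma diag_sum (V : zmodType) (F : nat -> nat -> V) m :
  (forall i j, (m <= i)%N || (m <= j)%N -> F i j = 0) ->
  \sum_(k < m.*2) \sum_(i < k.+1) F i (k - i)%N =
  \sum_(i < m) \sum_(j < m) F i j.
Proof.
move=> F0.
under eq_bigr => k _ do
  rewrite (big_ord_widen _ (fun i => F i (k - i)%N) (ltn_ord k)).
rewrite (exchange_big_dep xpredT) //=.
have le : (m <= m.*2)%N by rewrite -addnn leq_addr.
rewrite (big_ord_widen _ (fun i => \sum_(j < m) F i j) le) [RHS]big_mkcond /=.
apply: eq_bigr => i _; case: ltnP => im; last first.
  by rewrite big1 // => k _; rewrite F0 // im.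
have le' : (m <= m.*2 - i)%N by move: im; clear; case: i => i /= _; lia.
rewrite (big_ord_widen _ (fun j => F i j) le') [RHS]big_mkcond /=.
rewrite -(big_mkord (fun k => (i < k.+1)%N) (fun k => F i (k - i)%N)).
rewrite -(big_nat_widenl i 0 _ xpredT) // -{1}[nat_of_ord i]add0n big_addn big_mkord.
by apply: eq_bigr => j _; rewrite addnK; case: ltnP => // mj; rewrite F0 // mj orbT.
Qed.

(** * Conjugation, derivations and one-parameter groups *)

Section ExponentialIdentities.
Variables (K : comNzRingType) (phi : {rmorphism rat -> K}) (n : nat).
Local Notation M := 'M[K]_n.+1.
Local Notation expt := (exp_term phi).
Local Notation gexp := (@gexp K phi n).
Local Notation fct m := (phi (m`!%:R)^-1).
Implicit Types X Y Z U V : M.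

Definition ad Z X : M := Z * X - X * Z.

Lemma mulrS_inj X Y k : X *+ k.+1 = Y *+ k.+1 -> X = Y.
Proof.
move=> E; have h (Z : M) : phi (k.+1%:R)^-1 *: (Z *+ k.+1) = Z.
  rewrite -scaler_nat scalerA -(rmorph_nat phi) -rmorphM mulVf ?rmorph1 ?scale1r //.
by rewrite -[X]h E h.
Qed.

Lemma fctS k X : (fct k.+1 *: X) *+ k.+1 = fct k *: X.
Proof.
rewrite -scaler_nat scalerA -[k.+1%:R](rmorph_nat phi) -rmorphM factS natrM invfM.
by rewrite mulrA divff ?mul1r // pnatr_eq0.
Qed.

Lemma adZ a Z X : ad Z (a *: X) = a *: ad Z X.
Proof. by rewrite /ad -scalerAr -scalerAl scalerBr. Qed.

Lemma exp_term_ge k X : upper_by 1 X -> (n < k)%N -> expt k X = 0.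
Proof. by move=> hX nk; rewrite /exp_term upper_nil ?scaler0. Qed.

(** The term of degree m + 1 of the Cauchy product is ad X applied to the term of
degree m, divided by m + 1. *)
Lemma gexpN_conj X Y : upper_by 1 X ->
  gexp X * Y * gexp (- X) =
  \sum_(m < (n.+1).*2) fct m *: iter m (ad X) Y.
Proof.
move=> hX; pose F i j := expt i X * Y * expt j (- X).
have hNX := upper_byN hX.
transitivity (\sum_(i < n.+1) \sum_(j < n.+1) F i j).
  rewrite (gexpE phi hX (ltnSn n)) (gexpE phi hNX (ltnSn n)) !mulr_suml.
  by apply: eq_bigr => i _; rewrite mulr_sumr.
rewrite -diag_sum => [|i j /orP[]h]; last 2 first.
- by rewrite /F exp_term_ge // !mul0r.
- by rewrite /F [expt j _]exp_term_ge // mulr0.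
apply: eq_bigr => -[m /= _] _; elim: m => [|m IH].
  by rewrite big_ord1 /F !exp_term0 mul1r mulr1 invr1 rmorph1 scale1r.
apply: (@mulrS_inj _ _ m); rewrite conv_rec fctS /= -adZ -IH /ad mulr_sumr mulr_suml.
rewrite -sumrN; congr (_ + _); apply: eq_bigr => i _.
  by rewrite /F -mulrnAl -mulrnAl exp_termS !mulrA.
by rewrite /F -mulrnAr exp_termSr mulrN mulrN !mulrA.
Qed.

Section Derivation.
Variable delta : {additive M -> M}.
Hypothesis deltaM : forall X Y, delta (X * Y) = delta X * Y + X * delta Y.

(** The terms c m Y of the Cauchy product of exp (- Z) with delta (exp Z * Y) satisfy
(m + 1) c (m + 1) Y = c m (Z Y) - Z c m Y. The extra factor Y makes the
recursion close; it is taken to be 1 at the end. *)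
Lemma gexpN_derivation Z : upper_by 1 Z ->
  gexp (- Z) * delta (gexp Z) =
  \sum_(m < (n.*2).+1) fct m.+1 *: iter m (ad (- Z)) (delta Z).
Proof.
move=> hZ; have hNZ := upper_byN hZ.
pose F Y i j := expt i (- Z) * delta (expt j Z * Y).
have F0 Y i j : (n.+1 <= i)%N || (n.+1 <= j)%N -> F Y i j = 0.
  rewrite /F => /orP[] h; first by rewrite [expt i _]exp_term_ge // mul0r.
  by rewrite [expt j _]exp_term_ge // mul0r raddf0 mulr0.
pose c m Y := \sum_(i < m.+1) F Y i (m - i)%N.
have cS m Y : c m.+1 Y *+ m.+1 = - Z * c m Y + c m (Z * Y).
  rewrite /c conv_rec mulr_sumr; congr (_ + _); apply: eq_bigr => i _.
    by rewrite /F -mulrnAl exp_termS !mulrA.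
  by rewrite /F -mulrnAr -raddfMn -mulrnAl exp_termSr mulrA.
have c0 Y : c 0 Y = delta Y by rewrite /c big_ord1 /F !exp_term0 !mul1r.
have cE m Y : c m.+1 Y = fct m.+1 *: iter m (ad (- Z)) (delta Z) * Y.
  elim: m Y => [|m IH] Y.
    rewrite -[LHS]mulr1n cS !c0 deltaM mulNr addrCA addNr addr0 /=.
    by rewrite invr1 rmorph1 scale1r.
  apply: (@mulrS_inj _ _ m.+1); rewrite cS !IH -[RHS]mulrnAl fctS /= -adZ; set W := _ *: _.
  by rewrite /ad mulrN opprK mulrDl !mulrA.
have delta1 : delta 1 = 0.
  by have /eqP := deltaM 1 1; rewrite !mul1r mulr1 -subr_eq0 opprD addrA subrr
   add0r oppr_eq0 => /eqP.
transitivity (\sum_(i < n.+1) \sum_(j < n.+1) F 1 i j).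
  rewrite (gexpE phi hZ (ltnSn n)) (gexpE phi hNZ (ltnSn n)) mulr_suml raddf_sum.
  by apply: eq_bigr => i _; rewrite mulr_sumr; apply: eq_bigr => j _; rewrite /F mulr1.
rewrite -(diag_sum (F0 1)) doubleS big_ord_recl.
have -> : \sum_(i < (@ord0 n.*2.+1).+1) F 1 i (@ord0 n.*2.+1 - i)%N = 0.
  by rewrite -[RHS]delta1 -c0.
by rewrite add0r; apply: eq_bigr => m _; rewrite -[RHS]mulr1 -cE.
Qed.

End Derivation.

Lemma gexp_add (a b : rat) X : upper_by 1 X ->
  gexp (phi a *: X) * gexp (phi b *: X) = gexp (phi (a + b) *: X).
Proof.
move=> hX; pose F i j := expt i (phi a *: X) * expt j (phi b *: X).
have h q : upper_by 1 (phi q *: X) by apply: upper_byZ.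
transitivity (\sum_(i < n.+1) \sum_(j < n.+1) F i j).
  rewrite (gexpE phi (h a) (ltnSn n)) (gexpE phi (h b) (ltnSn n)) !mulr_suml.
  by apply: eq_bigr => i _; rewrite mulr_sumr.
rewrite -diag_sum => [|i j /orP[]hi]; last 2 first.
- by rewrite /F exp_term_ge // !mul0r.
- by rewrite /F [expt j _]exp_term_ge // mulr0.
have nn : (n < (n.+1).*2)%N by rewrite doubleS; lia.
rewrite (gexpE phi (h _) nn); apply: eq_bigr => -[m /= _] _.
elim: m => [|m IH]; first by rewrite big_ord1 /F !exp_term0 mulr1.
apply: (@mulrS_inj _ _ m); rewrite conv_rec exp_termSr -IH rmorphD scalerDl.
rewrite mulrDr !mulr_suml; congr (_ + _); apply: eq_bigr => i _.
  rewrite /F -mulrnAl exp_termSr -!mulrA; congr (_ * _).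
  rewrite /exp_term !exprZn -!scalerAl -!scalerAr -exprS -exprSr.
  by rewrite !scalerA; congr (_ *: _); ring.
by rewrite /F -mulrnAr exp_termSr mulrA.
Qed.

Lemma gexp0 : gexp 0 = 1.
Proof.
rewrite (gexpE phi (@upper_by0 _ _ 1) (ltnSn n)) big_ord_recl exp_term0 big1 ?addr0 //.
by move=> i _; rewrite /exp_term expr0n scaler0.
Qed.

Lemma gexpN X : upper_by 1 X -> gexp X * gexp (- X) = 1.
Proof.
move=> hX; have := gexp_add 1 (-1) hX.
by rewrite rmorph1 rmorphN1 scale1r scaleN1r subrr rmorph0 scale0r gexp0.
Qed.

Lemma gexpNl X : upper_by 1 X -> gexp (- X) * gexp X = 1.
Proof. by move=> hX; rewrite -{2}[X]opprK gexpN //; apply: upper_byN. Qed.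

Lemma series_conj p U V X : U * V = 1 -> V * U = 1 ->
  series phi p (U * X * V) = U * series phi p X * V.
Proof.
move=> UV VU; rewrite /series !horner_mx_coef mulr_sumr mulr_suml.
apply: eq_bigr => k _; rewrite -scalerAr -scalerAl; congr (_ *: _).
elim: (nat_of_ord k) => [|m IH]; first by rewrite !expr0 mulr1 UV.
by rewrite !exprS IH !mulrA -[_ * V * U]mulrA VU mulr1.
Qed.

End ExponentialIdentities.

(** * Lie polynomials in two variables *)

Inductive lie_word := LX | LY | LB of lie_word & lie_word.

Definition is_bracket w := if w is LB _ _ then true else false.

Fixpoint word_eval (T : Type) (br : T -> T -> T) (x y : T) (w : lie_word) : T :=
  match w with
  | LX => x
  | LY => y
  | LB u v => br (word_eval br x y u) (word_eval br x y v)
  end.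

Definition lie_eval n (l : seq (rat * lie_word)) (A B : 'M[rat]_n) : 'M[rat]_n :=
  \sum_(c <- l) c.1 *: word_eval (@mlie n) A B c.2.

Section MlieLinear.
Variable n : nat.
Implicit Types A B C : 'M[rat]_n.

Lemma mlieDl A B C : mlie (A + B) C = mlie A C + mlie B C.
Proof. by rewrite /mlie mulmxDl mulmxDr opprD addrACA. Qed.

Lemma mlieC A B : mlie A B = - mlie B A.
Proof. by rewrite /mlie opprB. Qed.

Lemma mlieDr A B C : mlie A (B + C) = mlie A B + mlie A C.
Proof. by rewrite !(mlieC A) mlieDl opprD. Qed.

Lemma mlieZl a A B : mlie (a *: A) B = a *: mlie A B.
Proof. by rewrite /mlie -scalemxAl -scalemxAr scalerBr. Qed.

Lemma mlieZr a A B : mlie A (a *: B) = a *: mlie A B.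
Proof. by rewrite !(mlieC A) mlieZl scalerN. Qed.

Lemma mlieNl A B : mlie (- A) B = - mlie A B.
Proof. by rewrite -scaleN1r mlieZl scaleN1r. Qed.

Lemma mlieNr A B : mlie A (- B) = - mlie A B.
Proof. by rewrite -scaleN1r mlieZr scaleN1r. Qed.

Lemma mlie0l A : mlie 0 A = 0.
Proof. by rewrite /mlie mul0mx mulmx0 subrr. Qed.

Lemma mlie0r A : mlie A 0 = 0.
Proof. by rewrite /mlie mul0mx mulmx0 subrr. Qed.

Lemma mlieBl A B C : mlie (A - B) C = mlie A C - mlie B C.
Proof. by rewrite mlieDl mlieNl. Qed.

Lemma mlieBr A B C : mlie A (B - C) = mlie A B - mlie A C.
Proof. by rewrite mlieDr mlieNr. Qed.

Lemma mliexx A : mlie A A = 0.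
Proof. by rewrite /mlie subrr. Qed.

Lemma mlie_jacobi A B C : mlie (mlie A B) C = mlie A (mlie B C) - mlie B (mlie A C).
Proof.
rewrite /mlie !(mulmxBl, mulmxBr) !mulmxA.
move: (A *m B *m C) (B *m A *m C) (C *m A *m B) => a b c.
move: (C *m B *m A) (A *m C *m B) (B *m C *m A) => d e f.
by apply/matrixP => i j; rewrite !mxE; ring.
Qed.

Lemma mlie_sumr A I (r : seq I) (P : pred I) F :
  mlie A (\sum_(i <- r | P i) F i) = \sum_(i <- r | P i) mlie A (F i).
Proof. exact: (big_morph _ (mlieDr A) (mlie0r A)). Qed.

Lemma mlie_suml A I (r : seq I) (P : pred I) F :
  mlie (\sum_(i <- r | P i) F i) A = \sum_(i <- r | P i) mlie (F i) A.
Proof.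
by apply: (big_morph (fun B => mlie B A)) => [B C|]; rewrite ?mlieDl ?mlie0l.
Qed.

End MlieLinear.

Section LiePolynomials.
Variable n : nat.
Local Notation M := 'M[rat]_n.
Implicit Types (A B : M) (f g : M -> M -> M).

(** The list l is chosen before A and B: one formula for all pairs. *)
Definition lie_polynomial f := exists l, forall A B,
  upper_by 1 A -> upper_by 1 B -> f A B = lie_eval l A B.

Lemma lp_ext f g : lie_polynomial g ->
  (forall A B, upper_by 1 A -> upper_by 1 B -> f A B = g A B) ->
  lie_polynomial f.
Proof. by move=> [l hl] fg; exists l => A B hA hB; rewrite fg ?hl. Qed.

Lemma lp0 : lie_polynomial (fun _ _ => 0).
Proof. by exists [::] => A B _ _; rewrite /lie_eval big_nil. Qed.

Lemma lpX : lie_polynomial (fun A _ => A).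
Proof. by exists [:: (1, LX)] => A B _ _; rewrite /lie_eval big_seq1 scale1r. Qed.

Lemma lpY : lie_polynomial (fun _ B => B).
Proof. by exists [:: (1, LY)] => A B _ _; rewrite /lie_eval big_seq1 scale1r. Qed.

Lemma lpD f g : lie_polynomial f -> lie_polynomial g ->
  lie_polynomial (fun A B => f A B + g A B).
Proof.
move=> [l hl] [k hk]; exists (l ++ k) => A B hA hB.
by rewrite hl // hk // /lie_eval big_cat.
Qed.

Lemma lpZ a f : lie_polynomial f -> lie_polynomial (fun A B => a *: f A B).
Proof.
move=> [l hl]; exists [seq (a * c.1, c.2) | c <- l] => A B hA hB.
rewrite hl // /lie_eval big_map scaler_sumr.
by apply: eq_bigr => c _; rewrite scalerA.
Qed.

Lemma lpN f : lie_polynomial f -> lie_polynomial (fun A B => - f A B).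
Proof.
by move=> /(lpZ (-1)) h; apply: lp_ext h _ => A B _ _; rewrite scaleN1r.
Qed.

Lemma lp_bracket f g : lie_polynomial f -> lie_polynomial g ->
  lie_polynomial (fun A B => mlie (f A B) (g A B)).
Proof.
move=> [l hl] [k hk].
exists [seq (c.1 * d.1, LB c.2 d.2) | c <- l, d <- k] => A B hA hB.
rewrite hl // hk // /lie_eval big_allpairs_dep mlie_suml.
apply: eq_bigr => c _; rewrite mlie_sumr.
by apply: eq_bigr => d _; rewrite mlieZl mlieZr scalerA.
Qed.

Lemma lp_sum m (F : nat -> M -> M -> M) :
  (forall i, (i < m)%N -> lie_polynomial (F i)) ->
  lie_polynomial (fun A B => \sum_(i < m) F i A B).
Proof.
elim: m => [|m IH] h.
  by apply: lp_ext lp0 _ => A B _ _; rewrite big_ord0.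
have h1 : lie_polynomial (fun A B => \sum_(i < m) F i A B).
  by apply: IH => i im; apply: h; exact: ltnW.
apply: lp_ext (lpD h1 (h m (ltnSn m))) _ => A B _ _.
by rewrite big_ord_recr.
Qed.

End LiePolynomials.

(** * The differential equation behind the Baker-Campbell-Hausdorff formula *)

Section BCHRecursion.
Variable n : nat.
Local Notation Q := {poly rat}.
Local Notation M := 'M[rat]_n.+1.
Local Notation MP := 'M[Q]_n.+1.
Local Notation C := (@polyC rat : {rmorphism rat -> Q}).
Local Notation gexp := (@gexp Q C n).
Local Notation fct m := (C (m`!%:R)^-1).
Implicit Types (A B : M) (X Y Z P : MP).

Definition coef_mx j P : M := map_mx (coefp j) P.

Lemma coef_mxD j P P' : coef_mx j (P + P') = coef_mx j P + coef_mx j P'.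
Proof. by apply/matrixP => a b; rewrite !mxE /= coefD. Qed.

Lemma coef_mxN j P : coef_mx j (- P) = - coef_mx j P.
Proof. by apply/matrixP => a b; rewrite !mxE /= coefN. Qed.

Lemma coef_mx0 j : coef_mx j 0 = 0.
Proof. by apply/matrixP => a b; rewrite !mxE /= coef0. Qed.

Lemma coef_mxZ j c P : coef_mx j (C c *: P) = c *: coef_mx j P.
Proof. by apply/matrixP => a b; rewrite !mxE /= coefCM. Qed.

Lemma coef_mx_sum j I (r : seq I) (F : I -> MP) :
  coef_mx j (\sum_(i <- r) F i) = \sum_(i <- r) coef_mx j (F i).
Proof. exact: (big_morph _ (coef_mxD j) (coef_mx0 j)). Qed.

Lemma coef_mxM j P P' : coef_mx j (P * P') = \sum_(i < j.+1) coef_mx i P * coef_mx (j - i) P'.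
Proof.
apply/matrixP => a b; rewrite summxE !mxE /= coef_sum.
transitivity (\sum_k \sum_(i < j.+1) (P a k)`_i * (P' k b)`_(j - i)).
  by apply: eq_bigr => k _; exact: coefM.
rewrite exchange_big /=; apply: eq_bigr => i _; rewrite mxE.
by apply: eq_bigr => k _; rewrite !mxE.
Qed.

Definition deltamx P : MP := map_mx (@deriv rat) P.

Lemma deltamx_is_additive : zmod_morphism deltamx.
Proof. by move=> P P'; apply/matrixP => a b; rewrite !mxE derivB. Qed.
HB.instance Definition _ := GRing.isZmodMorphism.Build MP MP deltamx deltamx_is_additive.

Lemma deltamxM P P' : deltamx (P * P') = deltamx P * P' + P * deltamx P'.
Proof.
apply/matrixP => a b; rewrite !mxE (raddf_sum (@deriv rat)) -big_split /=.
by apply: eq_bigr => k _; rewrite !mxE derivM.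
Qed.

Lemma coef_mx_delta j P : coef_mx j (deltamx P) = coef_mx j.+1 P *+ j.+1.
Proof. by apply/matrixP => a b; rewrite mxE mulmxnE !mxE /= coef_deriv. Qed.

Definition line A : MP := 'X *: map_mx C A.

Lemma line_upper A : upper_by 1 A -> upper_by 1 (line A).
Proof. by move=> hA i j ij; rewrite !mxE hA // rmorph0 mulr0. Qed.

Lemma coef_mx_line j A : coef_mx j (line A) = if j == 1%N then A else 0.
Proof.
apply/matrixP => a b; rewrite !mxE /= coefXM coefC.
by case: j => [|[|j]] //=; rewrite mxE.
Qed.

Lemma coef_mx_const j A : coef_mx j (map_mx C A) = if j == 0%N then A else 0.
Proof. by apply/matrixP => a b; rewrite !mxE /= coefC; case: eqP; rewrite ?mxE. Qed.

Lemma delta_const (p : Q) A : deltamx (p *: map_mx C A) = p^`() *: map_mx C A.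
Proof. by apply/matrixP => a b; rewrite !mxE derivM derivC mulr0 addr0. Qed.

Lemma expr_line k A : line A ^+ k = 'X^k *: map_mx C (A ^+ k).
Proof. by rewrite /line exprZn -rmorphXn. Qed.

Lemma delta_gexp_line A : upper_by 1 A ->
  deltamx (gexp (line A)) = gexp (line A) * map_mx C A.
Proof.
move=> /line_upper hA.
rewrite {1}(gexpE C hA (leqW (ltnSn n))) (gexpE C hA (ltnSn n)).
rewrite raddf_sum big_ord_recl mulr_suml /= exp_term0.
have -> : deltamx 1 = 0.
  by apply/matrixP => a b; rewrite !mxE; case: eqP => _; rewrite ?rmorph1 ?rmorph0 derivC.
rewrite add0r; apply: eq_bigr => k _; rewrite /exp_term !expr_line !scalerA /=.
rewrite -scalerAl -rmorphM /= -exprSr delta_const /bump add1n.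
congr (_ *: _); rewrite !mul_polyC derivZ derivXn /= -scaler_nat scalerA.
by congr (_ *: _); rewrite factS natrM invfM mulrC mulrA divff ?mul1r.
Qed.

Definition bchpath A B : MP := glog C (gexp (line A) * gexp (line B)).

Section Fixed.
Variables (A B : M).
Hypotheses (hA : upper_by 1 A) (hB : upper_by 1 B).
Let hLA := line_upper hA.
Let hLB := line_upper hB.

Lemma path_unip : upper_by 1 (gexp (line A) * gexp (line B) - 1).
Proof. by apply: unip_mul; apply: gexp_upper. Qed.

Lemma bchpath_upper : upper_by 1 (bchpath A B).
Proof. exact/glog_upper/path_unip. Qed.

(** Both sides are exp (- Z) (exp Z)', where Z is the path: the left one for a general
Z, the right one from exp Z = exp (t A) exp (t B), which gives
B + exp (- t B) A exp (t B). *)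
Lemma bchpath_ode :
  \sum_(m < (n.*2).+1)
     fct m.+1 *: iter m (ad (- bchpath A B)) (deltamx (bchpath A B)) =
  map_mx C B + \sum_(m < (n.+1).*2) fct m *: iter m (ad (- line B)) (map_mx C A).
Proof.
have hZ := bchpath_upper; have EZ : gexp (bchpath A B) = gexp (line A) * gexp (line B).
  by rewrite /bchpath glogK //; exact: path_unip.
rewrite -(gexpN_derivation C deltamxM hZ) -(gexpN_conj C _ (upper_byN hLB)) opprK.
have -> : gexp (- bchpath A B) = gexp (- line B) * gexp (- line A).
  rewrite -[LHS]mulr1 -(gexpN C hLA) -{1}[gexp (line A)]mulr1 -(gexpN C hLB).
  by rewrite !mulrA -[_ * _ * gexp (line B)]mulrA -EZ gexpNl // mul1r.
rewrite EZ /= deltamxM !delta_gexp_line // mulrDr -!mulrA addrC; congr (_ + _).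
  by rewrite !mulrA -[_ * _ * gexp (line A)]mulrA !gexpNl // mulr1 gexpNl // mul1r.
by rewrite !mulrA -[_ * _ * gexp (line A)]mulrA !gexpNl // mulr1.
Qed.

End Fixed.

End BCHRecursion.

(** * The Baker-Campbell-Hausdorff formula with coefficients depending only on the dimension *)

Section BCHLie.
Variable n : nat.
Local Notation Q := {poly rat}.
Local Notation M := 'M[rat]_n.+1.
Local Notation MP := 'M[Q]_n.+1.
Local Notation C := (@polyC rat : {rmorphism rat -> Q}).
Implicit Types (A B : M) (X Y Z P : M -> M -> MP).

Definition lie_coef j P := lie_polynomial (fun A B => coef_mx j (P A B)).

Lemma coef_mx_ad j (Z X : MP) :
  coef_mx j (ad (- Z) X) = \sum_(i < j.+1) mlie (coef_mx i X) (coef_mx (j - i) Z).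
Proof.
rewrite /ad mulNr mulrN opprK addrC coef_mxD coef_mxN !coef_mxM.
rewrite [X in _ - X](reindex_inj rev_ord_inj) -sumrB.
apply: eq_bigr => i _ /=; rewrite subSS subKn // -ltnS; exact: ltn_ord.
Qed.

(** As Z has no constant term, the coefficient of degree l of ad (- Z) X involves only
the coefficients of X of degree below l. *)
Lemma lie_coef_ad j Z X : (forall i, (i <= j)%N -> lie_coef i Z) ->
  (forall A B, upper_by 1 A -> upper_by 1 B -> coef_mx 0 (Z A B) = 0) ->
  (forall i, (i < j)%N -> lie_coef i X) ->
  forall l, (l <= j)%N -> lie_coef l (fun A B => ad (- Z A B) (X A B)).
Proof.
move=> hZ Z0 hX l lj.
apply: (lp_ext (g := fun A B => \sum_(i < l) mlie (coef_mx i (X A B)) (coef_mx (l - i) (Z A B)))).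
  apply: (lp_sum (F := fun i A B => mlie (coef_mx i (X A B)) (coef_mx (l - i) (Z A B)))) => i il.
  by apply: lp_bracket; [apply: hX; apply: leq_trans il lj|apply: hZ; lia].
by move=> A B hA hB; rewrite coef_mx_ad big_ord_recr /= subnn Z0 // mlie0r addr0.
Qed.

Lemma lie_coef_iter_ad j Z X : (forall i, (i <= j)%N -> lie_coef i Z) ->
  (forall A B, upper_by 1 A -> upper_by 1 B -> coef_mx 0 (Z A B) = 0) ->
  (forall i, (i < j)%N -> lie_coef i X) -> forall m,
  lie_coef j (fun A B => iter m.+1 (ad (- Z A B)) (X A B)).
Proof.
move=> hZ Z0 hX m.
suff h l : (l <= j)%N -> lie_coef l (fun A B => iter m.+1 (ad (- Z A B)) (X A B)) by exact: h.
elim: m l => [|m IH] l lj; first exact: (lie_coef_ad hZ Z0 hX lj).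
by apply: (lie_coef_ad hZ Z0 _ lj) => i ij; apply: IH; exact: ltnW.
Qed.

Lemma lie_coef_line j : lie_coef j (fun _ B => line B).
Proof.
case: (eqVneq j 1%N) => [->|j1].
  by apply: lp_ext (@lpY n.+1) _ => A B _ _; rewrite coef_mx_line.
by apply: lp_ext (@lp0 n.+1) _ => A B _ _; rewrite coef_mx_line (negbTE j1).
Qed.

Lemma lie_coef_rhs j m : lie_coef j (fun A B => iter m (ad (- line B)) (map_mx C A)).
Proof.
have base l : lie_coef l (fun A B => map_mx C A).
  case: (eqVneq l 0%N) => [->|j1].
    by apply: lp_ext (@lpX n.+1) _ => A B _ _; rewrite coef_mx_const.
  by apply: lp_ext (@lp0 n.+1) _ => A B _ _; rewrite coef_mx_const (negbTE j1).
case: m => [|m]; first exact: base.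
apply: (@lie_coef_iter_ad j (fun _ B => line B)) => [i _|A B _ _|i _].
- exact: lie_coef_line.
- by rewrite coef_mx_line.
- exact: base.
Qed.

Lemma map_series (a : rat) p (X : MP) :
  map_mx (horner_eval a) (series C p X) = series idfun p (map_mx (horner_eval a) X).
Proof.
rewrite /series map_horner_mx; congr horner_mx.
rewrite -map_poly_comp; apply: eq_map_poly => x /=.
by rewrite /horner_eval hornerC.
Qed.

Lemma bchpath_eval a A B : map_mx (horner_eval a) (bchpath A B) =
  glog idfun (gexp idfun (a *: A) * gexp idfun (a *: B)).
Proof.
have E D : map_mx (horner_eval a) (line D) = a *: D.
  by apply/matrixP => i j; rewrite !mxE /= /horner_eval hornerM hornerX hornerC.
rewrite /bchpath /glog map_series rmorphB rmorphM rmorph1 /gexp /=.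
by rewrite !map_series !E.
Qed.

Lemma bchpath0 A B : upper_by 1 A -> upper_by 1 B -> coef_mx 0 (bchpath A B) = 0.
Proof.
move=> hA hB; have -> : coef_mx 0 (bchpath A B) = map_mx (horner_eval 0) (bchpath A B).
  by apply/matrixP => i j; rewrite !mxE /= horner_evalE horner_coef0.
rewrite bchpath_eval !scale0r gexp0 mulr1 -(gexp0 idfun n) gexpK //.
exact: upper_by0.
Qed.

(** In degree j the term m = 0 of bchpath_ode is (j + 1) times the coefficient of
degree j + 1 of the path, and all other terms are Lie polynomials by induction. *)
Lemma lie_coef_bchpath j : lie_coef j (@bchpath n).
Proof.
elim/ltn_ind: j => -[|j] IH.
  by apply: lp_ext (@lp0 n.+1) _ => A B hA hB; rewrite bchpath0.
pose V A B := deltamx (bchpath A B).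
have hV i : (i < j)%N -> lie_coef i V.
  move=> ij; have := lpZ i.+1%:R (IH i.+1 ij).
  by move=> h; apply: lp_ext h _ => A B _ _; rewrite coef_mx_delta scaler_nat.
have h1 m : lie_coef j (fun A B => iter m.+1 (ad (- bchpath A B)) (V A B)).
  by apply: lie_coef_iter_ad hV m; [move=> i ij; apply: IH|exact: bchpath0].
have h2 : lie_polynomial (fun A B => (j.+1%:R)^-1 *: (coef_mx j (map_mx C B) +
   \sum_(m < (n.+1).*2) (m`!%:R)^-1 *: coef_mx j (iter m (ad (- line B)) (map_mx C A))
   - \sum_(m < n.*2) (m.+2`!%:R)^-1 *: coef_mx j (iter m.+1 (ad (- bchpath A B)) (V A B)))).
  apply: lpZ; apply: lpD; first apply: lpD.
  - case: (eqVneq j 0%N) => [->|j1].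
      by apply: lp_ext (@lpY n.+1) _ => A B _ _; rewrite coef_mx_const.
    by apply: lp_ext (@lp0 n.+1) _ => A B _ _; rewrite coef_mx_const (negbTE j1).
  - apply: (lp_sum (F := fun m A B => (m`!%:R)^-1 *:
      coef_mx j (iter m (ad (- line B)) (map_mx C A)))) => m _.
    by apply: lpZ; exact: lie_coef_rhs.
  - apply: lpN; apply: (lp_sum (F := fun m A B => (m.+2`!%:R)^-1 *:
      coef_mx j (iter m.+1 (ad (- bchpath A B)) (V A B)))) => m _.
    by apply: lpZ; exact: h1.
apply: lp_ext h2 _ => A B hA hB.
have /(congr1 (coef_mx j)) := bchpath_ode hA hB.
rewrite coef_mx_sum big_ord_recl /= coef_mxZ invr1 scale1r coef_mxD coef_mx_sum -/(V A B).
under [X in _ + X = _]eq_bigr => m _ do rewrite coef_mxZ -iterS /bump add1n.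
under [X in _ = _ + X]eq_bigr => m _ do rewrite coef_mxZ.
move=> <-; rewrite addrK coef_mx_delta -scaler_nat scalerA mulVf ?scale1r //.
Qed.

Definition deg_le d (P : MP) := forall i j, (size (P i j) <= d.+1)%N.

Lemma deg_leD d (P P' : MP) : deg_le d P -> deg_le d P' -> deg_le d (P + P').
Proof.
by move=> h h' i j; rewrite mxE (leq_trans (size_polyD _ _)) // geq_max h h'.
Qed.

Lemma deg_leZ d c (P : MP) : deg_le d P -> deg_le d (C c *: P).
Proof.
move=> h i j; rewrite mxE mul_polyC.
exact: leq_trans (size_scale_leq _ _) (h i j).
Qed.

Lemma deg_leM d e (P P' : MP) : deg_le d P -> deg_le e P' -> deg_le (d + e) (P * P').
Proof.
move=> h h' i j; rewrite mxE; apply: (leq_trans (size_sum _ _ _)).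
apply/bigmax_leqP => k _; apply: (leq_trans (size_polyMleq _ _)).
by move: (h i k) (h' k j); move: (size (P i k)) (size (P' k j)) => a b; lia.
Qed.

Lemma deg_le1 : deg_le 0 1.
Proof. by move=> i j; rewrite mxE; case: eqP => _; rewrite ?size_poly1 ?size_poly0. Qed.

Lemma deg_leW d e (P : MP) : deg_le d P -> (d <= e)%N -> deg_le e P.
Proof. by move=> h de i j; rewrite (leq_trans (h i j)). Qed.

Lemma deg_le_sum d m (F : 'I_m -> MP) : (forall i, deg_le d (F i)) ->
  deg_le d (\sum_(i < m) F i).
Proof.
move=> h; elim/big_ind: _ => [i j||i _]; [|exact: deg_leD|exact: h].
by rewrite mxE size_poly0.
Qed.

Lemma deg_leX d k (P : MP) : deg_le d P -> deg_le (k * d) (P ^+ k).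
Proof.
move=> h; elim: k => [|k IH]; first by rewrite expr0; exact: deg_le1.
by rewrite exprS mulSn; exact: deg_leM.
Qed.

Lemma deg_le_series d m (c : nat -> rat) (P : MP) : deg_le d P ->
  deg_le (m * d) (series C (\poly_(k < m) c k) P).
Proof.
move=> h; rewrite series_poly; apply: deg_le_sum => k; apply: deg_leZ.
by apply: deg_leW (deg_leX k h) _; rewrite leq_mul2r orbC ltnW.
Qed.

(** The bound is uniform in A and B, so that the evaluation of the path at t = 1 is one
fixed sum of coefficients. *)
Lemma bchpath_deg : exists d, forall A B, deg_le d (bchpath A B).
Proof.
have hl D : deg_le 1 (line D).
  move=> i j; rewrite !mxE; apply: (leq_trans (size_polyMleq _ _)).
  by rewrite size_polyX; move: (size_polyC_leq1 (D i j)); move: (size _) => a; lia.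
exists (n.+2 * (n.+2 * 1 + n.+2 * 1))%N => A B; apply: deg_le_series.
apply: deg_leD; first by apply: deg_leM; apply: deg_le_series.
have -> : -1 = C (-1) *: (1 : MP) by rewrite rmorphN1 scaleN1r.
by apply: deg_leZ; apply: deg_leW deg_le1 _.
Qed.

Lemma mexpE A : mexp A = gexp idfun A.
Proof. by rewrite /mexp big_mkord /gexp series_poly. Qed.

Lemma mlogE A : mlog A = glog idfun A.
Proof.
rewrite /mlog /glog series_poly big_add1 /= big_mkord [RHS]big_ord_recl /=.
by rewrite scale0r add0r.
Qed.

Lemma bchE A B : bch A B = glog idfun (gexp idfun A * gexp idfun B).
Proof. by rewrite /bch mlogE !mexpE. Qed.

Lemma lie_polynomial_bch : lie_polynomial (@bch n.+1).
Proof.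
have [d hd] := bchpath_deg.
have h : lie_polynomial (fun A B => \sum_(j < d.+1) coef_mx j (bchpath A B)).
  by apply: (lp_sum (F := fun j A B => coef_mx j (bchpath A B))) => j _; exact: lie_coef_bchpath.
apply: lp_ext h _ => A B _ _; rewrite bchE -[A in LHS]scale1r -[B in LHS]scale1r.
rewrite -bchpath_eval; apply/matrixP => i j; rewrite summxE !mxE horner_evalE.
rewrite (@horner_coef_wide _ d.+1) ?hd //; apply: eq_bigr => k _.
by rewrite expr1n mulr1 mxE.
Qed.

End BCHLie.

Lemma strictly_upperE n (A : 'M[rat]_n) : strictly_upper A <-> upper_by 1 A.
Proof.
by split=> h i j ij; apply: h; move: ij; rewrite addn1 ltnS.
Qed.

Lemma word_eval0 n (A : 'M[rat]_n) w : is_bracket w -> word_eval (@mlie n) A 0 w = 0.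
Proof.
move=> hw; have : word_eval (@mlie n) A 0 w = if w is LX then A else 0.
  elim: w {hw} => //= u -> v ->.
  by case: u => [||? ?]; case: v => [||? ?]; rewrite ?mliexx ?mlie0l ?mlie0r.
by move=> ->; case: w hw.
Qed.

(** The linear part a A + b B of the Lie polynomial is found by setting B = 0 or A = 0,
where all brackets vanish. *)
Theorem bch_lie n : exists2 l : seq (rat * lie_word),
  all (fun c => is_bracket c.2) l &
  forall A B : 'M[rat]_n, strictly_upper A -> strictly_upper B ->
    bch A B = A + B + lie_eval l A B.
Proof.
case: n => [|n].
  by exists [::] => // A B _ _; apply/matrixP => -[].
have [l hl] := lie_polynomial_bch n.
pose k := [seq c <- l | is_bracket c.2].
pose a := \sum_(c <- l) (if c.2 is LX then c.1 else 0 : rat).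
pose b := \sum_(c <- l) (if c.2 is LY then c.1 else 0 : rat).
have E (A B : 'M[rat]_n.+1) : lie_eval l A B = a *: A + b *: B + lie_eval k A B.
  rewrite /lie_eval /a /b /k; elim: l {hl k a b} => [|[c w] l IH].
    by rewrite !big_nil !scale0r !addr0.
  rewrite !big_cons IH !scalerDl; case: w => [||u v] /=.
  - by rewrite scale0r add0r !addrA.
  - by rewrite scale0r add0r addrA [c *: B + _]addrCA.
  - by rewrite !scale0r !add0r big_cons addrCA.
have k0 (A : 'M[rat]_n.+1) : lie_eval k A 0 = 0.
  rewrite /lie_eval big_filter big1 // => c h.
  by rewrite word_eval0 // scaler0.
exists k; first by rewrite /k; elim: l {hl k a b E k0} => //= c l IH; case: ifP => //= ->.
have k0' (B : 'M[rat]_n.+1) : lie_eval k 0 B = 0.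
  rewrite /lie_eval big_filter big1 // => c h.
  suff -> : word_eval (@mlie n.+1) 0 B c.2 = 0 by rewrite scaler0.
  have : word_eval (@mlie n.+1) 0 B c.2 = if c.2 is LY then B else 0.
    elim: (c.2) => //= u -> v ->.
    by case: u => [||? ?]; case: v => [||? ?]; rewrite ?mliexx ?mlie0l ?mlie0r.
  by move=> ->; case: c.2 h.
move=> A B /strictly_upperE hA /strictly_upperE hB; rewrite hl // E.
have u0 := @upper_by0 rat n.+1 1.
congr (_ + _ + _).
  have := hl A 0 hA u0; rewrite E k0 scaler0 !addr0 => <-.
  by rewrite bchE gexp0 mulr1 gexpK.
have := hl 0 B u0 hB; rewrite E k0' scaler0 addr0 add0r => <-.
by rewrite bchE gexp0 mul1r gexpK.
Qed.

(** * The group of strictly upper triangular matrices *)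

Lemma mat0_eq (A B : 'M[rat]_0) : A = B.
Proof. by apply/matrixP => -[]. Qed.

Section BCHGroup.
Variable n : nat.
Implicit Types A B C : 'M[rat]_n.

Lemma su_0 : su (0 : 'M[rat]_n).
Proof. by apply/strictly_upperE; exact: upper_by0. Qed.

Lemma suD A B : su A -> su B -> su (A + B).
Proof. by move=> /strictly_upperE hA /strictly_upperE hB; apply/strictly_upperE/upper_byD. Qed.

Lemma suZ a A : su A -> su (a *: A).
Proof. by move=> /strictly_upperE hA; apply/strictly_upperE/upper_byZ. Qed.

Lemma suN A : su A -> su (- A).
Proof. by move=> /strictly_upperE hA; apply/strictly_upperE/upper_byN. Qed.

Lemma upper_by_mlie d e A B : upper_by d A -> upper_by e B -> upper_by (d + e) (mlie A B).
Proof.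
move=> hA hB; apply: upper_byD; first exact: upper_byM.
by apply: upper_byN; rewrite addnC; exact: upper_byM.
Qed.

Lemma su_mlie A B : su A -> su B -> su (mlie A B).
Proof.
move=> /strictly_upperE hA /strictly_upperE hB; apply/strictly_upperE.
by apply: upper_byW (upper_by_mlie hA hB) _.
Qed.

Definition iter_ad (s : seq 'M[rat]_n) A := foldr (@mlie n) A s.

Lemma iter_ad_upper d s A : (forall B, B \in s -> su B) -> upper_by d A ->
  upper_by (size s + d) (iter_ad s A).
Proof.
elim: s => [|B s IH] hs hA //=; rewrite -addn1 -addnA addnCA.
apply: upper_by_mlie; first by apply/strictly_upperE/hs/mem_head.
by apply: IH => // C Cs; apply: hs; rewrite inE Cs orbT.
Qed.

Lemma iter_ad_nil s A : (forall B, B \in s -> su B) -> su A -> (n <= size s)%N ->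
  iter_ad s A = 0.
Proof.
move=> hs /strictly_upperE hA ns; apply: upper_by_ge.
by apply: upper_byW (iter_ad_upper hs hA) _; rewrite (leq_trans ns) // leq_addr.
Qed.

End BCHGroup.

Section BCHGroupS.
Variable n : nat.
Implicit Types A B C : 'M[rat]_n.+1.
Local Notation gexp := (@gexp rat idfun n).
Local Notation glog := (@glog rat idfun n).

Lemma su_bchS A B : su A -> su B -> su (bch A B).
Proof.
move=> /strictly_upperE hA /strictly_upperE hB; apply/strictly_upperE.
by rewrite bchE; apply/glog_upper/unip_mul; apply: gexp_upper.
Qed.

Lemma gexp_bch A B : su A -> su B -> gexp (bch A B) = gexp A * gexp B.
Proof.
move=> /strictly_upperE hA /strictly_upperE hB.
by rewrite bchE glogK //; apply: unip_mul; apply: gexp_upper.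
Qed.

Lemma gexp_inj A B : su A -> su B -> gexp A = gexp B -> A = B.
Proof.
move=> /strictly_upperE hA /strictly_upperE hB E.
by rewrite -(gexpK idfun hA) E gexpK.
Qed.

End BCHGroupS.

Section BCHGroupLaws.
Variable n : nat.
Implicit Types A B C : 'M[rat]_n.

Lemma su_bch A B : su A -> su B -> su (bch A B).
Proof. case: n A B => [|m] A B hA hB; last exact: su_bchS.
by case=> i hi. Qed.

Lemma bchA A B C : su A -> su B -> su C -> bch A (bch B C) = bch (bch A B) C.
Proof.
case: n A B C => [|m] A B C hA hB hC; first exact: mat0_eq.
have [hAB hBC] := (su_bchS hA hB, su_bchS hB hC).
by apply: gexp_inj; [exact: su_bchS|exact: su_bchS|rewrite !gexp_bch // mulrA].
Qed.

Lemma bchZ A a b : su A -> bch (a *: A) (b *: A) = (a + b) *: A.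
Proof.
case: n A => [|m] A hA; first exact: mat0_eq.
apply: gexp_inj; [exact: su_bchS (suZ _ hA) (suZ _ hA)|exact: suZ|].
rewrite gexp_bch ; [|exact: suZ|exact: suZ].
by apply: (gexp_add idfun); apply/strictly_upperE.
Qed.

Lemma bchN A : su A -> bch A (- A) = 0.
Proof. by move=> hA; have := bchZ 1 (-1) hA; rewrite scale1r scaleN1r subrr scale0r. Qed.

Lemma bchNl A : su A -> bch (- A) A = 0.
Proof. by move=> hA; have := bchZ (-1) 1 hA; rewrite scale1r scaleN1r addNr scale0r. Qed.

Lemma bch0r A : su A -> bch A 0 = A.
Proof. by move=> hA; have := bchZ 1 0 hA; rewrite addr0 !scale1r scale0r. Qed.

Lemma bch0l A : su A -> bch 0 A = A.
Proof. by move=> hA; have := bchZ 0 1 hA; rewrite add0r !scale1r scale0r. Qed.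

Lemma bchKl A B : su A -> su B -> bch (- A) (bch A B) = B.
Proof. by move=> hA hB; rewrite bchA ?bchNl ?bch0l //; exact: suN. Qed.

Lemma bchKr A B : su A -> su B -> bch (bch B A) (- A) = B.
Proof. by move=> hA hB; rewrite -bchA ?bchN ?bch0r //; exact: suN. Qed.

Lemma bchNK A B : su A -> su B -> bch A (bch (- A) B) = B.
Proof. by move=> hA hB; rewrite bchA ?bchN ?bch0l //; exact: suN. Qed.

Lemma bch_conj A B : su A -> su B ->
  bch (bch A B) (- A) = \sum_(m < n.*2) (m`!%:R)^-1 *: iter m (mlie A) B.
Proof.
case: n A B => [|m] A B hA hB; first exact: mat0_eq.
have hAu : upper_by 1 A by exact/strictly_upperE.
have hS : su (\sum_(k < (m.+1).*2) (k`!%:R)^-1 *: iter k (mlie A) B).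
  elim/big_ind: _ => [||k _]; [exact: su_0|exact: suD|apply: suZ].
  by elim: (nat_of_ord k) => //= j IH; apply: su_mlie.
apply: gexp_inj; [by apply: su_bchS; [apply: su_bchS|apply: suN]|exact: hS|].
rewrite !gexp_bch //; [|exact: su_bchS|exact: suN].
rewrite -(@series_conj _ idfun m (exp_poly m.+2) _ _ B (gexpN idfun hAu) (gexpNl idfun hAu)).
by rewrite gexpN_conj.
Qed.

Lemma su_bch_prod (s : seq 'M[rat]_n) : (forall A, A \in s -> su A) -> su (bch_prod s).
Proof.
elim: s => [|A s IH] hs; first exact: su_0.
apply: su_bch; first exact/hs/mem_head.
by apply: IH => B Bs; apply: hs; rewrite inE Bs orbT.
Qed.

Lemma bch_prod_cat (s t : seq 'M[rat]_n) : (forall A, A \in s -> su A) ->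
  (forall A, A \in t -> su A) -> bch_prod (s ++ t) = bch (bch_prod s) (bch_prod t).
Proof.
move=> hs ht; elim: s hs => [|A s IH] hs.
  by rewrite /= bch0l //; exact: su_bch_prod.
have hA : su A by apply/hs/mem_head.
have hs' B : B \in s -> su B by move=> Bs; apply: hs; rewrite inE Bs orbT.
by rewrite /= -/(bch_prod _) IH // bchA //; exact: su_bch_prod.
Qed.

End BCHGroupLaws.

(** * Additive subgroups and perturbation of products *)

Section AdditiveSubgroups.
Variable n : nat.
Local Notation M := 'M[rat]_n.
Implicit Types (x y z : M) (J X : set M).

Definition zsub J := J 0 /\ forall x y, J x -> J y -> J (x - y).
Inductive zspan X : set M :=
| zspan_zero : zspan X 0
| zspan_gen x of X x : zspan X x
| zspan_diff x y of zspan X x & zspan X y : zspan X (x - y).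

Lemma zsub_opp J x : zsub J -> J x -> J (- x).
Proof. by move=> [J0 JB] Jx; rewrite -sub0r; exact: JB. Qed.

Lemma zsub_add J x y : zsub J -> J x -> J y -> J (x + y).
Proof. by move=> hJ Jx Jy; rewrite -[y]opprK; apply: hJ.2 => //; exact: zsub_opp. Qed.

Lemma zsub_sub J x y : zsub J -> J x -> J y -> J (x - y).
Proof. by case=> _; apply. Qed.

Lemma zsub_0 J : zsub J -> J 0. Proof. by case. Qed.

Lemma zsub_nat J x k : zsub J -> J x -> J (k%:R *: x).
Proof.
move=> hJ Jx; rewrite scaler_nat; elim: k => [|k IH]; first exact: hJ.1.
by rewrite mulrS; exact: zsub_add.
Qed.

Lemma zsub_int J x (k : rat) : zsub J -> k \is a Num.int -> J x -> J (k *: x).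
Proof.
move=> hJ /intrP[[i|i] ->] Jx; first exact: zsub_nat.
by rewrite NegzE mulrNz scaleNr; apply: zsub_opp => //; exact: zsub_nat.
Qed.

Lemma zsub_sum J m (F : 'I_m -> M) : zsub J -> (forall i, J (F i)) ->
  J (\sum_(i < m) F i).
Proof.
move=> hJ h; elim/big_ind: _ => [|x y|i _]; [exact: hJ.1|exact: zsub_add|exact: h].
Qed.

Lemma zsub_zspan X : zsub (zspan X).
Proof. by split=> [|x y]; [exact: zspan_zero|exact: zspan_diff]. Qed.

Lemma sub_zspan X x : X x -> zspan X x.
Proof. exact: zspan_gen. Qed.

Lemma zspan_sub X J : zsub J -> X `<=` J -> zspan X `<=` J.
Proof. by move=> hJ XJ x; elim=> [|y /XJ//|y z _ Jy _ Jz]; [exact: hJ.1|exact: hJ.2]. Qed.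

Lemma zsub_su : zsub (@strictly_upper n).
Proof.
by split=> [|x y hx hy]; [exact: su_0|apply: suD => //; exact: suN].
Qed.

End AdditiveSubgroups.

(** The integer d is a common denominator of the coefficients of the
Baker-Campbell-Hausdorff formula. *)
Definition bch_bound n d := (0 < d)%N /\
  exists2 l : seq (rat * lie_word),
    all (fun c => is_bracket c.2 && (d%:R * c.1 \is a Num.int)) l &
    forall A B : 'M[rat]_n, su A -> su B -> bch A B = A + B + lie_eval l A B.

Lemma mul_denq_int (q : rat) : `|denq q|%:R * q \is a Num.int.
Proof.
by rewrite mulrC -[_%:R]/((Posz `|denq q|)%:~R) absz_denq -numqE intr_int.
Qed.

Lemma clear_denominators (s : seq rat) : exists2 D, (0 < D)%N &
  forall q, q \in s -> D%:R * q \is a Num.int.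
Proof.
elim: s => [|q s [D D0 hD]]; first by exists 1%N.
exists (D * `|denq q|)%N; first by rewrite muln_gt0 D0 absz_gt0 denq_neq0.
move=> p; rewrite inE => /predU1P[->|/hD h]; rewrite natrM.
  by rewrite -mulrA rpredM ?natr_int // mul_denq_int.
by rewrite [D%:R * _]mulrC -mulrA rpredM // natr_int.
Qed.

Lemma bch_bound_exists n : exists d, bch_bound n d.
Proof.
have [l hl E] := bch_lie n; have [d d0 hd] := clear_denominators [seq c.1 | c <- l].
exists d; split=> //; exists l => //.
have : all (fun c => d%:R * c.1 \is a Num.int) l.
  by rewrite -(all_map fst (fun q => d%:R * q \is a Num.int)); apply/allP.
by move=> hd'; rewrite -[all _ l]/(all (predI _ _) l) all_predI hl.
Qed.

Section Perturbation.
Variables (n d : nat).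
Hypothesis hd : bch_bound n d.
Local Notation M := 'M[rat]_n.
Variables (Lam J J' : set M).
Hypotheses (Lsu : Lam `<=` @strictly_upper n) (Lz : zsub Lam)
  (Lbr : forall a b, Lam a -> Lam b -> Lam (mlie a b))
  (JL : J `<=` Lam) (Jz : zsub J) (J'z : zsub J') (J'J : J' `<=` J)
  (LJ : forall a j, Lam a -> J j -> exists2 j', J' j' & mlie a j = d%:R *: j').

(** Replacing the letters one at a time changes a bracket by a bracket with an entry in
J, which lies in d J'. *)
Lemma word_perturb x y j k w : Lam x -> Lam y -> J j -> J k ->
  let W := word_eval (@mlie n) x y w in
  let W' := word_eval (@mlie n) (x + j) (y + k) w in
  [/\ Lam W, J (W' - W) &
      is_bracket w -> exists2 j', J' j' & W' - W = d%:R *: j'].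
Proof.
move=> Lx Ly Jj Jk /=; elim: w => [||u [Lu Ju _] v [Lv Jv _]] /=.
- by rewrite addrAC subrr add0r; split.
- by rewrite addrAC subrr add0r; split.
set U := word_eval _ x y u in Lu Ju *; set V := word_eval _ x y v in Lv Jv *.
set U' := word_eval _ _ _ u in Ju *; set V' := word_eval _ _ _ v in Jv *.
have LV' : Lam V' by rewrite -[V'](subrK V); apply: zsub_add => //; exact: JL.
have [a Ja Ea] := LJ LV' Ju; have [b Jb Eb] := LJ Lu Jv.
have E : mlie U' V' - mlie U V = d%:R *: (b - a).
  rewrite scalerBr -Ea -Eb !mlieBr !(mlieC V').
  move: (mlie U' V') (mlie U V) (mlie U V') => p q r.
  by apply/matrixP => i1 i2; rewrite !mxE; ring.
have Jba : J' (b - a) by apply: J'z.2.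
split; [exact: Lbr| |by move=> _; exists (b - a)].
by rewrite E; apply: zsub_nat => //; exact: J'J.
Qed.

(** The factor d gained in each bracket compensates the denominators. Two uses: with
J' = J the cosets of J for addition and for bch coincide, and with J' one step
deeper in a filtration bch is addition on J modulo J'. *)
Lemma bch_perturb x y j k : Lam x -> Lam y -> J j -> J k ->
  J' (bch (x + j) (y + k) - bch x y - j - k).
Proof.
move=> Lx Ly Jj Jk; have [_ [l hl E]] := hd.
have Lxj : Lam (x + j) by apply: zsub_add => //; exact: JL.
have Lyk : Lam (y + k) by apply: zsub_add => //; exact: JL.
rewrite !E; try exact: Lsu.
have -> : x + j + (y + k) + lie_eval l (x + j) (y + k) - (x + y + lie_eval l x y) - j - k
    = lie_eval l (x + j) (y + k) - lie_eval l x y.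
  by apply/matrixP => a b; rewrite !mxE; ring.
rewrite /lie_eval; elim: l hl {E} => [|c l IH] /=.
  by rewrite !big_nil subrr => _; exact: J'z.1.
move=> /andP[/andP[bw cint] /IH h]; rewrite !big_cons opprD addrACA.
apply: zsub_add => //; rewrite -scalerBr.
have [_ _ /(_ bw) [j' Jj' ->]] := word_perturb c.2 Lx Ly Jj Jk.
by rewrite scalerA mulrC; apply: zsub_int.
Qed.

End Perturbation.

Section Hull.
Variables (n d : nat).
Hypothesis d0 : (0 < d)%N.
Local Notation M := 'M[rat]_n.
Implicit Types (Lam I J : set M) (s : seq M).

Lemma iter_adZ s a (x : M) : iter_ad s (a *: x) = a *: iter_ad s x.
Proof. by elim: s => //= g s ->; rewrite mlieZr. Qed.

(** The scaling by d^n / d^k of brackets with k elements of Lam is what makes one more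
bracket gain a factor d; the factor is an integer for k <= n, and the brackets
with more entries vanish. *)
Definition hull q Lam I : set M := zspan [set v | exists s x,
  [/\ forall g, g \in s -> Lam g, (q <= size s)%N, I x
    & v = (d%:R ^+ n / d%:R ^+ size s) *: iter_ad s x]].

Lemma zsub_hull q Lam I : zsub (hull q Lam I).
Proof. exact: zsub_zspan. Qed.

Lemma hull_weaken q q' Lam I : (q <= q')%N -> hull q' Lam I `<=` hull q Lam I.
Proof.
move=> qq'; apply: zspan_sub; first exact: zsub_zspan.
move=> _ [s [x [hs sq Ix ->]]]; apply: sub_zspan; exists s, x; split=> //.
exact: leq_trans sq.
Qed.

Lemma hull_sub q Lam I I' : Lam `<=` @strictly_upper n -> I `<=` @strictly_upper n ->
  zsub I' ->
  (forall s x, (forall g, g \in s -> Lam g) -> (q <= size s)%N -> I x -> I' (iter_ad s x)) ->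
  hull q Lam I `<=` I'.
Proof.
move=> Lsu Isu I'z h; apply: zspan_sub => // _ [s [x [hs qs Ix ->]]].
have [sn|ns] := leqP (size s) n.
  have -> : (d%:R ^+ n / d%:R ^+ size s : rat) = (d ^ (n - size s))%:R.
    by rewrite natrX expfB_cond // pnatr_eq0 eqn0Ngt d0.
  by apply: zsub_nat => //; exact: h.
rewrite iter_ad_nil ?scaler0; [exact: I'z.1|by move=> g /hs/Lsu|exact: Isu|exact: ltnW].
Qed.

Lemma hull_mul Lam I x : I x -> hull 0 Lam I (d%:R ^+ n *: x).
Proof.
move=> Ix; apply: sub_zspan; exists [::], x; split=> //.
by rewrite expr0 divr1.
Qed.

Lemma hull_br Lam I a j : Lam a -> hull 0 Lam I j ->
  exists2 j', hull 1 Lam I j' & mlie a j = d%:R *: j'.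
Proof.
move=> La; have h : zsub [set v | exists2 j', hull 1 Lam I j' & mlie a v = d%:R *: j'].
  split; first by exists 0; [exact: (zsub_hull _ _ _).1|rewrite mlie0r scaler0].
  move=> x y [x' hx Ex] [y' hy Ey]; exists (x' - y').
    exact: (zsub_hull _ _ _).2.
  by rewrite mlieBr Ex Ey scalerBr.
apply: (zspan_sub h) => _ [s [x [hs _ Ix ->]]].
exists ((d%:R ^+ n / d%:R ^+ size (a :: s)) *: iter_ad (a :: s) x).
  apply: sub_zspan; exists (a :: s), x; split=> //.
  by move=> g; rewrite inE => /predU1P[->//|/hs].
rewrite mlieZr scalerA /=; congr (_ *: _).
by rewrite mulrCA exprS invfM mulVKf // pnatr_eq0 eqn0Ngt d0.
Qed.

End Hull.

(** * The ideal generated by a normal subgroup *)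

Section Malcev.
Variables (n d : nat).
Hypothesis hd : bch_bound n d.
Local Notation M := 'M[rat]_n.
Variables (Gam N : set M).
Hypotheses (Gsu : Gam `<=` @strictly_upper n) (NG : N `<=` Gam)
  (Nbch : bch_subgroup N)
  (Nconj : forall g x, Gam g -> N x -> N (bch (bch g x) (- g))).
Implicit Types (x y z g : M) (s : seq M).

(** The step k is spanned by the brackets of at least k elements of Gam with an element
of N; for k = 0 it is the ideal generated by N. *)
Definition lie_filtration k : set M := zspan [set v | exists s x,
  [/\ forall g, g \in s -> Gam g, (k <= size s)%N, N x & v = iter_ad s x]].
Local Notation F := lie_filtration.

Let Nsu : N `<=` @strictly_upper n. Proof. by move=> x /NG/Gsu. Qed.

Lemma su_iter_ad s x : (forall g, g \in s -> su g) -> su x -> su (iter_ad s x).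
Proof.
elim: s => //= g s IH hs hx; apply: su_mlie; first exact/hs/mem_head.
by apply: IH => // h hh; apply: hs; rewrite inE hh orbT.
Qed.

Lemma zsub_filtration k : zsub (F k). Proof. exact: zsub_zspan. Qed.

Lemma filtration_le k l : (k <= l)%N -> F l `<=` F k.
Proof.
move=> kl; apply: zspan_sub; first exact: zsub_zspan.
move=> _ [s [x [hs ls Nx ->]]]; apply: sub_zspan; exists s, x; split=> //.
exact: leq_trans ls.
Qed.

Lemma filtration_su k : F k `<=` @strictly_upper n.
Proof.
apply: zspan_sub; first exact: zsub_su.
move=> _ [s [x [hs _ Nx ->]]]; apply: su_iter_ad; last exact: Nsu.
by move=> g /hs/Gsu.
Qed.

Lemma filtration_ge k x : (n <= k)%N -> F k x -> x = 0.
Proof.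
move=> nk; suff : F k `<=` [set 0] by apply.
apply: zspan_sub; first by split=> [//|x1 x2 -> ->]; rewrite /= subrr.
move=> _ [s [y [hs ks Ny ->]]]; rewrite /= iter_ad_nil //; last exact: leq_trans ks.
  by move=> g /hs/Gsu.
exact: Nsu.
Qed.

Lemma filtration_br k g x : Gam g -> F k x -> F k.+1 (mlie g x).
Proof.
move=> Gg; apply: (@zspan_sub _ _ [set x | F k.+1 (mlie g x)]).
  split=> [|y z hy hz] /=; first by rewrite mlie0r; exact: zsub_0 (zsub_filtration _).
  by rewrite mlieBr; exact: zsub_sub (zsub_filtration _) hy hz.
move=> _ [s [y [hs ks Ny ->]]]; apply: sub_zspan; exists (g :: s), y; split=> //.
by move=> h; rewrite inE => /predU1P[->//|/hs].
Qed.

(** The set Gam is closed neither under addition nor under brackets; this ring is, and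
it acts on the filtration as Gam does. *)
Definition filtration_ring : set M :=
  [set a | su a /\ forall k y, F k y -> F k.+1 (mlie a y)].
Local Notation Lam := filtration_ring.

Lemma ring_su : Lam `<=` @strictly_upper n. Proof. by move=> x []. Qed.

Lemma ring_Gam : Gam `<=` Lam.
Proof. by move=> g Gg; split=> [|k y]; [exact: Gsu|exact: filtration_br]. Qed.

Lemma ring_zsub : zsub Lam.
Proof.
split=> [|a b [sa ha] [sb hb]].
  split=> [|k y _]; first exact: su_0.
  by rewrite mlie0l; exact: zsub_0 (zsub_filtration _).
split=> [|k y Fy]; first exact: zsub_sub (zsub_su n) sa sb.
by rewrite mlieBl; exact: zsub_sub (zsub_filtration _) (ha _ _ Fy) (hb _ _ Fy).
Qed.

Lemma ring_lie a b : Lam a -> Lam b -> Lam (mlie a b).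
Proof.
move=> [sa ha] [sb hb]; split=> [|k y Fy]; first exact: su_mlie.
rewrite mlie_jacobi; apply: (@filtration_le _ k.+2) => //.
exact: ((zsub_filtration k.+2).2 _ _ (ha _ _ (hb _ _ Fy)) (hb _ _ (ha _ _ Fy))).
Qed.

Lemma ring_filtration k : F k `<=` Lam.
Proof.
apply: zspan_sub; first exact: ring_zsub.
move=> _ [s [x [hs _ Nx ->]]]; elim: s hs => [|g s IH] hs /=; first exact/ring_Gam/NG.
apply: ring_lie; first exact/ring_Gam/hs/mem_head.
by apply: IH => h hh; apply: hs; rewrite inE hh orbT.
Qed.

Lemma ring_iter_ad k s x : (forall g, g \in s -> Lam g) -> F k x ->
  F (size s + k) (iter_ad s x).
Proof.
move=> hs Fx; elim: s hs => //= g s IH hs; apply: (hs g (mem_head _ _)).2.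
by apply: IH => h hh; apply: hs; rewrite inE hh orbT.
Qed.

Local Notation J k := (hull d 0 Lam (F k)).
Local Notation Jp k := (hull d 1 Lam (F k)).
Let d0 : (0 < d)%N. Proof. exact: hd.1. Qed.

Lemma hull0_filtration k : J k `<=` F k.
Proof.
apply: hull_sub => //; [exact: ring_su|exact: filtration_su|exact: zsub_filtration|].
move=> s x hs _ Fx; apply: (@filtration_le _ (size s + k)); first exact: leq_addl.
exact: ring_iter_ad.
Qed.

Lemma hull1_filtration k : Jp k `<=` F k.+1.
Proof.
apply: hull_sub => //; [exact: ring_su|exact: filtration_su|exact: zsub_filtration|].
move=> s x hs ss Fx; apply: (@filtration_le _ (size s + k)); last exact: ring_iter_ad.
by rewrite -add1n leq_add2r.
Qed.

Lemma hull1_hull0 k : Jp k `<=` J k.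
Proof. exact: hull_weaken. Qed.

Lemma bch_hull k x y i j : Lam x -> Lam y -> J k i -> J k j ->
  Jp k (bch (x + i) (y + j) - bch x y - i - j).
Proof.
apply: (bch_perturb hd ring_su ring_zsub ring_lie).
- by move=> z /hull0_filtration/ring_filtration.
- exact: zsub_hull.
- exact: zsub_hull.
- exact: hull1_hull0.
- by move=> a z; exact: (hull_br d0).
Qed.

Lemma N_nat k x : N x -> N (k%:R *: x).
Proof.
move=> Nx; elim: k => [|k IH]; first by rewrite scale0r; case: Nbch.
have [_ NM _] := Nbch; have := NM _ _ Nx IH.
by rewrite -{1}[x]scale1r bchZ ?nat1r //; exact: Nsu.
Qed.

(** On the hull the product bch is the sum up to the next step of the filtration, so
that approximation modulo the next step by elements of N is stable under
differences. The error m has to stay in the hull for this argument to iterate. *)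
Lemma approx_zsub k (e : nat) : zsub [set z | F k z /\ exists m,
  [/\ J k m, F k.+1 m & N (d%:R ^+ n *: (e%:R *: z) + m)]].
Proof.
have [N0 NM NV] := Nbch.
have hJ z m : F k z -> J k m -> J k (d%:R ^+ n *: (e%:R *: z) + m).
  move=> Fz Jm; apply: (zsub_add (zsub_hull _ _ _ _) _ Jm).
  apply: (@hull_mul n d Lam (F k)). apply: zsub_nat Fz. exact: zsub_filtration.
split.
  split; first exact: zsub_0 (zsub_filtration _).
  exists 0; rewrite !scaler0 addr0; split=> //; first exact: zsub_0 (zsub_hull _ _ _ _).
  exact: zsub_0 (zsub_filtration _).
move=> z1 z2 [Fz1 [m1 [Jm1 Fm1 Nm1]]] [Fz2 [m2 [Jm2 Fm2 Nm2]]].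
split; first exact: zsub_sub (zsub_filtration _) Fz1 Fz2.
set y1 := _ + m1 in Nm1; set y2 := _ + m2 in Nm2.
have Jy1 : J k y1 by exact: hJ.
have Jy2 : J k (- y2) by apply: zsub_opp; [exact: zsub_hull|exact: hJ].
have L0 : Lam 0 := ring_zsub.1.
have := bch_hull L0 L0 Jy1 Jy2; rewrite !add0r bch0r ?subr0; last exact: su_0.
set p := (X in Jp k X) => hp; exists (m1 - m2 + p); split.
- exact: zsub_add (zsub_hull _ _ _ _) (zsub_sub (zsub_hull _ _ _ _) Jm1 Jm2) (hull1_hull0 hp).
- exact: zsub_add (zsub_filtration _) (zsub_sub (zsub_filtration _) Fm1 Fm2) (hull1_filtration hp).
suff -> : d%:R ^+ n *: (e%:R *: (z1 - z2)) + (m1 - m2 + p) = bch y1 (- y2).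
  by apply: NM => //; exact: NV.
by rewrite /p /y1 /y2; apply/matrixP => a b; rewrite !mxE; ring.
Qed.

(* A common denominator of the coefficients of exp (ad g). *)
Let nf := (n.*2)`!.

Lemma dvdn_fact_le a b : (a <= b)%N -> (a`! %| b`!)%N.
Proof.
move=> ab; rewrite -(bin_fact ab) mulnCA; exact: dvdn_mulr.
Qed.

Lemma conj_expand k (D : nat) g w : Gam g -> N w -> F k w ->
  exists2 r, F k.+2 r &
  bch (bch g ((D * nf)%:R *: w)) (- g) =
    (D * nf)%:R *: w + D%:R *: (nf%:R *: mlie g w + r).
Proof.
move=> Gg Nw Fw; have sg := Gsu Gg; have sw : su w := Nsu Nw.
have Fi m : F (m + k) (iter m (mlie g) w).
  by elim: m => //= m IH; exact: filtration_br.
pose t m := (nf%:R / m`!%:R) *: iter m (mlie g) w.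
have Ft m j : (m <= n.*2)%N -> (j <= m + k)%N -> F j (t m).
  move=> mn jm; apply: filtration_le jm _ _; rewrite /t.
  have -> : nf%:R / m`!%:R = ((nf %/ m`!)%N)%:R :> rat.
    rewrite -{1}(@divnK m`! nf) ?natrM ?mulfK ?pnatr_eq0 -?lt0n ?fact_gt0 //.
    exact: dvdn_fact_le mn.
  exact: zsub_nat (zsub_filtration _) _.
exists (\sum_(m < n.*2 - 2) t m.+2).
  apply: zsub_sum => [|m]; first exact: zsub_filtration.
  by apply: Ft; [case: m => m /=; lia|rewrite !addSn !ltnS leq_addl].
have it m : iter m (mlie g) ((D * nf)%:R *: w) = (D * nf)%:R *: iter m (mlie g) w.
  by elim: m => //= m ->; rewrite mlieZr.
rewrite bch_conj //; last exact: suZ.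
have -> : \sum_(m < n.*2) (m`!%:R)^-1 *: iter m (mlie g) ((D * nf)%:R *: w) =
    \sum_(m < n.*2) D%:R *: t m.
  by apply: eq_bigr => m _; rewrite it /t !scalerA natrM mulrC mulrA.
rewrite -scaler_sumr natrM -scalerA -scalerDr addrA; congr (_ *: _).
have t0 : t 0%N = nf%:R *: w by rewrite /t invr1 mulr1.
have t1 : t 1%N = nf%:R *: mlie g w by rewrite /t invr1 mulr1.
rewrite -t0 -t1; have [n0|n0] := posnP n.
  by apply/matrixP => i; have := ltn_ord i; rewrite {2}n0.
have [k2 E] : exists k2, n.*2 = k2.+2 by exists (n.*2 - 2)%N; lia.
rewrite -(big_mkord xpredT t) -(big_mkord xpredT (fun m => t m.+2)) E subn2 !big_mkord.
by rewrite !big_ord_recl addrA.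
Qed.

Fixpoint approx_factor (k : nat) : nat :=
  if k is k'.+1 then d ^ n * nf * approx_factor k' else d ^ n.

(** Up to a fixed factor, every element of the filtration is approximated by an element
of N modulo the next step. If w in N approximates z, the commutator of g with a
multiple of w lies in N and approximates a multiple of the bracket of g and z. *)
Lemma filtration_approx k z : F k z ->
  exists2 m, F k.+1 m & N ((approx_factor k)%:R *: z + m).
Proof.
have trivial_approx k' (e : nat) y : F k' y -> F k'.+1 y ->
    F k' y /\ exists m, [/\ J k' m, F k'.+1 m & N (d%:R ^+ n *: (e%:R *: y) + m)].
  move=> Fy Fy'; split=> //; exists (- (d%:R ^+ n *: (e%:R *: y))); split.
  - apply: zsub_opp; first exact: zsub_hull.
    apply: (@hull_mul n d Lam (F k')); apply: zsub_nat Fy; exact: zsub_filtration.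
  - apply: zsub_opp; first exact: zsub_filtration.
    rewrite -natrX; apply: zsub_nat; first exact: zsub_filtration.
    apply: zsub_nat => //; exact: zsub_filtration.
  - by rewrite subrr; case: Nbch.
elim: k z => [|k IH] z.
  suff h : F 0 `<=` [set z | F 0 z /\ exists m,
      [/\ J 0 m, F 1 m & N (d%:R ^+ n *: (1%:R *: z) + m)]].
    by move=> /h[_ [m [_ Fm]]]; rewrite scale1r /= natrX => Nm; exists m.
  apply: zspan_sub; first exact: approx_zsub.
  move=> _ [s [x [hs _ Nx ->]]].
  case: s hs => [_|g s hs]; last first.
    by apply: trivial_approx; apply: sub_zspan; exists (g :: s), x.
  split; first by apply: sub_zspan; exists [::], x.
  exists 0; split; [exact: zsub_0 (zsub_hull _ _ _ _)|exact: zsub_0 (zsub_filtration _)|].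
  by rewrite scale1r addr0 -natrX; exact: N_nat.
pose e := (nf * approx_factor k)%N.
suff h : F k.+1 `<=` [set z | F k.+1 z /\ exists m,
    [/\ J k.+1 m, F k.+2 m & N (d%:R ^+ n *: (e%:R *: z) + m)]].
  move=> /h[_ [m [_ Fm]]]; rewrite scalerA -natrX -natrM /e mulnA => Nm.
  by exists m.
apply: zspan_sub; first exact: approx_zsub.
move=> _ [s [x [hs ks Nx ->]]].
have [ks'|] := ltnP k.+1 (size s).
  by apply: trivial_approx; apply: sub_zspan; exists s, x.
case: s hs ks => // g s hs ks sk.
have Gg : Gam g by exact/hs/mem_head.
have hs' h : h \in s -> Gam h by move=> hh; apply: hs; rewrite inE hh orbT.
have Fz : F k (iter_ad s x) by apply: sub_zspan; exists s, x.
have Fgz : F k.+1 (mlie g (iter_ad s x)) by exact: filtration_br.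
have [m Fm Nw] := IH _ Fz; set w := _ + m in Nw.
have Fw : F k w.
  apply: zsub_add; [exact: zsub_filtration|apply: zsub_nat => //; exact: zsub_filtration|].
  exact: filtration_le Fm.
split=> //.
have [r Fr Er] := conj_expand (d ^ n) Gg Nw Fw.
set w' := _ *: w in Er; have Nw' : N w' by exact: N_nat.
set q := _ *: (_ + r) in Er.
have Fq : F k.+1 (nf%:R *: mlie g w + r).
  apply: zsub_add; [exact: zsub_filtration| |exact: filtration_le Fr].
  apply: zsub_nat; [exact: zsub_filtration|exact: filtration_br].
have Jq : J k.+1 q by rewrite /q natrX; apply: (@hull_mul n d Lam (F k.+1)).
have sw' : su w' by exact: Nsu.
have Nc : N (bch (- w') (w' + q)).
  by have [_ NM NV] := Nbch; rewrite -Er; apply: NM; [exact: NV|exact: Nconj].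
have Lw' : Lam w' by exact/ring_Gam/NG.
have LNw' : Lam (- w') by apply: zsub_opp => //; exact: ring_zsub.
have := bch_hull LNw' Lw' (zsub_0 (zsub_hull d 0 Lam (F k.+1))) Jq.
rewrite addr0 bchNl // !subr0; set p := _ - q => Jpp.
pose m' := nf%:R *: mlie g m + r.
have Fm' : F k.+2 m'.
  apply: zsub_add => //; first exact: zsub_filtration.
  apply: zsub_nat; [exact: zsub_filtration|exact: filtration_br].
exists (d%:R ^+ n *: m' + p); split.
- apply: zsub_add; [exact: zsub_hull| |exact: hull1_hull0].
  by apply: (@hull_mul n d Lam (F k.+1)); exact: filtration_le Fm'.
- apply: zsub_add; [exact: zsub_filtration| |exact: hull1_filtration].
  by rewrite -natrX; apply: zsub_nat => //; exact: zsub_filtration.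
suff -> : d%:R ^+ n *: (e%:R *: iter_ad (g :: s) x) + (d%:R ^+ n *: m' + p)
    = bch (- w') (w' + q) by [].
rewrite /p; move: (bch (- w') _) => c1.
rewrite /q /m' /e natrX /w mlieDr mlieZr natrM /=.
move: (mlie g m) (mlie g _) (nf) => c2 c3 f1.
by apply/matrixP => a b; rewrite !mxE; ring.
Qed.

Fixpoint malcev_factor (j : nat) : nat :=
  if j is j'.+1 then (d ^ n * malcev_factor j') * approx_factor (n - j) else 1.

(** Downward induction on the filtration, which ends at 0. If D F (k + 1) lies in N and
w = a z + m in N approximates z in F k, then a multiple of w differs from a multiple of
z by an element of the hull of D F (k + 1), and translation by the hull
preserves N. *)
Lemma malcev_step j z : (j <= n)%N -> F (n - j) z -> N ((malcev_factor j)%:R *: z).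
Proof.
have [N0 NM NV] := Nbch.
elim: j z => [|j IH] z jn Fz.
  by rewrite subn0 in Fz; rewrite (filtration_ge (leqnn n) Fz) scaler0.
have Ek : (n - j = (n - j.+1).+1)%N by lia.
set k := (n - j.+1)%N in Ek Fz; rewrite {}Ek in IH.
have {}IH x : F k.+1 x -> N ((malcev_factor j)%:R *: x) by apply: IH; exact: ltnW.
have [m Fm Nw] := filtration_approx Fz.
set D := malcev_factor j in IH.
pose I := [set x | exists2 y, F k.+1 y & x = D%:R *: y].
have IN : I `<=` N by move=> _ [y Fy ->]; exact: IH.
have Iz : zsub I.
  split; first by exists 0; rewrite ?scaler0 //; exact: zsub_0 (zsub_filtration _).
  move=> _ _ [x Fx ->] [y Fy ->]; exists (x - y); last by rewrite scalerBr.
  exact: zsub_sub (zsub_filtration _) Fx Fy.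
have Isu : I `<=` @strictly_upper n by move=> _ [y /filtration_su Fy ->]; exact: suZ.
have JI : hull d 0 Lam I `<=` I.
  apply: hull_sub => //; first exact: ring_su.
  move=> s _ hs _ [y Fy ->]; rewrite iter_adZ; exists (iter_ad s y) => //.
  by apply: (@filtration_le _ (size s + k.+1)); [exact: leq_addl|exact: ring_iter_ad].
have IL : I `<=` Lam.
  move=> _ [y Fy ->]; apply: zsub_nat; [exact: ring_zsub|exact: ring_filtration Fy].
have NJ x y : N x -> hull d 0 Lam I y -> N (x + y).
  move=> Nx Jy; have sx := Nsu Nx.
  have Lx : Lam x by exact/ring_Gam/NG.
  have LNx : Lam (- x) by apply: zsub_opp => //; exact: ring_zsub.
  have sy : su y by apply/Isu/JI.
  rewrite -[x + y](bchNK sx); last exact: suD.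
  apply: NM => //; apply/IN/JI.
  have := @bch_perturb n d hd Lam (hull d 0 Lam I) (hull d 0 Lam I) ring_su ring_zsub
    ring_lie _ (zsub_hull _ _ _ _) (zsub_hull _ _ _ _) _ _ (- x) x 0 y LNx Lx
    (zsub_0 (zsub_hull _ _ _ _)) Jy.
  rewrite addr0 bchNl // !subr0 => h.
  rewrite -[bch _ _](subrK y); apply: zsub_add Jy; first exact: zsub_hull.
  apply: h => //; first by move=> u /JI/IL.
  move=> u v Lu Jv; have [v' Jv' ->] := hull_br d0 Lu Jv.
  by exists v' => //; exact: hull_weaken Jv'.
rewrite /= -/D -/k -[X in N X](addrK ((d ^ n * D)%:R *: m)).
apply: NJ; last first.
  apply: zsub_opp; first exact: zsub_hull.
  rewrite natrM natrX -scalerA; apply: (@hull_mul n d Lam I); by exists m.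
by rewrite natrM -scalerA -scalerDr; exact: N_nat.
Qed.

End Malcev.

(** By malcev_step, n steps down the filtration reach the whole ideal. That D is chosen
before N makes the comparison of indices uniform over all normal subgroups. *)
Theorem malcev n : exists2 D, (0 < D)%N &
  forall Gam N : set 'M[rat]_n, Gam `<=` @strictly_upper n -> N `<=` Gam ->
    bch_subgroup N ->
    (forall g x, Gam g -> N x -> N (bch (bch g x) (- g))) ->
    forall z, lie_filtration Gam N 0 z -> N (D%:R *: z).
Proof.
have [d hd] := bch_bound_exists n.
have d0 : (0 < d ^ n)%N by rewrite expn_gt0 hd.1.
have a0 k : (0 < approx_factor n d k)%N.
  by elim: k => //= k IH; rewrite !muln_gt0 d0 fact_gt0.
exists (malcev_factor n d n).
  by elim: {2}n => //= j IH; rewrite !muln_gt0 d0 IH a0.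
move=> Gam N Gsu NG Nbch Nconj z Fz.
by apply: (malcev_step hd Gsu NG Nbch Nconj (leqnn n)); rewrite subnn.
Qed.

(** * Group automorphisms are Lie ring automorphisms *)

Section BlockDiagonal.
Variable n : nat.
Implicit Types A B U V : 'M[rat]_n.

Definition bdiag A B : 'M[rat]_(n + n) := block_mx A 0 0 B.

Lemma bdiagD A B A' B' : bdiag A B + bdiag A' B' = bdiag (A + A') (B + B').
Proof. by rewrite /bdiag add_block_mx !addr0. Qed.

Lemma bdiagZ a A B : a *: bdiag A B = bdiag (a *: A) (a *: B).
Proof. by rewrite /bdiag scale_block_mx !scaler0. Qed.

Lemma bdiagN A B : - bdiag A B = bdiag (- A) (- B).
Proof. by rewrite -scaleN1r bdiagZ !scaleN1r. Qed.

Lemma bdiagM A B A' B' : bdiag A B *m bdiag A' B' = bdiag (A *m A') (B *m B').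
Proof. by rewrite /bdiag mulmx_block !mulmx0 !mul0mx !addr0 !add0r. Qed.

Lemma bdiag_lie A B A' B' :
  mlie (bdiag A B) (bdiag A' B') = bdiag (mlie A A') (mlie B B').
Proof. by rewrite /mlie !bdiagM bdiagN bdiagD. Qed.

Lemma bdiag1 : 1%:M = bdiag 1%:M 1%:M.
Proof. by rewrite /bdiag -scalar_mx_block. Qed.

Lemma bdiag0 : 0 = bdiag 0 0.
Proof. by rewrite /bdiag block_mx0. Qed.

Lemma bdiagX A B k : bdiag A B ^+ k = bdiag (A ^+ k) (B ^+ k).
Proof.
elim: k => [|k IH]; first by rewrite !expr0 -[1]/(1%:M) bdiag1.
by rewrite !exprS IH -!mulmxE bdiagM.
Qed.

Lemma bdiag_sum I (r : seq I) (F F' : I -> 'M[rat]_n) :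
  \sum_(i <- r) bdiag (F i) (F' i) = bdiag (\sum_(i <- r) F i) (\sum_(i <- r) F' i).
Proof.
elim: r => [|i r IH]; first by rewrite !big_nil bdiag0.
by rewrite !big_cons IH bdiagD.
Qed.

Lemma bdiag_inj A B A' B' : bdiag A B = bdiag A' B' -> A = A' /\ B = B'.
Proof. by move=> /eq_block_mx[-> _ _ ->]. Qed.

Lemma su_bdiag A B : su A -> su B -> su (bdiag A B).
Proof.
move=> hA hB i j; rewrite -[i]splitK -[j]splitK.
case: (fintype.split i) => i'; case: (fintype.split j) => j' /=.
- by rewrite /bdiag block_mxEul => ij; exact: hA.
- by rewrite /bdiag block_mxEur mxE.
- by rewrite /bdiag block_mxEdl mxE.
- by rewrite leq_add2l /bdiag block_mxEdr => ij; exact: hB.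
Qed.

Lemma nilpotent_su A : su A -> forall k, (n <= k)%N -> A ^+ k = 0.
Proof.
move=> hA k nk; case: n A hA nk => [|m] A hA nk; first exact: mat0_eq.
by apply: upper_nil nk; exact/strictly_upperE.
Qed.

(** The series of matrices of size n and of size n + n are cut at different places; on
nilpotent matrices of size n this makes no difference. *)
Lemma nil_series (c : nat -> rat) A m k : (forall j, (n <= j)%N -> A ^+ j = 0) ->
  (k <= n.+1)%N ->
  \sum_(k <= i < (n + m).+1) c i *: A ^+ i = \sum_(k <= i < n.+1) c i *: A ^+ i.
Proof.
move=> hA kn; elim: m => [|m IH]; first by rewrite addn0.
rewrite addnS big_nat_recr /=; last by rewrite (leq_trans kn) // ltnS leq_addr.
by rewrite IH hA ?scaler0 ?addr0 // -addnS leq_addr.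
Qed.

Lemma su_mexp A : su A -> su (mexp A - 1%:M).
Proof.
case: n A => [|m] A hA; first by case=> i.
apply/strictly_upperE; rewrite mexpE; apply: gexp_upper; exact/strictly_upperE.
Qed.

Lemma su_unip_mul U V : su (U - 1%:M) -> su (V - 1%:M) -> su (U *m V - 1%:M).
Proof.
case: n U V => [|m] U V hU hV; first by case=> i.
by apply/strictly_upperE/unip_mul; apply/strictly_upperE.
Qed.

Lemma bdiag_mexp A B : su A -> su B -> mexp (bdiag A B) = bdiag (mexp A) (mexp B).
Proof.
move=> hA hB; rewrite /mexp -(nil_series _ n (nilpotent_su hA)) //.
rewrite -(nil_series _ n (nilpotent_su hB)) // -bdiag_sum.
by apply: eq_bigr => i _; rewrite bdiagX bdiagZ.
Qed.

Lemma bdiag_mlog U V : su (U - 1%:M) -> su (V - 1%:M) ->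
  mlog (bdiag U V) = bdiag (mlog U) (mlog V).
Proof.
move=> hU hV; rewrite /mlog -(nil_series _ n (nilpotent_su hU)) //.
rewrite -(nil_series _ n (nilpotent_su hV)) // -bdiag_sum.
by apply: eq_bigr => i _; rewrite bdiag1 bdiagN bdiagD bdiagX bdiagZ.
Qed.

Lemma bdiag_bch A B A' B' : su A -> su B -> su A' -> su B' ->
  bch (bdiag A B) (bdiag A' B') = bdiag (bch A A') (bch B B').
Proof.
move=> hA hB hA' hB'; rewrite /bch !bdiag_mexp // bdiagM bdiag_mlog //.
- exact: su_unip_mul (su_mexp hA) (su_mexp hA').
- exact: su_unip_mul (su_mexp hB) (su_mexp hB').
Qed.

End BlockDiagonal.

Section Automorphisms.
Variables (n : nat) (G : set 'M[rat]_n).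
Hypothesis HG : LR_group G.
Variable f : 'M[rat]_n -> 'M[rat]_n.
Hypothesis Hf : is_aut G f.

Let Gsu : G `<=` @strictly_upper n. Proof. by move=> x /(LR_upper HG). Qed.
Let fG x : G x -> G (f x). Proof. by have [[h _ _] _ _] := Hf; exact: h. Qed.
Let fM x y : G x -> G y -> f (bch x y) = bch (f x) (f y).
Proof. by have [_ _ h] := Hf; exact: h. Qed.

Lemma aut_nat k x : G x -> G (k%:R *: x) /\ f (k%:R *: x) = k%:R *: f x.
Proof.
have [G0 GM GN] := LR_subgroup HG.
move=> Gx; elim: k => [|k [Gk fk]].
  rewrite !scale0r; split=> //; have sf0 := Gsu (fG G0).
  have := fM G0 G0; rewrite bch0l; last exact: su_0.
  by move=> /(congr1 (bch (- f 0))); rewrite bchNl // bchKl // => <-.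
have E y : su y -> k.+1%:R *: y = bch y (k%:R *: y).
  by move=> hy; rewrite -{2}[y]scale1r bchZ // nat1r.
by rewrite !E ?fM ?fk //; [split=> //; exact: GM|exact/Gsu/fG|exact: Gsu].
Qed.

Definition graph : set 'M[rat]_(n + n) := [set X | exists2 x, G x & X = bdiag x (f x)].

(** The graph of f is a subgroup of the block diagonal matrices. By malcev, with the
graph in the role of both Gam and N, it contains multiples of sums and brackets of its
elements. *)
Lemma graph_malcev : exists2 D, (0 < D)%N & forall x y, G x -> G y ->
  graph (D%:R *: bdiag (x + y) (f x + f y)) /\
  graph (D%:R *: bdiag (mlie x y) (mlie (f x) (f y))).
Proof.
have [D D0 h] := malcev (n + n); exists D => // x y Gx Gy.
have [G0 GM GN] := LR_subgroup HG.
have gsu : graph `<=` @strictly_upper (n + n).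
  by move=> _ [z Gz ->]; apply: su_bdiag; apply: Gsu => //; exact: fG.
have fN z : G z -> f (- z) = - f z.
  move=> Gz; have [sz sfz] := (Gsu Gz, Gsu (fG Gz)).
  have := fM Gz (GN _ Gz); rewrite bchN //.
  have [_] := aut_nat 0 G0; rewrite !scale0r => ->.
  move=> /(congr1 (bch (- f z))); rewrite bchKl //; last exact/Gsu/fG/GN.
  by rewrite bch0r //; exact: suN.
have gM (X Y : _) : graph X -> graph Y -> graph (bch X Y).
  move=> [z Gz ->] [t Gt ->]; exists (bch z t); first exact: GM.
  by rewrite bdiag_bch ?fM //; apply: Gsu => //; exact: fG.
have gN X : graph X -> graph (- X).
  by move=> [z Gz ->]; exists (- z); [exact: GN|rewrite bdiagN fN].
have gb : bch_subgroup graph.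
  split=> //; exists 0 => //; have [_] := aut_nat 0 G0; rewrite !scale0r => ->.
  by rewrite bdiag0.
have gx : graph (bdiag x (f x)) by exists x.
have gy : graph (bdiag y (f y)) by exists y.
have key := h graph graph gsu (@subset_refl _ _) gb
   (fun g z gg gz => gM _ _ (gM _ _ gg gz) (gN _ gg)).
have Fx z : graph z -> lie_filtration graph graph 0 z.
  by move=> gz; apply: sub_zspan; exists [::], z.
rewrite -bdiagD -bdiag_lie; split; apply: key.
  by apply: zsub_add; [exact: zsub_filtration|exact: Fx|exact: Fx].
by apply: sub_zspan; exists [:: bdiag x (f x)], (bdiag y (f y)); split=> // z;
  rewrite inE => /eqP ->.
Qed.

(** A point of the graph over D (x + y) has second entry D f (x + y), as D (x + y) is
the D-th power of x + y. *)
Lemma aut_additive x y : G x -> G y -> f (x + y) = f x + f y.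
Proof.
move=> Gx Gy; have [D D0 h] := graph_malcev.
have [[z Gz]] := h x y Gx Gy; rewrite bdiagZ => /bdiag_inj[<- E] _.
have Gxy : G (x + y) by exact: LR_add.
move: E; have [_ ->] := aut_nat D Gxy.
by move=> /(scalerI _) -> //; rewrite pnatr_eq0 -lt0n.
Qed.

Lemma aut_lie x y : G x -> G y -> f (mlie x y) = mlie (f x) (f y).
Proof.
move=> Gx Gy; have [D D0 h] := graph_malcev.
have [_ [z Gz]] := h x y Gx Gy; rewrite bdiagZ => /bdiag_inj[<- E].
have Gxy : G (mlie x y) by exact: LR_lie.
move: E; have [_ ->] := aut_nat D Gxy.
by move=> /(scalerI _) -> //; rewrite pnatr_eq0 -lt0n.
Qed.

End Automorphisms.

(** * Indices and detection *)

Section Index.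
Variables (R : realType) (T : choiceType).
Implicit Types (op : T -> T -> T) (G N : set T) (P : set (set T)).

(** A bound on the index of a subgroup by a map to {0, ..., K - 1} that separates the
classes: no quotient is formed, and relations coming from different operations can
be combined. *)
Definition classes_le (K : nat) G (P : T -> T -> Prop) := exists cls : T -> nat,
  (forall x, G x -> (cls x < K)%N) /\
  forall x y, G x -> G y -> cls x = cls y -> P x y.

Lemma index_le op G N K :
  classes_le K G (fun x y => op x @` N = op y @` N) ->
  (index_in R op G N <= K%:R%:E)%E.
Proof.
move=> [cls [clsK clsE]]; rewrite /index_in /counting.
pose A := [set op g @` N | g in G]; rewrite -/A.
have [h hh] : exists h : nat -> set T, A `<=` h @` `I_K.
  have /choice[h hP] : forall i : nat, exists B : set T,
      forall x, G x -> cls x = i -> B = op x @` N.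
    move=> i; have [[x [Gx xi]]|no] := pselect (exists x, G x /\ cls x = i).
      by exists (op x @` N) => y Gy yi; apply: clsE => //; rewrite xi yi.
    by exists set0 => y Gy yi; case: no; exists y.
  exists h => _ [x Gx <-]; exists (cls x); first exact: clsK.
  exact: hP.
have Ale : (A #<= `I_K)%card.
  exact: card_le_trans (subset_card_le hh) (card_image_le _ _).
have finA : finite_set A by apply: sub_finite_set hh _; exact/finite_image/finite_II.
by rewrite asboolT // lee_fin ler_nat geq_card_fset_set.
Qed.

Lemma index_classes op G N : index_in R op G N = +oo%E \/
  exists2 K : nat, index_in R op G N = K%:R%:E &
    classes_le K G (fun x y => op x @` N = op y @` N).
Proof.
rewrite /index_in /counting; case: asboolP => finA; [right|by left].
set A := [set _ | g in G] in finA *; have /finite_setP[m Am] := finA.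
exists m; first by rewrite (card_fset_set Am).
have := Am; rewrite card_eq_le => /andP[/pcard_leP[f] _].
exists (fun x => f (op x @` N)); split=> [x Gx|x y Gx Gy E].
  by have := @funS _ _ _ _ f (op x @` N); apply; exists x.
by apply: (@inj _ _ _ f) => //; rewrite inE; [exists x|exists y].
Qed.

Lemma index_ge1 op G N g : G g -> (1%:E <= index_in R op G N)%E.
Proof.
move=> Gg; have [->|[K -> [cls [h _]]]] := index_classes op G N; first exact: leey.
by rewrite lee_fin ler1n; have := h g Gg; case: (K).
Qed.

Lemma detect_ge1 op G P g : G g -> (1%:E <= detect R op G P g)%E.
Proof. by move=> Gg; apply: le_ereal_inf_tmp => _ [N _ <-]; exact: index_ge1 Gg. Qed.

Lemma detect_le op1 op2 G P1 P2 g (C : nat) : (0 < C)%N ->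
  (forall N, P1 N -> ~ N g -> exists N', [/\ P2 N', ~ N' g &
     forall K, classes_le K G (fun x y => op1 x @` N = op1 y @` N) ->
       classes_le (C * K) G (fun x y => op2 x @` N' = op2 y @` N')]) ->
  (detect R op2 G P2 g <= C%:R%:E * detect R op1 G P1 g)%E.
Proof.
move=> C0 h; have C0' : 0 < C%:R :> R by rewrite ltr0n.
rewrite -lee_pdivrMl //; apply: le_ereal_inf_tmp => _ [N [PN gN] <-].
rewrite lee_pdivrMl //; have [N' [PN' gN' hK]] := h N PN gN.
have le : (detect R op2 G P2 g <= index_in R op2 G N')%E.
  by apply: ereal_inf_lbound; exists N'.
have [->|[K -> hc]] := index_classes op1 G N; first by rewrite gt0_muley ?lte_fin ?leey.
by apply: (le_trans le); rewrite -EFinM -natrM; exact/index_le/hK.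
Qed.

End Index.

(** * Finiteness of the index of multiples *)

Section Lattice.
Variable n : nat.
Local Notation M := 'M[rat]_n.

(** Induction on the generators: x is sorted by its coefficient at e modulo m, then by
its remainder in the span of the other generators. The generators need not be
independent; kap is any choice of coefficient. *)
Lemma zspan_seq_classes (b : seq M) (m : nat) : (0 < m)%N ->
  exists2 K, (0 < K)%N & classes_le K (zspan [set` b])
    (fun x y => exists2 z, zspan [set` b] z & x - y = m%:R *: z).
Proof.
move=> m0; elim: b => [|e b [K K0 [cls [hK hcls]]]].
  exists 1%N => //; exists (fun=> 0%N); split=> // x y hx hy _.
  have z0 v : zspan [set` ([::] : seq M)] v -> v = 0.
    apply: (@zspan_sub _ _ [set 0]) => //.
    by split=> // u w -> ->; rewrite /= subrr.
  by exists 0; [exact: zspan_zero|rewrite (z0 x hx) (z0 y hy) subrr scaler0].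
have hsub : zspan [set` b] `<=` zspan [set` e :: b].
  apply: zspan_sub; first exact: zsub_zspan.
  by move=> x /= xb; apply: sub_zspan; rewrite /= inE xb orbT.
have /choice[kap hkap] : forall x, exists k : int, zspan [set` e :: b] x ->
    zspan [set` b] (x - k%:~R *: e).
  move=> x; have [hx|no] := pselect (zspan [set` e :: b] x); last by exists 0.
  suff [k hk] : exists k : int, zspan [set` b] (x - k%:~R *: e) by exists k.
  elim: hx => [|y|y z _ [k hk] _ [l hl]].
  - by exists 0; rewrite scale0r subrr; exact: zspan_zero.
  - rewrite /= inE => /predU1P[->|yb].
      by exists 1; rewrite scale1r subrr; exact: zspan_zero.
    by exists 0; rewrite scale0r subr0; exact: sub_zspan.
  - exists (k - l); have := zspan_diff hk hl; congr zspan.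
    by apply/matrixP => i j; rewrite !mxE rmorphB /=; ring.
have mZ : (m%:Z != 0)%R by rewrite eqz_nat -lt0n.
pose r x := `|(kap x %% m%:Z)%Z|%N.
have rm x : (r x < m)%N.
  by rewrite -ltz_nat gez0_abs ?modz_ge0 // ltz_pmod // ltz_nat.
exists (m * K)%N; first by rewrite muln_gt0 m0.
exists (fun x => r x * K + cls (x - (kap x)%:~R *: e)%R)%N; split=> [x hx|x y hx hy E].
  have := hK _ (hkap x hx); move: (cls _) (r x) (rm x) => c a; nia.
have cx := hK _ (hkap x hx); have cy := hK _ (hkap y hy).
have Er : r x = r y.
  by have := congr1 (divn^~ K) E; rewrite /= !divnMDl // !divn_small // !addn0.
have Ec : cls (x - (kap x)%:~R *: e) = cls (y - (kap y)%:~R *: e).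
  by move: E; rewrite Er => /addnI.
have [z hz Ez] := hcls _ _ (hkap x hx) (hkap y hy) Ec.
have Em : kap x - kap y = m%:Z * ((kap x %/ m%:Z)%Z - (kap y %/ m%:Z)%Z).
  have Er' : (kap x %% m%:Z)%Z = (kap y %% m%:Z)%Z.
    by move: Er => /(congr1 Posz); rewrite /r !gez0_abs ?modz_ge0.
  by rewrite {1}(divz_eq (kap x) m%:Z) {1}(divz_eq (kap y) m%:Z) Er'; ring.
exists (z + ((kap x %/ m%:Z)%Z - (kap y %/ m%:Z)%Z)%:~R *: e).
  apply: zsub_add; [exact: zsub_zspan|exact: hsub|apply: zsub_int].
  - exact: zsub_zspan.
  - exact: intr_int.
  - by apply: sub_zspan; rewrite /= mem_head.
rewrite scalerDr -Ez scalerA -[m%:R]/(m%:Z%:~R) -intrM -Em rmorphB /=.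
by apply/matrixP => i j; rewrite !mxE; ring.
Qed.

(** The index k stands for weight k + 1: right-normed brackets of k + 1 entries of Sq. *)
Fixpoint gen_brackets (Sq : seq M) (k : nat) : seq M :=
  if k is k'.+1 then [seq mlie s e | s <- Sq, e <- gen_brackets Sq k'] else Sq.

Variables (Sq : seq M) (G : set M).
Hypotheses (HG : LR_group G) (gen : generates [set` Sq] G).
Let Gsu : G `<=` @strictly_upper n. Proof. by move=> x /(LR_upper HG). Qed.

Lemma LR_zsub : zsub G.
Proof.
have [G0 _ GN] := LR_subgroup HG; split=> // x y Gx Gy.
by apply: (LR_add HG) => //; exact: GN.
Qed.

Lemma gen_brackets_sub k e : e \in gen_brackets Sq k -> G e.
Proof.
elim: k e => [|k IH] e /=; first by case: gen => h _ /h.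
case/allpairsP => -[s f] /= [sS /IH Gf ->]; apply: (LR_lie HG) => //.
by case: gen => h _; exact: h.
Qed.

Lemma gen_brackets_upper k e : e \in gen_brackets Sq k -> upper_by k.+1 e.
Proof.
elim: k e => [|k IH] e /=.
  by move=> eS; apply/strictly_upperE/Gsu; case: gen => h _; exact: h.
case/allpairsP => -[s f] /= [sS /IH hf ->]; rewrite -add1n; apply: upper_by_mlie => //.
by apply/strictly_upperE/Gsu; case: gen => h _; exact: h.
Qed.

(** Jacobi identity, by induction on the first weight. *)
Lemma gen_brackets_lie k l e f : e \in gen_brackets Sq k -> f \in gen_brackets Sq l ->
  zspan [set` gen_brackets Sq (k + l).+1] (mlie e f).
Proof.
elim: k l e f => [|k IH] l e f.
  by move=> eS fl; apply: sub_zspan; apply/allpairsP; exists (e, f).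
case/allpairsP => -[s e1] [sS e1k ->] fl; rewrite mlie_jacobi.
apply: zspan_diff; last first.
  have := IH l.+1 e1 (mlie s f) e1k; rewrite addnS; apply.
  by apply/allpairsP; exists (s, f).
have : zspan [set` gen_brackets Sq (k + l).+1] (mlie e1 f) by exact: IH.
apply: (@zspan_sub _ _ [set v | zspan [set` gen_brackets Sq (k.+1 + l).+1] (mlie s v)]).
  split=> [|x y /= hx hy]; first by rewrite /= mlie0r; exact: zspan_zero.
  by rewrite mlieBr; exact: zspan_diff.
by move=> v vk /=; apply: sub_zspan; apply/allpairsP; exists (s, v).
Qed.

(** Scale the brackets of weight k + 1 by d^(-k). Their span L has [L, L] inside d L, so
it is closed under bch and contains G, which is generated by Sq. As brackets of
weight above n vanish, d^n clears the scaling factors. *)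
Lemma lattice_bound : exists2 D, (0 < D)%N & forall v, G v ->
  zspan [set e | exists2 k, (k < n)%N & e \in gen_brackets Sq k] (D%:R *: v).
Proof.
have [d hd] := bch_bound_exists n; have d0 := hd.1.
have dn0 : d%:R != 0 :> rat by rewrite pnatr_eq0 -lt0n.
pose X : set M := [set v | exists k e, e \in gen_brackets Sq k /\ v = (d%:R ^+ k)^-1 *: e].
pose L := zspan X.
have Lz : zsub L by exact: zsub_zspan.
have Lsu : L `<=` @strictly_upper n.
  apply: zspan_sub; first exact: zsub_su.
  by move=> _ [k [e [ek ->]]]; apply: suZ; apply/Gsu/(gen_brackets_sub ek).
have LL a b : L a -> L b -> exists2 c, L c & mlie a b = d%:R *: c.
  have hz a' : zsub [set b | exists2 c, L c & mlie a' b = d%:R *: c].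
    split; first by exists 0; [exact: zspan_zero|rewrite mlie0r scaler0].
    move=> x y [x' hx Ex] [y' hy Ey]; exists (x' - y'); first exact: zspan_diff.
    by rewrite mlieBr Ex Ey scalerBr.
  have hz' b' : zsub [set a | exists2 c, L c & mlie a b' = d%:R *: c].
    split; first by exists 0; [exact: zspan_zero|rewrite mlie0l scaler0].
    move=> x y [x' hx Ex] [y' hy Ey]; exists (x' - y'); first exact: zspan_diff.
    by rewrite mlieBl Ex Ey scalerBr.
  move=> La Lb; move: a La; apply: (zspan_sub (hz' b)) => _ [k [e [ek ->]]].
  move: b Lb; apply: (zspan_sub (hz _)) => _ [l [f [fl ->]]].
  exists ((d%:R ^+ (k + l).+1)^-1 *: mlie e f).
    have := gen_brackets_lie ek fl; apply: (@zspan_sub _ _ [set v | L (_ *: v)]).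
      split=> [|x y hx hy] /=; first by rewrite scaler0; exact: zspan_zero.
      by rewrite scalerBr; exact: zspan_diff.
    by move=> v vk /=; apply: sub_zspan; exists (k + l).+1, v.
  rewrite mlieZl mlieZr !scalerA; congr (_ *: _).
  by rewrite exprS exprD; field; rewrite expf_neq0 //= expf_neq0.
have Lbr a b : L a -> L b -> L (mlie a b).
  by move=> La Lb; have [c Lc ->] := LL a b La Lb; exact: zsub_nat.
have LM x y : L x -> L y -> L (bch x y).
  move=> Lx Ly; have L0 : L 0 by exact: zspan_zero.
  have := bch_perturb hd Lsu Lz Lbr (@subset_refl _ L) Lz Lz (@subset_refl _ L) LL L0 L0 Lx Ly.
  rewrite !add0r bch0l ?subr0; last exact: su_0.
  by move=> h; rewrite -[bch x y](subrK x) -[_ - x](subrK y); do 2!apply: zsub_add => //.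
have GL : G `<=` L.
  move=> v; case: gen => SG h /h[s hs ->]; elim: s hs => [|A s IH] hs /=.
    exact: zspan_zero.
  apply: LM; last by apply: IH => B Bs; apply: hs; rewrite inE Bs orbT.
  have SL x : x \in Sq -> L x.
    by move=> xS; apply: sub_zspan; exists 0%N, x; rewrite expr0 invr1 scale1r.
  case: (hs A (mem_head _ _)) => [/SL//|/SL h'].
  by rewrite -[A]opprK; exact: zsub_opp.
exists (d ^ n)%N; first by rewrite expn_gt0 d0.
move=> v /GL; apply: (@zspan_sub _ _ [set v | zspan _ (_ *: v)]).
  split=> [|x y hx hy] /=; first by rewrite scaler0; exact: zspan_zero.
  by rewrite scalerBr; exact: zspan_diff.
move=> _ [k [e [ek ->]]] /=; have [kn|nk] := ltnP k n; last first.
  rewrite (@upper_by_ge _ _ e) ?scaler0; first exact: zspan_zero.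
  by apply: upper_byW (gen_brackets_upper ek) _; exact: leqW.
have -> : (d ^ n)%:R *: ((d%:R ^+ k)^-1 *: e) = (d ^ (n - k))%:R *: e.
  rewrite scalerA; congr (_ *: _).
  by rewrite -{1}(subnK (ltnW kn)) expnD natrM -mulrA [(d ^ k)%:R]natrX mulfV ?mulr1 ?expf_neq0.
apply: zsub_nat; first exact: zsub_zspan.
by apply: sub_zspan; exists k.
Qed.

(** The group G lies between the span of the finite list b and 1/D times this span. *)
Lemma index_multiples (E : nat) : (0 < E)%N -> exists2 K, (0 < K)%N &
  classes_le K G (fun x y => exists2 z, G z & x - y = E%:R *: z).
Proof.
move=> E0; have [D D0 hD] := lattice_bound.
pose b := flatten [seq gen_brackets Sq k | k <- iota 0 n].
have bE : [set e | exists2 k, (k < n)%N & e \in gen_brackets Sq k] `<=` [set` b].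
  by move=> e [k kn ek]; apply/flatten_mapP; exists k; rewrite ?mem_iota.
have bG : zspan [set` b] `<=` G.
  apply: zspan_sub; first exact: LR_zsub.
  by move=> e /flatten_mapP[k _ /gen_brackets_sub].
have hDb v : G v -> zspan [set` b] (D%:R *: v).
  move=> /hD; apply: zspan_sub; first exact: zsub_zspan.
  by move=> e /bE; exact: sub_zspan.
have DE0 : (0 < D * E)%N by rewrite muln_gt0 D0.
have [K K0 [cls [hK hcls]]] := zspan_seq_classes b DE0.
exists K => //; exists (fun x => cls (D%:R *: x)); split=> [x /hDb/hK//|x y Gx Gy Exy].
have [z /bG Gz Ez] := hcls _ _ (hDb _ Gx) (hDb _ Gy) Exy; exists z => //.
have Dn0 : D%:R != 0 :> rat by rewrite pnatr_eq0 -lt0n.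
by apply: (scalerI Dn0); rewrite scalerBr Ez natrM scalerA.
Qed.

End Lattice.

(** * Detection by ideals and by normal subgroups *)

Section Detection.
Variables (n : nat) (G : set 'M[rat]_n).
Hypothesis HG : LR_group G.
Local Notation M := 'M[rat]_n.

Let Gsu : G `<=` @strictly_upper n. Proof. by move=> x /(LR_upper HG). Qed.
Let Gz : zsub G := LR_zsub HG.
Let GM x y : G x -> G y -> G (bch x y). Proof. by case: (LR_subgroup HG) => _ h _; exact: h. Qed.
Let GN x : G x -> G (- x). Proof. by case: (LR_subgroup HG) => _ _; apply. Qed.
Let GL x y : G x -> G y -> G (mlie x y). Proof. exact: (LR_lie HG). Qed.

(** For a J that is only stable under brackets, with no gain of a factor d, the
denominators of the formula remain. *)
Lemma bch_perturb_scaled d (J : set M) x j : bch_bound n d -> J `<=` G -> zsub J ->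
  (forall a i, G a -> J i -> J (mlie a i)) -> G x -> J j ->
  J (d%:R *: (bch x j - x)).
Proof.
move=> [_ [l hl E]] JG Jz GJ Gx Jj.
have GJ1 a i : G a -> J i -> exists2 i', J i' & mlie a i = 1%:R *: i'.
  by move=> Ga Ji; exists (mlie a i); rewrite ?scale1r //; exact: GJ.
have h w := word_perturb Gz GL JG Jz Jz (@subset_refl _ J) GJ1 w Gx (zsub_0 Gz)
   (zsub_0 Jz) Jj.
rewrite E; [|exact: Gsu|exact/Gsu/JG].
rewrite addrAC [x + j]addrC addrK scalerDr.
apply: zsub_add => //; first exact: zsub_nat.
rewrite /lie_eval scaler_sumr; elim: l hl {E} => [|c l IH] /=.
  by rewrite big_nil => _; exact: zsub_0.
move=> /andP[/andP[bw cint] /IH hl]; rewrite big_cons; apply: zsub_add => //.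
have [_ + _] := h c.2; rewrite addr0 add0r (word_eval0 _ bw) subr0 scalerA => Jw.
exact: zsub_int.
Qed.

Lemma bch_coset_eq (N : set M) x y : N `<=` @strictly_upper n -> bch_subgroup N ->
  su x -> su y -> N (bch (- y) x) -> bch x @` N = bch y @` N.
Proof.
move=> Nsu [N0 NM NN] sx sy Nyx.
have sNy := suN sy; have syx : su (bch (- y) x) by exact: su_bch.
have Ex : x = bch y (bch (- y) x) by rewrite bchNK.
have Nxy := NN _ Nyx.
apply/seteqP; split=> _ [v Nv <-].
  exists (bch (bch (- y) x) v); first exact: NM.
  by rewrite bchA // ?bchNK //; exact: Nsu.
exists (bch (- bch (- y) x) v); first exact: NM.
have sv := Nsu _ Nv; rewrite {1}Ex -bchA ?bchNK //.
by apply: su_bch => //; exact: suN.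
Qed.

Lemma bch_coset_mem (N : set M) x y : bch_subgroup N -> su x -> su y ->
  bch x @` N = bch y @` N -> exists2 v, N v & x = bch y v.
Proof.
move=> [N0 _ _] sx sy E; have : (bch x @` N) x by exists 0; rewrite ?bch0r.
by rewrite E => -[v Nv <-]; exists v.
Qed.

Lemma add_coset_eq (I : set M) x y : zsub I -> I (x - y) ->
  +%R x @` I = +%R y @` I.
Proof.
move=> Iz Ixy; apply/seteqP; split=> _ [v Iv <-].
  exists (x - y + v); first exact: zsub_add.
  by rewrite addrA [y + _]addrC subrK.
exists (v - (x - y)); first exact: zsub_sub.
by rewrite opprB addrCA [x + _]addrC subrK addrC.
Qed.

Lemma add_coset_mem (I : set M) x y : I 0 -> +%R x @` I = +%R y @` I -> I (x - y).
Proof.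
move=> I0 E; have : (+%R x @` I) x by exists 0; rewrite ?addr0.
by rewrite E => -[v Iv <-]; rewrite addrAC subrr add0r.
Qed.

(** The element x is sorted by its class modulo E G and then by the P-class of u, where
x = rep + E u for a fixed representative. So replacing P by the relation that P
induces on the multiples by E costs the factor [G : E G] only. *)
Lemma classes_mul (E K : nat) (P : M -> M -> Prop) m : (0 < E)%N ->
  classes_le K G (fun x y => exists2 z, G z & x - y = E%:R *: z) ->
  classes_le m G P ->
  classes_le (K * m) G (fun x y => exists u v, [/\ G u, G v, P u v & x - y = E%:R *: (u - v)]).
Proof.
move=> E0 [cl [hK hcl]] [cl' [hm hcl']].
have /choice[rep hrep] : forall i : nat, exists r, forall x, G x -> cl x = i ->
    exists2 z, G z & x - r = E%:R *: z.
  move=> i; have [[r [Gr ri]]|no] := pselect (exists r, G r /\ cl r = i).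
    by exists r => x Gx xi; apply: hcl => //; rewrite ri.
  by exists 0 => x Gx xi; case: no; exists x.
have /choice[u hu] : forall x, exists u, G x -> G u /\ x - rep (cl x) = E%:R *: u.
  move=> x; have [Gx|no] := pselect (G x); last by exists 0.
  by have [z Gz' Ez] := hrep _ x Gx erefl; exists z.
exists (fun x => cl x * m + cl' (u x))%N; split=> [x Gx|x y Gx Gy e].
  have [Gu _] := hu x Gx; have := hm _ Gu; have := hK _ Gx.
  move: (cl x) (cl' _) => p q; nia.
have [Gu Eu] := hu x Gx; have [Gv Ev] := hu y Gy.
have m0 : (0 < m)%N by apply: leq_ltn_trans (hm _ Gu).
have Ec : cl x = cl y.
  have := congr1 (divn^~ m) e; rewrite /= !divnMDl //.
  by rewrite !divn_small ?addn0 ?hm.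
have Ec' : cl' (u x) = cl' (u y) by move: e; rewrite Ec => /addnI.
exists (u x), (u y); split=> //; first exact: hcl'.
by rewrite scalerBr -Eu -Ev Ec opprB addrA subrK.
Qed.

Section Invariance.
Variable H : set (M -> M).
Hypothesis HH : aut_subgroup G H.

Let Haut xi : H xi -> is_aut G xi. Proof. by case: HH => h _ _ _; exact: h. Qed.

Lemma aut_G xi x : H xi -> G x -> G (xi x).
Proof. by move=> /Haut[[h _ _] _ _]; exact: h. Qed.

(** Invariance as an equality follows from the inclusion, because H contains inverses. *)
Lemma invariant_image (I : set M) : I `<=` G ->
  (forall xi x, H xi -> I x -> I (xi x)) -> forall xi, H xi -> xi @` I = I.
Proof.
move=> IG h xi Hxi; apply/seteqP; split=> [_ [x Ix <-]|x Ix]; first exact: h.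
have [_ _ _ /(_ _ Hxi)[g Hg gK]] := HH.
exists (g x); first exact: h.
have [[_ _ sur] _ _] := Haut Hxi.
by have [y Gy <-] := sur x (IG _ Ix); rewrite gK.
Qed.

Lemma aut0 xi : H xi -> xi 0 = 0.
Proof.
by move=> /Haut h; have [_] := aut_nat HG h 0 (zsub_0 Gz); rewrite !scale0r.
Qed.

Lemma autB xi x y : H xi -> G x -> G y -> xi (x - y) = xi x - xi y.
Proof.
move=> Hxi Gx Gy; have h := Haut Hxi.
have Gxy := zsub_sub Gz Gx Gy.
by apply/eqP; rewrite -subr_eq opprK -(aut_additive HG h) // subrK.
Qed.

Lemma aut_int xi x (k : int) : H xi -> G x -> xi (k%:~R *: x) = k%:~R *: xi x.
Proof.
move=> Hxi Gx; have h := Haut Hxi; case: k => k.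
  by have [_] := aut_nat HG h k Gx.
have [Gk Ek] := aut_nat HG h k.+1 Gx.
by rewrite NegzE mulrNz !scaleNr -sub0r autB ?aut0 ?sub0r ?Ek //; exact: zsub_0.
Qed.

Lemma aut_rat xi x (q : rat) : H xi -> G x -> G (q *: x) -> xi (q *: x) = q *: xi x.
Proof.
move=> Hxi Gx Gqx; have q0 : (denq q)%:~R != 0 :> rat by rewrite intr_eq0 denq_neq0.
apply: (scalerI q0); rewrite -aut_int // !scalerA [_ * q]mulrC -numqE aut_int //.
Qed.

Lemma aut_iter_ad xi s x : H xi -> (forall g, g \in s -> G g) -> G x ->
  G (iter_ad s x) /\ xi (iter_ad s x) = iter_ad (map xi s) (xi x).
Proof.
move=> Hxi + Gx; elim: s => [|g s IH] hs //=.
have Gg : G g by exact/hs/mem_head.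
have [Gs Es] : G (iter_ad s x) /\ xi (iter_ad s x) = iter_ad (map xi s) (xi x).
  by apply: IH => h hh; apply: hs; rewrite inE hh orbT.
split; first exact: GL.
by rewrite (aut_lie HG (Haut Hxi)) // Es.
Qed.

Lemma aut_zspan X xi : H xi -> X `<=` G -> (forall x, X x -> zspan X (xi x)) ->
  forall x, zspan X x -> zspan X (xi x).
Proof.
move=> Hxi XG h x hx.
suff [] : G x /\ zspan X (xi x) by [].
elim: hx => [|y Xy|y z _ [Gy hy] _ [Gz' hz]].
- by rewrite aut0 //; split; [exact: zsub_0|exact: zspan_zero].
- by split; [exact: XG|exact: h].
- split; first exact: zsub_sub.
  by rewrite autB //; exact: zspan_diff.
Qed.

(** As [G, N] lies in d N, translation by N in both arguments does not change bch modulo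
N. This makes N a subgroup, normal, with additive cosets contained in cosets for bch. *)
Lemma ideal_to_normal d I : bch_bound n d -> invariant_ideal G H I ->
  let N := hull d 0 G I in
  [/\ invariant_normal G H N, N `<=` I, forall x, I x -> N ((d ^ n)%:R *: x)
    & forall x y, G x -> G y -> N (x - y) -> N (bch (- y) x)].
Proof.
move=> hd [[IG [I0 IB] IL] Iinv] N; have d0 := hd.1.
have Iz : zsub I by split.
have IL' a x : G a -> I x -> I (mlie a x).
  by move=> Ga Ix; rewrite mlieC; apply: zsub_opp => //; exact: IL.
have Isu : I `<=` @strictly_upper n by move=> x /IG/Gsu.
have NI : N `<=` I.
  apply: hull_sub => // s x hs _ Ix; elim: s hs => //= g s IH hs.
  apply: IL'; first exact/hs/mem_head.
  by apply: IH => h hh; apply: hs; rewrite inE hh orbT.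
have NG : N `<=` G by move=> x /NI/IG.
have Nz : zsub N by exact: zsub_hull.
have NL a j : G a -> N j -> exists2 j', N j' & mlie a j = d%:R *: j'.
  move=> Ga Nj; have [j' Jj' ->] := hull_br d0 Ga Nj.
  by exists j' => //; exact: hull_weaken Jj'.
have P x y j k : G x -> G y -> N j -> N k -> N (bch (x + j) (y + k) - bch x y).
  move=> Gx Gy Nj Nk.
  have := bch_perturb hd Gsu Gz GL NG Nz Nz (@subset_refl _ N) NL Gx Gy Nj Nk.
  set A := _ - bch x y => h.
  by rewrite -[A](subrK j) -[A - j](subrK k); do 2!apply: zsub_add => //.
have N0 : N 0 by exact: zsub_0.
have G0 : G 0 by exact: zsub_0.
have s0 : su (0 : M) by exact: su_0.
split=> //; last first.
- move=> x y Gx Gy Nxy.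
  have := P (- y) y 0 (x - y) (GN Gy) Gy N0 Nxy.
  by rewrite addr0 [y + _]addrC subrK bchNl ?subr0 //; exact: Gsu.
- by move=> x Ix; rewrite natrX; exact: hull_mul.
split.
  split=> //.
    split=> // [x y Nx Ny|x Nx]; last exact: zsub_opp.
    by have := P 0 0 x y G0 G0 Nx Ny; rewrite !add0r bch0r // subr0.
  move=> g x Gg Nx; have sg := Gsu Gg.
  have := P g 0 0 x Gg G0 N0 Nx; rewrite addr0 add0r bch0r //; set q := _ - g => Nq.
  have -> : bch g x = g + q by rewrite /q addrC subrK.
  have := P g (- g) q 0 Gg (GN Gg) Nq N0.
  by rewrite addr0 bchN // subr0.
apply: invariant_image => // xi x Hxi; apply: aut_zspan => //.
  by move=> y Xy; apply: NG; apply: sub_zspan.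
move=> _ [s [y [hs _ Iy ->]]]; have Gy := IG _ Iy.
have [Gs Es] := aut_iter_ad Hxi hs Gy.
rewrite aut_rat //; last by apply: NG; apply: sub_zspan; exists s, y.
rewrite Es; apply: sub_zspan; exists (map xi s), (xi y); split=> //.
- by move=> g /mapP[g' /hs Gg' ->]; exact: aut_G.
- by rewrite -(Iinv _ Hxi); exists y.
- by rewrite size_map.
Qed.

(** The ideal is D times the ideal generated by N. Elements in the same coset of N differ
by an element of 1/d times the ideal generated by N. *)
Lemma normal_to_ideal d D N : bch_bound n d ->
  (forall Gam N : set M, Gam `<=` @strictly_upper n -> N `<=` Gam ->
    bch_subgroup N ->
    (forall g x, Gam g -> N x -> N (bch (bch g x) (- g))) ->
    forall z, lie_filtration Gam N 0 z -> N (D%:R *: z)) ->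
  invariant_normal G H N ->
  let I := [set x | exists2 z, lie_filtration G N 0 z & x = D%:R *: z] in
  [/\ invariant_ideal G H I, I `<=` N
    & forall x y, G x -> G y -> N (bch (- y) x) -> I (D%:R *: (d%:R *: (x - y)))].
Proof.
move=> hd hD [[NG Nbch Nconj] Ninv] I.
pose F := lie_filtration G N.
have IN : I `<=` N by move=> _ [z Fz ->]; exact: hD Fz.
have Fz : zsub (F 0) by exact: zsub_filtration.
have FG : F 0 `<=` G.
  apply: zspan_sub => // _ [s [x [hs _ Nx ->]]].
  elim: s hs => [_|g s IH hs] /=; first exact: NG.
  apply: GL; first exact/hs/mem_head.
  by apply: IH => h hh; apply: hs; rewrite inE hh orbT.
have FL a x : G a -> F 0 x -> F 0 (mlie a x).
  by move=> Ga Fx; apply: (@filtration_le _ _ _ 0 1) => //; exact: filtration_br.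
split=> //; last first.
  move=> x y Gx Gy Nyx; exists (d%:R *: (x - y)) => //.
  have sx := Gsu Gx; have sy := Gsu Gy.
  have -> : x = bch y (bch (- y) x) by rewrite bchNK.
  apply: bch_perturb_scaled => //.
  by apply: sub_zspan; exists [::], (bch (- y) x).
split.
  split; [by move=> x /IN/NG| split|].
  - by exists 0; [exact: zsub_0|rewrite scaler0].
  - move=> _ _ [x Fx ->] [y Fy ->]; exists (x - y); last by rewrite scalerBr.
    exact: zsub_sub.
  - move=> _ y [x Fx ->] Gy; exists (mlie x y); last by rewrite mlieZl.
    by rewrite mlieC; apply: zsub_opp => //; exact: FL.
apply: invariant_image => [x /IN/NG//|xi _ Hxi [z Fz' ->]].
exists (xi z); last by have [_ ->] := aut_nat HG (Haut Hxi) D (FG _ Fz').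
apply: aut_zspan Fz' => //.
  by move=> y Xy; apply: FG; apply: sub_zspan.
move=> _ [s [y [hs _ Ny ->]]].
have [Gs Es] := aut_iter_ad Hxi hs (NG _ Ny).
rewrite Es; apply: sub_zspan; exists (map xi s), (xi y); split=> //.
- by move=> g /mapP[g' /hs Gg' ->]; exact: aut_G.
- by rewrite -(Ninv _ Hxi); exists y.
Qed.

Theorem detect_comparable (R : realType) : exists2 C : nat, (0 < C)%N &
  forall g, G g ->
    (detect R (@bch n) G (invariant_normal G H) g <=
       C%:R%:E * detect R +%R G (invariant_ideal G H) g)%E /\
    (detect R +%R G (invariant_ideal G H) g <=
       C%:R%:E * detect R (@bch n) G (invariant_normal G H) g)%E.
Proof.
have [d hd] := bch_bound_exists n; have [D D0 hD] := malcev n.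
have d0 := hd.1; have dn0 : (0 < d ^ n)%N by rewrite expn_gt0 d0.
have [S0 finS0 gen] := LR_fg HG.
have /finite_seqP[Sq ESq] := finS0; rewrite {}ESq in gen.
have Dd0 : (0 < D * d)%N by rewrite muln_gt0 D0.
have [K1 K10 h1] := index_multiples HG gen dn0.
have [K2 K20 h2] := index_multiples HG gen Dd0.
have le_detect (C : nat) (x y : \bar R) : (1%:E <= y)%E ->
    forall K, (x <= K%:R%:E * y)%E -> (K <= C)%N -> (x <= C%:R%:E * y)%E.
  move=> y1 K xK KC; apply: (le_trans xK); apply: lee_wpmul2r.
    by apply: le_trans y1; rewrite lee_fin.
  by rewrite lee_fin ler_nat.
exists (K1 + K2)%N; first by rewrite addn_gt0 K10.
move=> g Gg; split.
  apply: (@le_detect _ _ _ _ K1); [exact: detect_ge1| |exact: leq_addr].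
  apply: detect_le => // I hI gI.
  have [hN NI Nmul Nmem] := ideal_to_normal hd hI.
  exists (hull d 0 G I); split=> // [/NI//|K hK].
  have [cls [cK hcls]] := classes_mul dn0 h1 hK.
  exists cls; split=> // x y Gx Gy /hcls[//|//|u [v [Gu Gv Euv Exy]]].
  have [[NG Nbch _] _] := hN.
  apply: bch_coset_eq => //; [by move=> z /NG/Gsu|exact: Gsu|exact: Gsu|].
  apply: Nmem => //; rewrite Exy; apply: Nmul; apply: add_coset_mem Euv.
  by have [[_ [I0 _] _] _] := hI.
apply: (@le_detect _ _ _ _ K2); [exact: detect_ge1| |exact: leq_addl].
apply: detect_le => // N hN gN.
have [hI IN Imem] := normal_to_ideal hd hD hN.
eexists; split; [exact: hI|by move=> /IN|move=> K hK].
have [cls [cK hcls]] := classes_mul Dd0 h2 hK.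
exists cls; split=> // x y Gx Gy /hcls[//|//|u [v [Gu Gv Euv Exy]]].
have [[_ [I0 IB] _] _] := hI.
apply: add_coset_eq => //; rewrite Exy natrM -scalerA; apply: Imem => //.
have [[NG Nbch _] _] := hN; have [su' sv'] := (Gsu Gu, Gsu Gv).
have [w Nw ->] := bch_coset_mem Nbch su' sv' Euv.
by rewrite bchKl //; exact/Gsu/NG.
Qed.

End Invariance.

End Detection.

(** * The bracket filtration and distortion of commutators *)

Section RationalFiltration.
Variables (n : nat) (L : set 'M[rat]_n) (Sq : seq 'M[rat]_n).
Hypotheses (HL : LR_group L) (gen : generates [set` Sq] L).
Local Notation M := 'M[rat]_n.
Local Notation gen_brackets := (gen_brackets Sq).

Let Lsu : L `<=` @strictly_upper n. Proof. by move=> x /(LR_upper HL). Qed.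
Let Lz : zsub L := LR_zsub HL.
Let LM x y : L x -> L y -> L (bch x y). Proof. by case: (LR_subgroup HL) => _ h _; exact: h. Qed.
Let LN x : L x -> L (- x). Proof. by case: (LR_subgroup HL) => _ _; apply. Qed.

Definition gen_bracket_list k := flatten [seq gen_brackets j | j <- iota k (n - k)].
(** The rational span of the term k + 1 of the lower central series of L: like
gen_brackets, the filtration starts at 0. *)
Definition bracket_span k : {vspace M} := <<gen_bracket_list k>>%VS.

Lemma gen_bracket_listP k e :
  reflect (exists2 j, (k <= j < n)%N & e \in gen_brackets j) (e \in gen_bracket_list k).
Proof.
apply: (iffP flatten_mapP) => [[j]|[j kj ej]].
  rewrite mem_iota => /andP[kj jn] ej; exists j => //; rewrite kj /=.
  by move: jn; case: (leqP k n) => [kn|nk]; [rewrite subnKC|lia].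
by exists j => //; rewrite mem_iota; lia.
Qed.

Lemma bracket_span_mem j k e : (k <= j)%N -> e \in gen_brackets j -> e \in bracket_span k.
Proof.
move=> kj ej; have [jn|nj] := ltnP j n.
  by apply: memv_span; apply/gen_bracket_listP; exists j => //; rewrite kj.
rewrite (@upper_by_ge _ _ e) ?mem0v //.
by apply: upper_byW (gen_brackets_upper HL gen ej) _; exact: leqW.
Qed.

Lemma bracket_span_sub k (V : {vspace M}) :
  (forall j e, (k <= j)%N -> e \in gen_brackets j -> e \in V) ->
  (bracket_span k <= V)%VS.
Proof.
by move=> h; apply/span_subvP => e /gen_bracket_listP[j /andP[kj _]]; exact: h.
Qed.

Lemma bracket_span_le k l : (k <= l)%N -> (bracket_span l <= bracket_span k)%VS.
Proof.
move=> kl; apply: bracket_span_sub => j e lj; apply: bracket_span_mem.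
exact: leq_trans lj.
Qed.

Lemma zspan_vspace (X : set M) (V : {vspace M}) : (forall x, X x -> x \in V) ->
  forall x, zspan X x -> x \in V.
Proof. by move=> h x; elim=> [|y /h//|y z _ hy _ hz]; [exact: mem0v|exact: rpredB]. Qed.

Lemma bracket_span_br k x y : x \in bracket_span 0 -> y \in bracket_span k ->
  mlie x y \in bracket_span k.+1.
Proof.
move=> x0 yk; rewrite (coord_span (X := in_tuple _) x0) mlie_suml.
apply: memv_suml => i _; rewrite mlieZl; apply: memvZ.
rewrite (coord_span (X := in_tuple _) yk) mlie_sumr.
apply: memv_suml => j _; rewrite mlieZr; apply: memvZ.
have /gen_bracket_listP[p _ hp] : (gen_bracket_list 0)`_i \in gen_bracket_list 0 by rewrite mem_nth.
have /gen_bracket_listP[q /andP[kq _] hq] : (gen_bracket_list k)`_j \in gen_bracket_list k by rewrite mem_nth.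
apply: zspan_vspace (gen_brackets_lie hp hq) => e he; apply: bracket_span_mem he.
by rewrite ltnS (leq_trans kq) // leq_addl.
Qed.

Lemma sub_bracket_span0 x : L x -> x \in bracket_span 0.
Proof.
move=> Lx; have [D D0 hD] := lattice_bound HL gen.
have Dn0 : D%:R != 0 :> rat by rewrite pnatr_eq0 -lt0n.
have : D%:R *: x \in bracket_span 0.
  by apply: zspan_vspace (hD x Lx) => e [j _]; exact: bracket_span_mem.
by move=> h; rewrite -[x]scale1r -(mulVf Dn0) -scalerA memvZ.
Qed.

Lemma gen_brackets_L k e : e \in gen_brackets k -> L e.
Proof. exact: (gen_brackets_sub HL gen). Qed.

(** The brackets of one weight may be dependent modulo the next step; phi is a linear
section of the map that they define on coordinates. *)
Lemma bracket_span_coord k : exists phi : {linear M -> 'rV[rat]_(size (gen_brackets k))},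
  (forall v, v \in bracket_span k -> v - \sum_i phi v 0 i *: (gen_brackets k)`_i \in bracket_span k.+1) /\
  (forall v, v \in bracket_span k.+1 -> phi v = 0).
Proof.
set p := size _; pose E := gen_brackets k.
pose g0 (u : 'rV[rat]_p) : M := \sum_i u 0 i *: E`_i.
have g0lin : linear g0.
  move=> q u v; rewrite /g0 scaler_sumr -big_split; apply: eq_bigr => i _.
  by rewrite !mxE scalerDl scalerA.
pose g1 : {linear 'rV[rat]_p -> M} := HB.pack g0 (GRing.isLinear.Build rat _ _ *:%R g0 g0lin).
pose g := linfun g1; have gE u : g u = g0 u by rewrite lfunE.
pose P := (\1 - projv (bracket_span k.+1))%VF.
have PE v : P v = v - projv (bracket_span k.+1) v by rewrite /P add_lfunE opp_lfunE id_lfunE.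
have P0 v : v \in bracket_span k.+1 -> P v = 0 by move=> vU; rewrite PE projv_id // subrr.
pose h := (P \o g)%VF; pose phi := (h^-1 \o P)%VF.
exists (phi : {linear M -> 'rV[rat]_p}); split=> [v vk|v vU]; last first.
  by rewrite /= /phi comp_lfunE P0 // linear0.
have [u [w [wU Ev]]] : exists u w, w \in bracket_span k.+1 /\ v = g u + w.
  have : v \in (limg g + bracket_span k.+1)%VS.
    move: v vk; apply/subvP; apply: bracket_span_sub => j e kj ej.
    have [E1|jk] := eqVneq j k.
      rewrite E1 in ej; apply: (subvP (addvSl _ _)); apply/memv_imgP.
      have ej' : (index e E < p)%N by rewrite index_mem.
      exists (delta_mx 0 (Ordinal ej')); first exact: memvf.
      rewrite gE /g0 (bigD1 (Ordinal ej')) //= big1 ?addr0.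
        by rewrite mxE !eqxx scale1r nth_index.
      by move=> i /negbTE ii; rewrite mxE ii andbF scale0r.
    apply: (subvP (addvSr _ _)); apply: bracket_span_mem ej; lia.
  move=> /memv_addP[x /memv_imgP[u _ ->] [w wU ->]]; exists u, w; by [].
have Pv : P v = h u by rewrite Ev linearD /= (P0 w wU) addr0 /h comp_lfunE.
have hv : h (phi v) = P v.
  by rewrite /phi comp_lfunE Pv limg_lfunVK // memv_img // memvf.
have : P (v - g (phi v)) = 0.
  by rewrite linearB /=; move: hv; rewrite /h comp_lfunE => ->; rewrite subrr.
rewrite PE gE => /eqP; rewrite subr_eq0 => /eqP ->; exact: memv_proj.
Qed.

(** A linear map takes the lattice of lattice_bound, which is finitely generated, to a
finitely generated group of rational vectors. *)
Lemma coord_denom p (phi : {linear M -> 'rV[rat]_p}) : exists2 D, (0 < D)%N &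
  forall v i, L v -> D%:R * phi v 0 i \is a Num.int.
Proof.
have [D D0 hD] := lattice_bound HL gen.
have [D' D'0 hD'] := clear_denominators [seq phi e 0 i | e <- gen_bracket_list 0, i <- enum 'I_p].
exists (D' * D)%N; first by rewrite muln_gt0 D'0.
move=> v i Lv.
have : forall w, zspan [set e | exists2 k, (k < n)%N & e \in gen_brackets k] w ->
    D'%:R * phi w 0 i \is a Num.int.
  move=> w; elim=> [|e [k kn ek]|x y _ hx _ hy].
  - by rewrite linear0 mxE mulr0.
  - apply: hD'; apply/allpairsP; exists (e, i); split=> //=; last by rewrite mem_enum.
    by apply/gen_bracket_listP; exists k.
  - by rewrite linearB !mxE mulrBr rpredB.
by move=> /(_ _ (hD v Lv)); rewrite linearZ mxE mulrA natrM.
Qed.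

Let SL : [set` Sq] `<=` L. Proof. by case: gen. Qed.

Lemma word_L s : is_word [set` Sq] s -> forall A, A \in s -> L A.
Proof.
move=> hs A As; case: (hs A As) => [/SL//|/SL h].
by rewrite -[A]opprK; exact: zsub_opp.
Qed.

Lemma prod_L s : is_word [set` Sq] s -> L (bch_prod s).
Proof.
move=> /word_L; elim: s => [|A s IH] hs; first exact: zsub_0.
apply: LM; first exact/hs/mem_head.
by apply: IH => B Bs; apply: hs; rewrite inE Bs orbT.
Qed.

Lemma word_cat s t : is_word [set` Sq] s -> is_word [set` Sq] t ->
  is_word [set` Sq] (s ++ t) /\ bch_prod (s ++ t) = bch (bch_prod s) (bch_prod t).
Proof.
move=> hs ht; split; first by move=> A; rewrite mem_cat => /orP[/hs|/ht].
by apply: bch_prod_cat => A; [move=> /(word_L hs)/Lsu|move=> /(word_L ht)/Lsu].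
Qed.

Lemma bch_opp (A B : M) : su A -> su B -> - bch A B = bch (- B) (- A).
Proof.
move=> hA hB; have hAB := su_bch hA hB; have [hA' hB'] := (suN hA, suN hB).
have h : bch (bch A B) (bch (- B) (- A)) = 0.
  by rewrite bchA ?bchKr ?bchN //; exact: su_bch.
by rewrite -(bchKl hAB (su_bch hB' hA')) h bch0r //; exact: suN.
Qed.

Lemma word_inv s : is_word [set` Sq] s -> exists s',
  [/\ is_word [set` Sq] s', size s' = size s & bch_prod s' = - bch_prod s].
Proof.
elim: s => [|A s IH] hs; first by exists [::]; rewrite /= oppr0.
have hs' : is_word [set` Sq] s by move=> B Bs; apply: hs; rewrite inE Bs orbT.
have [t [ht st Et]] := IH hs'.
have hA : is_word [set` Sq] [:: - A].
  move=> B; rewrite inE => /eqP ->; case: (hs A (mem_head _ _)) => h; [right|left] => //.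
  by rewrite opprK.
have sA : su A by apply/Lsu/(word_L hs)/mem_head.
have [h E] := word_cat ht hA.
exists (t ++ [:: - A]); split=> //; first by rewrite size_cat st addn1.
rewrite E Et /= bch0r; last exact: suN.
by rewrite -/(bch_prod s) bch_opp //; exact/Lsu/prod_L.
Qed.

Lemma word_nseq k A : [set` Sq] A \/ [set` Sq] (- A) ->
  is_word [set` Sq] (nseq k A) /\ bch_prod (nseq k A) = k%:R *: A.
Proof.
move=> SA; have hw : is_word [set` Sq] [:: A] by move=> B; rewrite inE => /eqP ->.
have sA : su A by apply/Lsu/(word_L hw)/mem_head.
split; first by move=> B; rewrite mem_nseq => /andP[_ /eqP ->].
elim: k => [|k IH]; first by rewrite scale0r.
by rewrite /= -/(bch_prod _) IH -{1}[A]scale1r bchZ // nat1r.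
Qed.

Lemma bracket_span_su k x : x \in bracket_span k -> su x.
Proof.
move=> xk; rewrite (coord_span (X := in_tuple _) xk).
elim/big_ind: _ => [||i _]; [exact: su_0|exact: suD|apply: suZ].
have /gen_bracket_listP[q _ hq] : (gen_bracket_list k)`_i \in gen_bracket_list k by rewrite mem_nth.
exact/Lsu/(gen_brackets_L hq).
Qed.

(** Over the rationals division by d is free, so bch_perturb applies to consecutive
steps of the filtration. *)
Lemma bracket_span_bch k x y i j :
  x \in bracket_span 0 -> y \in bracket_span 0 -> i \in bracket_span k -> j \in bracket_span k ->
  bch (x + i) (y + j) - bch x y - i - j \in bracket_span k.+1.
Proof.
move=> hx hy hi hj; have [d hd] := bch_bound_exists n; have [d0 _] := hd.
have dn0 : d%:R != 0 :> rat by rewrite pnatr_eq0 -lt0n.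
have Vz m : zsub [set x : M | x \in bracket_span m].
  by split; [exact: mem0v|move=> u v; exact: rpredB].
have sub0 m u : u \in bracket_span m -> u \in bracket_span 0 by exact: (subvP (bracket_span_le (leq0n m))).
have := @bch_perturb n d hd [set x : M | x \in bracket_span 0] [set x : M | x \in bracket_span k]
  [set x : M | x \in bracket_span k.+1] _ (Vz 0%N) _ _ (Vz k) (Vz k.+1) _ _ x y i j.
apply=> //.
- by move=> u /bracket_span_su.
- by move=> u v hu hv; apply: (subvP (bracket_span_le (leqnSn 0))); exact: bracket_span_br.
- by move=> u /sub0.
- exact: (subvP (bracket_span_le (leqnSn k))).
- move=> u v hu hv; exists (d%:R^-1 *: mlie u v); last by rewrite scalerA mulfV // scale1r.
  by apply: memvZ; exact: bracket_span_br.
Qed.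

Lemma bracket_span_bch_add k x y : x \in bracket_span k -> y \in bracket_span k ->
  bch x y - (x + y) \in bracket_span k.+1.
Proof.
move=> hx hy; have := bracket_span_bch (mem0v _) (mem0v _) hx hy.
by rewrite !add0r bch0r ?subr0 ?opprD ?addrA //; exact: su_0.
Qed.

Lemma bracket_span_bch_mem k x y : x \in bracket_span k -> y \in bracket_span k ->
  bch x y \in bracket_span k.
Proof.
move=> hx hy; rewrite -[bch x y](subrK (x + y)); apply: rpredD; last exact: rpredD.
by apply: (subvP (bracket_span_le (leqnSn k))); exact: bracket_span_bch_add.
Qed.

Lemma bracket_span_comm k x y : x \in bracket_span 0 -> y \in bracket_span k ->
  bch (bch (bch x y) (- x)) (- y) - mlie x y \in bracket_span k.+2.
Proof.
move=> hx hy; have sx := bracket_span_su hx; have sy := bracket_span_su hy.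
have y0 : y \in bracket_span 0 := subvP (bracket_span_le (leq0n k)) _ hy.
rewrite bch_conj //.
have [q hq ->] : exists2 q, q - mlie x y \in bracket_span k.+2 &
    \sum_(m < n.*2) m`!%:R^-1 *: iter m (mlie x) y = y + q.
  have it m : iter m.+2 (mlie x) y \in bracket_span k.+2.
    elim: m => [|m IH]; first exact: (bracket_span_br hx (bracket_span_br hx hy)).
    by apply: (subvP (bracket_span_le (leqnSn _))); apply: bracket_span_br.
  have [n0|n0] := posnP n.
    have e (A B : M) : A = B by apply/matrixP => i; have := ltn_ord i; rewrite {2}n0.
    by exists 0; [rewrite [_ - _](e _ 0) mem0v|exact: e].
  have [k2 E] : exists k2, n.*2 = k2.+2 by exists (n.*2 - 2)%N; lia.
  exists (\sum_(m < k2.+1) (m.+1)`!%:R^-1 *: iter m.+1 (mlie x) y).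
    rewrite big_ord_recl /= invr1 scale1r addrC addKr.
    by apply: memv_suml => m _; apply: memvZ; exact: it.
  rewrite -(big_mkord xpredT (fun m => m`!%:R^-1 *: iter m (mlie x) y)) E big_mkord.
  by rewrite big_ord_recl /= invr1 scale1r.
have hxy := bracket_span_br hx hy.
have hq1 : q \in bracket_span k.+1.
  rewrite -[q](subrK (mlie x y)); apply: rpredD => //.
  exact: (subvP (bracket_span_le (leqnSn _))).
have yN : - y \in bracket_span 0 by rewrite rpredN.
have := bracket_span_bch y0 yN hq1 (mem0v _).
rewrite addr0 bchN // !subr0 => h.
by rewrite -[_ - mlie x y](subrKA q) rpredD.
Qed.

Definition short_word k (C q : nat) v := exists s,
  [/\ is_word [set` Sq] s, (size s <= C * q)%N & bch_prod s - v \in bracket_span k.+1].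

Lemma short_word_add k C C' q v v' : v \in bracket_span k -> v' \in bracket_span k ->
  short_word k C q v -> short_word k C' q v' -> short_word k (C + C') q (v + v').
Proof.
move=> hv hv' [s [hs ss Es]] [t [ht st Et]].
have [hst E] := word_cat hs ht; exists (s ++ t); split=> //.
  by rewrite size_cat mulnDl leq_add.
have up m u w : w \in bracket_span m -> u - w \in bracket_span m.+1 -> u \in bracket_span m.
  by move=> hw h; rewrite -[u](subrK w) rpredD //; exact: (subvP (bracket_span_le (leqnSn m))).
have := bracket_span_bch_add (up _ _ _ hv Es) (up _ _ _ hv' Et).
rewrite E; set p := bch _ _; set x := bch_prod s in Es *; set y := bch_prod t in Et *.
move=> h; have -> : p - (v + v') = (p - (x + y)) + ((x - v) + (y - v')).
  by rewrite [_ + (y - v')]addrACA -opprD addrA subrK.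
by rewrite rpredD // rpredD.
Qed.

(** The commutator of s0^m with the word of w; it has length O(q), while the coefficient m
multiplies the one of w. *)
Lemma short_word_comm k C q m s0 w : s0 \in Sq -> (m <= q)%N -> w \in bracket_span k ->
  short_word k C q w -> short_word k.+1 (2 + 2 * C) q (mlie (m%:R *: s0) w).
Proof.
move=> sS mq wU [s [hs ss Es]]; set y := bch_prod s in Es.
have [hm Em] := @word_nseq m s0 (or_introl sS); set x := m%:R *: s0 in Em *.
have [m' [hm' sm' Em']] := word_inv hm; have [s' [hs' ss' Es']] := word_inv hs.
have [h1 E1] := word_cat hm hs; have [h2 E2] := word_cat h1 hm'.
have [h3 E3] := word_cat h2 hs'.
exists (((nseq m s0 ++ s) ++ m') ++ s'); split=> //.
  by rewrite !size_cat sm' ss' size_nseq; nia.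
rewrite E3 E2 E1 Em Em' Es' Em -/y.
have x0 : x \in bracket_span 0 by apply: memvZ; exact: (@bracket_span_mem 0).
have yU : y \in bracket_span k.
  by rewrite -[y](subrK w) rpredD //; exact: (subvP (bracket_span_le (leqnSn k))).
rewrite -[_ - mlie x w](subrKA (mlie x y)) rpredD //; first exact: bracket_span_comm.
by rewrite -mlieBr; apply: bracket_span_br.
Qed.

(** Distortion: z of size q^(k + 1) costs only O(q) letters. By division with remainder
z = A q + B, and z [s0, e1] = [q s0, A e1] + [s0, B e1], where A and B are
admissible coefficients of e1 by induction. *)
Lemma short_word_bracket k e : e \in gen_brackets k -> exists C : nat, forall (q : nat) (z : int),
  (0 < q)%N -> (`|z| <= q ^ k.+1)%N -> short_word k C q (z%:~R *: e).
Proof.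
elim: k e => [|k IH] e.
  move=> eS; exists 1%N => q z q0 hz.
  have [s [hs ss Es]] : exists s, [/\ is_word [set` Sq] s, size s = `|z|%N &
      bch_prod s = z%:~R *: e].
    case: z {hz} => m.
      have [h E] := @word_nseq m e (or_introl eS).
      by exists (nseq m e); rewrite size_nseq.
    have [|h E] := @word_nseq m.+1 (- e); first by right; rewrite opprK.
    exists (nseq m.+1 (- e)); rewrite size_nseq; split=> //.
    by rewrite E NegzE mulrNz scaleNr scalerN.
  exists s; split=> //; first by rewrite ss mul1n -[q]expn1.
  by rewrite Es subrr mem0v.
case/allpairsP => -[s0 e1] [/= sS e1k ->].
have [C hC] := IH e1 e1k; have e1U : e1 \in bracket_span k by exact: bracket_span_mem e1k.
exists ((2 + 2 * C) + (2 + 2 * C))%N => q z q0 hz.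
have s0U : s0 \in bracket_span 0 by exact: (@bracket_span_mem 0).
pose A := (z %/ q%:Z)%Z; pose B := (z %% q%:Z)%Z.
have qz : (q%:Z != 0)%R by rewrite eqz_nat -lt0n.
have Ez : z = A * q%:Z + B := divz_eq z q%:Z.
have B0 : (0 <= B)%R by exact: modz_ge0.
have Bq : (B < q%:Z)%R by rewrite ltz_pmod // ltz_nat.
have hB : (`|B| <= q ^ k.+1)%N.
  by rewrite (@leq_trans q) ?leq_pexp2l //; [lia|rewrite -{1}[q]expn1 leq_pexp2l].
have hA : (`|A| <= q ^ k.+1)%N.
  have qq : (0 < q%:Z)%R by rewrite ltz_nat.
  move: hz; rewrite expnS; set Q := (q ^ k.+1)%N => hz.
  have Qz : (`|z| <= (q * Q)%N%:Z)%R by rewrite -abszE lez_nat.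
  have [h1 h2] : (A <= Q%:Z)%R /\ (- Q%:Z <= A)%R.
    move: Qz; rewrite ler_norml PoszM => /andP[l u]; split.
      rewrite -(ler_pM2r qq) [leRHS]mulrC; apply: le_trans u.
      by rewrite Ez lerDl.
    have : (- Q%:Z * q%:Z < (A + 1) * q%:Z)%R.
      by rewrite mulNr mulrC (le_lt_trans l) // Ez mulrDl mul1r ltrD2l.
    rewrite (ltr_pM2r qq); lia.
  lia.
have -> : z%:~R *: mlie s0 e1 = mlie (q%:R *: s0) (A%:~R *: e1) + mlie (1%:R *: s0) (B%:~R *: e1).
  rewrite scale1r !mlieZr mlieZl scalerA -scalerDl; congr (_ *: _).
  by rewrite {1}Ez rmorphD rmorphM.
have AU : A%:~R *: e1 \in bracket_span k by exact: memvZ.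
have BU : B%:~R *: e1 \in bracket_span k by exact: memvZ.
apply: short_word_add.
- by apply: bracket_span_br => //; exact: memvZ.
- by apply: bracket_span_br => //; exact: memvZ.
- by apply: short_word_comm => //; exact: hC.
- by apply: short_word_comm => //; exact: hC.
Qed.

End RationalFiltration.

(** * Coordinates in a finite-dimensional normed space *)
Import numFieldNormedType.Exports.

Section NormEquivalence.
Variables (R : realType) (gg : vectType R) (V : {vspace gg}) (N : gg -> R).
Hypothesis HN : is_norm_on V N.
Local Notation p := (\dim V).

Lemma norm_ge0 x : x \in V -> 0 <= N x. Proof. by case: HN => h _ _ _; exact: h. Qed.
Lemma normZ k x : x \in V -> N (k *: x) = `|k| * N x.
Proof. by case: HN => _ _ h _; exact: h. Qed.
Lemma normD x y : x \in V -> y \in V -> N (x + y) <= N x + N y.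
Proof. by case: HN => _ _ _ h; exact: h. Qed.
Lemma norm0 : N 0 = 0.
Proof. by rewrite -(scale0r 0) normZ ?mem0v // normr0 mul0r. Qed.
Lemma norm_sum I (r : seq I) (F : I -> gg) : (forall i, F i \in V) ->
  N (\sum_(i <- r) F i) <= \sum_(i <- r) N (F i).
Proof.
move=> h; elim: r => [|i r IH]; first by rewrite !big_nil norm0.
by rewrite !big_cons (le_trans (normD _ _)) ?lerD2l ?memv_suml.
Qed.

Let comb (u : 'rV[R]_p) : gg := \sum_b u 0 b *: (vbasis V)`_b.

Let basisV (b : 'I_p) : (vbasis V)`_(nat_of_ord b) \in V.
Proof. by apply/vbasis_mem/mem_nth; rewrite size_tuple. Qed.

Let combV u : comb u \in V.
Proof. by apply: memv_suml => b _; apply: memvZ. Qed.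

Let norm_entry (u : 'rV[R]_p) b : `|u 0 b| <= `|u|.
Proof.
rewrite [leRHS]/Num.norm /= mx_normrE.
by apply: (@le_bigmax _ _ _ _ (fun ij => `|u ij.1 ij.2|) (0, b)).
Qed.

Let combB u v : comb (u - v) = comb u - comb v.
Proof.
by rewrite /comb -sumrB; apply: eq_bigr => b _; rewrite !mxE scalerBl.
Qed.

Let C := \sum_b N (vbasis V)`_(nat_of_ord (b : 'I_p)).
Let C0 : 0 <= C. Proof. by apply: sumr_ge0 => b _; exact: norm_ge0. Qed.

Let comb_lip u : N (comb u) <= C * `|u|.
Proof.
apply: le_trans (norm_sum _ _) _ => [b|]; first exact: memvZ.
rewrite /C mulr_suml; apply: ler_sum => b _.
by rewrite normZ // mulrC ler_wpM2l // norm_ge0.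
Qed.

Let comb_dist u v : `|N (comb u) - N (comb v)| <= C * `|u - v|.
Proof.
have E a b : comb a = comb (a - b) + comb b by rewrite combB subrK.
have h a b : N (comb a) - N (comb b) <= C * `|a - b|.
  rewrite lerBlDr {1}(E a b); apply: le_trans (normD _ _) _ => //.
  by rewrite lerD2r; exact: comb_lip.
rewrite ler_norml h andbT lerNl opprB distrC; exact: h.
Qed.

Let comb_cont : continuous (fun u => N (comb u)).
Proof.
have C1 : 0 < C + 1 by rewrite ltr_pwDr.
move=> u; apply/(@cvgrPdist_lt _ _ _ _ (@nbhs_filter 'rV[R]_p u)) => e e0; near=> v.
apply: le_lt_trans (comb_dist u v) _.
apply: (@le_lt_trans _ _ ((C + 1) * `|u - v|)).
  by apply: ler_wpM2r => //; rewrite lerDl.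
rewrite mulrC -ltr_pdivlMr //; near: v.
have := @cvgrPdist_lt R _ _ (nbhs u) (@nbhs_filter 'rV[R]_p u) id u.
by move=> [h _]; apply: h; [exact: cvg_id|exact: divr_gt0 e0 C1].
Unshelve. all: by end_near. Qed.

Let sphere_compact : compact [set u : 'rV[R]_p | `|u| = 1].
Proof.
apply: bounded_closed_compact.
  by exists 1; split=> // M M1 u /= ->; exact: ltW.
have -> : [set u : 'rV[R]_p | `|u| = 1] = (fun u => `|u|) @^-1` [set 1].
  by [].
apply: closed_comp; last exact: closed_eq.
by move=> u _; exact: norm_continuous.
Qed.

(** On the compact unit sphere of the coordinate space the norm N has a positive
minimum. *)
Lemma norm_coord : exists2 K, 0 <= K &
  forall x, x \in V -> forall b, `|coord (vbasis V) b x| <= K * N x.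
Proof.
have [p0|p0] := posnP p.
  by exists 0 => // x _ b; have := ltn_ord b; rewrite {2}p0.
have S0 : [set u : 'rV[R]_p | `|u| = 1] !=set0.
  pose u : 'rV[R]_p := delta_mx 0 (Ordinal p0).
  have u0 : u != 0.
    apply/eqP => /rowP/(_ (Ordinal p0)); rewrite !mxE !eqxx => /eqP.
    by rewrite oner_eq0.
  exists (`|u|^-1 *: u); rewrite /= normrZ ger0_norm ?invr_ge0 //.
  by rewrite mulVf // normr_eq0.
have [] := @compact_EVT_min _ R (fun u => N (comb u)) _ S0 sphere_compact.
  by apply: continuous_subspaceT.
move=> u0; rewrite inE /= => nu0 umin.
have m0 : 0 < N (comb u0).
  rewrite lt_neqAle norm_ge0 // andbT eq_sym; apply/eqP => Nu0.
  have c0 : comb u0 = 0 by case: HN => _ h _ _; exact: h.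
  have : u0 = 0.
    apply/rowP => b; rewrite mxE.
    have /freeP h := basis_free (vbasisP V).
    exact: h c0 b.
  by move=> u00; move/eqP: nu0; rewrite u00 normr0 eq_sym oner_eq0.
exists (N (comb u0))^-1 => [|x xV b]; first by rewrite invr_ge0 ltW.
pose u : 'rV[R]_p := \row_b coord (vbasis V) b x.
have cu : comb u = x.
  by rewrite [RHS](coord_vbasis xV); apply: eq_bigr => i _; rewrite mxE.
have -> : coord (vbasis V) b x = u 0 b by rewrite mxE.
apply: le_trans (norm_entry _ _) _.
rewrite mulrC ler_pdivlMr // -cu.
have [->|un0] := eqVneq u 0.
  by rewrite normr0 mul0r; exact: norm_ge0.
have nu : 0 < `|u| by rewrite normr_gt0.
have : N (comb u0) <= N (comb (`|u|^-1 *: u)).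
  apply: umin; rewrite inE /= normrZ ger0_norm ?invr_ge0 //.
  by rewrite mulVf // normr_eq0.
have -> : comb (`|u|^-1 *: u) = `|u|^-1 *: comb u.
  by rewrite /comb scaler_sumr; apply: eq_bigr => i _; rewrite mxE scalerA.
rewrite normZ // ger0_norm ?invr_ge0 //.
by move=> h; rewrite mulrC -ler_pdivlMr // mulrC.
Qed.

End NormEquivalence.

(** * The real Lie algebra *)

Section LinearMaps.
Variables (R : realType) (U W : lmodType R).

Lemma linear_pack (f : U -> W) : linear f -> exists g : {linear U -> W}, g =1 f.
Proof.
move=> hf.
pose g : {linear U -> W} := HB.pack f (GRing.isLinear.Build R U W *:%R f hf).
by exists g.
Qed.

Lemma linear_sum (f : U -> W) I (r : seq I) (F : I -> U) : linear f ->
  f (\sum_(i <- r) F i) = \sum_(i <- r) f (F i).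
Proof.
move=> /linear_pack[g gf]; rewrite -gf raddf_sum.
by apply: eq_bigr => i _; rewrite /= gf.
Qed.

Lemma linear_scale (f : U -> W) a x : linear f -> f (a *: x) = a *: f x.
Proof. by move=> /linear_pack[g gf]; rewrite -!gf linearZ. Qed.

Lemma linear_add (f : U -> W) x y : linear f -> f (x + y) = f x + f y.
Proof. by move=> /linear_pack[g gf]; rewrite -!gf linearD. Qed.

Lemma linear_zero (f : U -> W) : linear f -> f 0 = 0.
Proof. by move=> /linear_pack[g gf]; rewrite -!gf linear0. Qed.

End LinearMaps.

Lemma span_linear (R : realType) (U W : vectType R) (f : U -> W) (X : seq U)
    (V : {vspace W}) : linear f ->
  (forall x, x \in X -> f x \in V) -> forall x, x \in <<X>>%VS -> f x \in V.
Proof.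
move=> /linear_pack[g gf] h x; rewrite -gf -[g x](lfunE g) memv_preim; move: x.
apply/subvP/span_subvP => x xX; rewrite -memv_preim lfunE /= gf; exact: h.
Qed.

Section RealExtension.
Variables (R : realType) (gg : vectType R) (n : nat) (L : set 'M[rat]_n)
  (br : gg -> gg -> gg) (iota : 'M[rat]_n -> gg).
Hypotheses (Hgg : real_extension L br iota) (HL : LR_group L).

Let brl w : linear (br^~ w). Proof. exact: (rext_linl Hgg). Qed.
Let brr w : linear (br w). Proof. exact: (rext_linr Hgg). Qed.
Let LL x y : L x -> L y -> L (mlie x y). Proof. exact: (LR_lie HL). Qed.

(** Uniqueness in the universal property: the image of L spans the real Lie algebra. It
transports the identities of the bracket of L to br. *)
Lemma lin_ext (W : lmodType R) (f f' : gg -> W) : linear f -> linear f' ->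
  (forall x, L x -> f (iota x) = f' (iota x)) -> f =1 f'.
Proof.
move=> /linear_pack[g gf] /linear_pack[g' gf'] h.
have [F _ hF] := rext_univ Hgg (f := fun x => f (iota x))
  (fun x y Lx Ly => etrans (congr1 f (rext_add Hgg Lx Ly))
     (etrans (esym (gf _)) (etrans (linearD g _ _) (congr2 +%R (gf _) (gf _))))).
have e1 : g =1 F by apply: hF => x Lx; exact: gf.
have e2 : g' =1 F by apply: hF => x Lx; rewrite h //; exact: gf'.
by move=> x; rewrite -gf -gf' e1 e2.
Qed.

Lemma extend_additive (f : 'M[rat]_n -> R) :
  (forall x y, L x -> L y -> f (x + y) = f x + f y) ->
  exists F : {linear gg -> R^o}, forall x, L x -> F (iota x) = f x.
Proof. by move=> hf; have [F h _] := rext_univ Hgg (W := R^o) hf; exists F. Qed.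

Lemma iota0 : iota 0 = 0.
Proof.
have L0 := zsub_0 (LR_zsub HL); have := rext_add Hgg L0 L0.
by rewrite addr0 => /eqP; rewrite -subr_eq0 opprD addNKr oppr_eq0 => /eqP.
Qed.

Lemma iotaB x y : L x -> L y -> iota (x - y) = iota x - iota y.
Proof.
move=> Lx Ly; have Lxy := zsub_sub (LR_zsub HL) Lx Ly.
by have := rext_add Hgg Lxy Ly; rewrite subrK => ->; rewrite addrK.
Qed.

Lemma iota_int (k : int) x : L x -> iota (k%:~R *: x) = k%:~R *: iota x.
Proof.
move=> Lx; have Lz := LR_zsub HL.
have h (m : nat) : iota (m%:R *: x) = m%:R *: iota x.
  elim: m => [|m IH]; first by rewrite !scale0r iota0.
  by rewrite -!natr1 !scalerDl !scale1r (rext_add Hgg) ?IH //; exact: zsub_nat.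
case: k => m; first exact: h.
rewrite NegzE !mulrNz !scaleNr -sub0r iotaB ?iota0 ?sub0r; first by rewrite h.
  exact: zsub_0.
exact: zsub_nat.
Qed.

(** The map iota is only additive on L, so the coefficients are made integral before it is
applied. *)
Lemma iota_comb I (r : seq I) (q : I -> rat) (F : I -> 'M[rat]_n) :
  (forall i, L (F i)) -> L (\sum_(i <- r) q i *: F i) ->
  iota (\sum_(i <- r) q i *: F i) = \sum_(i <- r) ratr (q i) *: iota (F i).
Proof.
have Lz := LR_zsub HL; move=> LF Lsum.
have [D D0 hD] := clear_denominators [seq q i | i <- r].
have Dn0 : D%:R != 0 :> R by rewrite pnatr_eq0 -lt0n.
apply: (scalerI Dn0); have := iota_int D Lsum; rewrite /= -[D%:~R]/(D%:R) => <-.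
rewrite !scaler_sumr.
have Lint k x : k \is a Num.int -> L x -> iota (k *: x) = ratr k *: iota x.
  by move=> /intrP[z ->] Lx; rewrite iota_int // ratr_int.
suff [] : L (\sum_(i <- r) D%:R *: (q i *: F i)) /\
   iota (\sum_(i <- r) D%:R *: (q i *: F i)) =
   \sum_(i <- r) D%:R *: (ratr (q i) *: iota (F i)) by [].
elim: r hD {Lsum} => [|i r IH] hD.
  by rewrite !big_nil iota0; split=> //; exact: zsub_0.
have [|Ls Es] := IH; first by move=> p pr; apply: hD; rewrite inE pr orbT.
have hi : D%:R * q i \is a Num.int by apply: hD; rewrite mem_head.
have Li : L (D%:R *: (q i *: F i)) by rewrite scalerA; exact: zsub_int.
rewrite !big_cons; split; first exact: zsub_add.
rewrite (rext_add Hgg) // Es; congr (_ + _).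
by rewrite !scalerA Lint // rmorphM /= ratr_nat.
Qed.

(** The entries of a matrix are additive functions on L, hence extend to linear
functionals. *)
Lemma iota_inj x : L x -> iota x = 0 -> x = 0.
Proof.
move=> Lx x0; apply/matrixP => i j; rewrite mxE.
have [|F hF] := extend_additive (f := fun x : 'M[rat]_n => ratr (x i j)).
  by move=> y z _ _; rewrite mxE rmorphD.
have := hF x Lx; rewrite x0 linear0 => /esym/eqP.
by rewrite fmorph_eq0 => /eqP.
Qed.

Lemma br_anti x y : br x y = - br y x.
Proof.
move: x; apply: lin_ext => [||x Lx]; first exact: brl.
  by move=> a u v /=; rewrite brr opprD scalerN.
move: y; apply: lin_ext => [||y Ly]; first exact: brr.
  by move=> a u v /=; rewrite brl opprD scalerN.
rewrite !(rext_lie Hgg) // mlieC.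
by rewrite -sub0r iotaB ?iota0 ?sub0r //; [exact: zsub_0 (LR_zsub HL)|exact: LL].
Qed.

Lemma brxx x : br x x = 0.
Proof.
have /eqP := br_anti x x; rewrite -subr_eq0 opprK -mulr2n -scaler_nat scaler_eq0.
by rewrite pnatr_eq0 /= => /eqP.
Qed.

Lemma br_jacobi x u v : br x (br u v) = br (br x u) v - br (br x v) u.
Proof.
move: x; apply: lin_ext => [||x Lx].
- exact: brl.
- by move=> a y z /=; rewrite !brl scalerBr opprD addrACA.
move: u; apply: lin_ext => [||u Lu].
- by move=> a y z /=; rewrite brl brr.
- by move=> a y z /=; rewrite !brr brl scalerBr opprD addrACA.
move: v; apply: lin_ext => [||v Lv].
- by move=> a y z /=; rewrite !brr.
- by move=> a y z /=; rewrite !brr brl scalerBr opprD addrACA.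
rewrite !(rext_lie Hgg) //; try exact: LL.
rewrite -iotaB; try by do 2?apply: LL.
by congr iota; rewrite (mlie_jacobi x u v) (mlieC (mlie x v)) opprK subrK.
Qed.

Lemma brv_mem (U V : {vspace gg}) x y : x \in U -> y \in V -> br x y \in brv br U V.
Proof.
move=> xU yV; rewrite (coord_vbasis xU) (linear_sum _ _ (brl y)).
apply: memv_suml => i _; rewrite (linear_scale _ _ (brl y)); apply: memvZ.
rewrite (coord_vbasis yV) (linear_sum _ _ (brr _)).
apply: memv_suml => j _; rewrite (linear_scale _ _ (brr _)); apply: memvZ.
apply: memv_span; apply/allpairsP; exists ((vbasis U)`_i, (vbasis V)`_j).
by split=> //=; apply: mem_nth; rewrite size_tuple.
Qed.

Lemma brv_ind (U V : {vspace gg}) (W : vectType R) (f : gg -> W) (V' : {vspace W}) : linear f ->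
  (forall x y, x \in U -> y \in V -> f (br x y) \in V') ->
  forall z, z \in brv br U V -> f z \in V'.
Proof.
move=> hf h; apply: span_linear => // _ /allpairsP[[x y] /= [xU yV ->]].
by apply: h; exact: vbasis_mem.
Qed.

Lemma lcsS i : lcs br i.+2 = brv br (lcs br i.+1) fullv.
Proof. by []. Qed.

Lemma lcs1 x : x \in lcs br 1. Proof. exact: memvf. Qed.

Lemma lcs_br1 i x y : x \in lcs br i.+1 -> br x y \in lcs br i.+2.
Proof. by move=> xi; rewrite lcsS; apply: brv_mem => //; exact: memvf. Qed.

Lemma lcs_br i j x y : x \in lcs br i.+1 -> y \in lcs br j.+1 ->
  br x y \in lcs br (i + j).+2.
Proof.
elim: j i x y => [|j IH] i x y xi; first by rewrite addn0 => _; exact: lcs_br1.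
rewrite lcsS; move: y; apply: brv_ind; first exact: brr.
move=> u v uj _; rewrite br_jacobi rpredB //.
  by rewrite addnS; apply: lcs_br1; exact: IH.
by have := IH i.+1 (br x v) u (lcs_br1 v xi) uj; rewrite addSnnS.
Qed.

Lemma lcs_le i j : (i <= j)%N -> (lcs br j.+1 <= lcs br i.+1)%VS.
Proof.
move=> /subnK <-; elim: (j - i)%N => [|k IH]; first by rewrite add0n.
apply: subv_trans IH; rewrite addSn; elim: (k + i)%N => [|m IHm].
  by apply/subvP => x _; exact: lcs1.
apply/subvP; apply: (@brv_ind _ _ _ id) => // x y xk _.
by apply: lcs_br1; exact: (subvP IHm).
Qed.

End RealExtension.

(** * Scaled norms *)

Section ScaledNorms.
Variables (R : realType) (gg : vectType R) (n : nat) (L : set 'M[rat]_n)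
  (br : gg -> gg -> gg) (iota : 'M[rat]_n -> gg).
Hypotheses (Hgg : real_extension L br iota) (HL : LR_group L).
Variables (c : nat) (Hc : nilpotency_class br c)
  (a : 'I_c -> {vspace gg}) (Ha : lcs_splitting br a)
  (N : 'I_c -> gg -> R) (HN : forall i : 'I_c, is_norm_on (a i) (N i)).

Let brl w : linear (br^~ w). Proof. exact: (rext_linl Hgg). Qed.
Let brr w : linear (br w). Proof. exact: (rext_linr Hgg). Qed.

Local Notation V0 := (\sum_(j < c) a j)%VS.
Definition component (i : 'I_c) (v : gg) : gg := sumv_pi V0 i v.
Local Notation pi := component.

Lemma full_sum v : v \in V0.
Proof.
case: (posnP c) => [c0|c0].
  have h : lcs br 1 = 0%VS by have [h _] := Hc; rewrite -h c0.
  by have := lcs1 br v; rewrite h memv0 => /eqP ->; exact: mem0v.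
have [E _] := Ha (Ordinal c0); have := lcs1 br v; rewrite E /=.
by rewrite (eq_bigl xpredT).
Qed.

Lemma direct_sum : directv V0.
Proof.
case: (posnP c) => [c0|c0].
  apply/directv_sumP => -[m hm]; by exfalso; move: hm; rewrite c0.
have [_ /directv_sumP h] := Ha (Ordinal c0); apply/directv_sumP => i _.
by rewrite -[RHS](h i isT); congr (_ :&: _)%VS; apply: eq_bigl.
Qed.

Lemma component_sum v : \sum_i pi i v = v.
Proof. exact: sumv_pi_sum (full_sum v). Qed.

Lemma component_mem i v : pi i v \in a i. Proof. exact: memv_sum_pi. Qed.

Lemma component_linear i : linear (pi i).
Proof. by move=> k u v; rewrite /component linearP. Qed.

Lemma component_uniq (w : 'I_c -> gg) v : (forall i, w i \in a i) -> v = \sum_i w i ->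
  forall i, pi i v = w i.
Proof.
move=> hw E i; have /directv_sum_unique h := direct_sum.
have := h (fun i => pi i v) w (fun i _ => component_mem i v) (fun i _ => hw i).
by rewrite component_sum {1}E eqxx => /esym/forallP/(_ i)/eqP.
Qed.

Lemma component_lcs k v (i : 'I_c) : v \in lcs br k.+1 -> (i < k)%N -> pi i v = 0.
Proof.
move=> vk ik; have [kc|ck] := ltnP k c; last first.
  have [h _] := Hc; have := subvP (lcs_le Hgg ck) v vk.
  by rewrite h memv0 => /eqP ->; exact: linear_zero (component_linear i).
have [E _] := Ha (Ordinal kc); move: vk; rewrite E => /memv_sumP[vs hvs Ev].
pose w (j : 'I_c) := if (k <= j)%N then vs j else 0.
rewrite (@component_uniq w) /w.
- by rewrite leqNgt ik.
- by move=> j; case: ifP => [/hvs//|_]; exact: mem0v.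
- by rewrite Ev [LHS]big_mkcond.
Qed.

Lemma a_lcs i v : v \in a i -> v \in lcs br i.+1.
Proof.
by have [-> _] := Ha i; move=> vi; apply: (subvP (sumv_sup i _ (subvv _))).
Qed.

(** Compared with the Guivarc'h length at radius t, this has the same unit ball up to
constants (guivarch_le, scaled_norm_le_guivarch) and is a norm. *)
Definition scaled_norm (t : R) (v : gg) : R := \sum_i N i (pi i v) / t ^+ i.+1.

Section FixedScale.
Variable t : R.
Hypothesis t1 : 1 <= t.
Let t0 : 0 < t. Proof. exact: lt_le_trans ltr01 t1. Qed.

Lemma scaled_norm_ge0 v : 0 <= scaled_norm t v.
Proof.
apply: sumr_ge0 => i _; rewrite divr_ge0 ?(norm_ge0 (HN i)) ?component_mem //.
by rewrite exprn_ge0 // ltW.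
Qed.

Lemma scaled_norm_add u v : scaled_norm t (u + v) <= scaled_norm t u + scaled_norm t v.
Proof.
rewrite /scaled_norm -big_split; apply: ler_sum => i _ /=; rewrite -mulrDl.
apply: ler_wpM2r; first by rewrite invr_ge0 exprn_ge0 // ltW.
rewrite (linear_add _ _ (component_linear i)).
by apply: (normD (HN i)); exact: component_mem.
Qed.

Lemma scaled_norm_scale k v : scaled_norm t (k *: v) = `|k| * scaled_norm t v.
Proof.
rewrite /scaled_norm mulr_sumr; apply: eq_bigr => i _.
by rewrite (linear_scale _ _ (component_linear i)) (normZ (HN i)) ?component_mem // mulrA.
Qed.

Lemma scaled_norm0 : scaled_norm t 0 = 0.
Proof. by rewrite -(scale0r 0) scaled_norm_scale normr0 mul0r. Qed.

Lemma scaled_norm_opp v : scaled_norm t (- v) = scaled_norm t v.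
Proof. by rewrite -scaleN1r scaled_norm_scale normrN1 mul1r. Qed.

Lemma scaled_norm_sum I (r : seq I) (F : I -> gg) :
  scaled_norm t (\sum_(i <- r) F i) <= \sum_(i <- r) scaled_norm t (F i).
Proof.
elim: r => [|i r IH]; first by rewrite !big_nil scaled_norm0.
by rewrite !big_cons (le_trans (scaled_norm_add _ _)) ?lerD2l.
Qed.

Lemma component_le_norm v i : N i (pi i v) <= t ^+ i.+1 * scaled_norm t v.
Proof.
have ti : 0 < t ^+ i.+1 by rewrite exprn_gt0.
rewrite -ler_pdivrMl // mulrC /scaled_norm (bigD1 i) //= lerDl.
apply: sumr_ge0 => j _; rewrite divr_ge0 ?(norm_ge0 (HN j)) ?component_mem //.
by rewrite exprn_ge0 // ltW.
Qed.

Lemma scaled_norm_coarsen s v : 1 <= s -> scaled_norm (s * t) v <= scaled_norm t v / s.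
Proof.
move=> s1; have s0 : 0 < s by exact: lt_le_trans s1.
rewrite /scaled_norm mulr_suml; apply: ler_sum => i _; rewrite -mulrA.
apply: ler_wpM2l; first by rewrite (norm_ge0 (HN i)) ?component_mem.
rewrite -invfM lef_pV2 ?posrE ?mulr_gt0 ?exprn_gt0 ?mulr_gt0 //.
have ss : s <= s ^+ i.+1 by rewrite exprS ler_peMr ?exprn_ege1 // ltW.
by rewrite exprMn mulrC ler_wpM2r // exprn_ge0 // ltW.
Qed.

Lemma scaled_norm_refine s v : 1 <= s -> scaled_norm t v <= s ^+ c * scaled_norm (s * t) v.
Proof.
move=> s1; have s0 : 0 < s by exact: lt_le_trans s1.
rewrite /scaled_norm mulr_sumr; apply: ler_sum => i _; rewrite mulrCA.
apply: ler_wpM2l; first by rewrite (norm_ge0 (HN i)) ?component_mem.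
rewrite exprMn invfM mulrA -[X in X <= _]mul1r ler_wpM2r //.
  by rewrite invr_ge0 exprn_ge0 // ltW.
rewrite ler_pdivlMr ?exprn_gt0 // mul1r.
by apply: ler_weXn2l => //; exact: ltn_ord.
Qed.

End FixedScale.

Lemma bilinear_bound (i j k : 'I_c) : exists2 K, 0 <= K &
  forall x y, x \in a i -> y \in a j -> N k (pi k (br x y)) <= K * (N i x * N j y).
Proof.
have [Ki Ki0 hi] := norm_coord (HN i); have [Kj Kj0 hj] := norm_coord (HN j).
pose B (b : 'I_(\dim (a i))) (b' : 'I_(\dim (a j))) :=
  N k (pi k (br (vbasis (a i))`_b (vbasis (a j))`_b')).
have B0 b b' : 0 <= B b b' by rewrite /B (norm_ge0 (HN k)) ?component_mem.
exists (Ki * Kj * \sum_b \sum_b' B b b').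
  by rewrite !mulr_ge0 // sumr_ge0 // => b _; rewrite sumr_ge0.
move=> x y xi yj.
have E : pi k (br x y) = \sum_b \sum_b' (coord (vbasis (a i)) b x * coord (vbasis (a j)) b' y)
    *: pi k (br (vbasis (a i))`_b (vbasis (a j))`_b').
  rewrite {1}(coord_vbasis xi) (linear_sum _ _ (brl y)) (linear_sum _ _ (component_linear k)).
  apply: eq_bigr => b _; rewrite (linear_scale _ _ (brl y)) {1}(coord_vbasis yj).
  rewrite (linear_sum _ _ (brr _)) scaler_sumr (linear_sum _ _ (component_linear k)).
  apply: eq_bigr => b' _; rewrite (linear_scale _ _ (brr _)) scalerA.
  exact: linear_scale (component_linear k).
have km z : pi k z \in a k by exact: component_mem.
rewrite E; apply: le_trans (norm_sum (HN k) _ _) _.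
  by move=> b; apply: memv_suml => b' _; exact: memvZ.
rewrite mulrAC mulr_sumr; apply: ler_sum => b _.
apply: le_trans (norm_sum (HN k) _ _) _; first by move=> b'; exact: memvZ.
rewrite mulr_sumr; apply: ler_sum => b' _.
rewrite (normZ (HN k)) // -/(B b b'); apply: ler_wpM2r => //.
rewrite normrM mulrACA; apply: ler_pM => //; [exact: hi|exact: hj].
Qed.

(** The bracket of weights i and j has components of weight at least i + j only, so
dividing by powers of t >= 1 never makes the bilinear bound worse. *)
Lemma scaled_norm_br : exists2 K, 1 <= K & forall t, 1 <= t -> forall x y,
  scaled_norm t (br x y) <= K * (scaled_norm t x * scaled_norm t y).
Proof.
have /choice[K hK] : forall ijk : 'I_c * 'I_c * 'I_c, exists K, 0 <= K /\
    forall x y, x \in a ijk.1.1 -> y \in a ijk.1.2 ->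
      N ijk.2 (pi ijk.2 (br x y)) <= K * (N ijk.1.1 x * N ijk.1.2 y).
  move=> [[i j] k]; have [K K0 h] := bilinear_bound i j k; by exists K.
pose K0 := \sum_ijk K ijk.
have leK ijk : K ijk <= K0.
  by rewrite /K0 (bigD1 ijk) //= lerDl sumr_ge0 // => u _; have [] := hK u.
have K00 : 0 <= K0 by rewrite sumr_ge0 // => u _; have [] := hK u.
exists (1 + c%:R * K0); first by rewrite lerDl mulr_ge0.
move=> t t1 x y; have t0 : 0 < t by exact: lt_le_trans t1.
have xy0 : 0 <= scaled_norm t x * scaled_norm t y by rewrite mulr_ge0 // scaled_norm_ge0.
rewrite mulrDl mul1r -[leLHS]add0r lerD //.
have h (k : 'I_c) : N k (pi k (br x y)) / t ^+ k.+1 <= K0 * (scaled_norm t x * scaled_norm t y).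
  have E : pi k (br x y) = \sum_i \sum_j pi k (br (pi i x) (pi j y)).
    rewrite -{1}(component_sum x) (linear_sum _ _ (brl y)) (linear_sum _ _ (component_linear k)).
    apply: eq_bigr => i _; rewrite -{1}(component_sum y) (linear_sum _ _ (brr _)).
    by rewrite (linear_sum _ _ (component_linear k)).
  have tk : 0 < t ^+ k.+1 by rewrite exprn_gt0.
  rewrite ler_pdivrMr // E; apply: le_trans (norm_sum (HN k) _ _) _.
    by move=> i; apply: memv_suml => j _; exact: component_mem.
  rewrite -mulrA [_ * t ^+ _]mulrC mulrA /scaled_norm mulr_suml mulr_sumr.
  apply: ler_sum => i _; apply: le_trans (norm_sum (HN k) _ _) _.
    by move=> j; exact: component_mem.
  rewrite 2!mulr_sumr; apply: ler_sum => j _.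
  have Ni : 0 <= N i (pi i x) by rewrite (norm_ge0 (HN i)) ?component_mem.
  have Nj : 0 <= N j (pi j y) by rewrite (norm_ge0 (HN j)) ?component_mem.
  have [kij|ijk] := ltnP k (i + j).+1.
    rewrite (@component_lcs (i + j).+1) //; last first.
      exact: (lcs_br Hgg HL (a_lcs (component_mem i x)) (a_lcs (component_mem j y))).
    by rewrite (norm0 (HN k)) !mulr_ge0 // ?invr_ge0 ?exprn_ge0 // ltW.
  have [_ /(_ (pi i x) (pi j y) (component_mem _ _) (component_mem _ _))] := hK (i, j, k).
  move=> /le_trans; apply => /=.
  apply: (@le_trans _ _ (K0 * (N i (pi i x) * N j (pi j y)))).
    by apply: ler_wpM2r; [exact: mulr_ge0|exact: leK].
  rewrite -mulrA; apply: ler_wpM2l => //.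
  rewrite mulrACA -invfM -exprD mulrCA ler_peMr //; first exact: mulr_ge0.
  rewrite ler_pdivlMr ?exprn_gt0 // mul1r; apply: ler_weXn2l => //.
  by rewrite addSn addnS.
rewrite {1}/scaled_norm; apply: le_trans (ler_sum _ (fun k _ => h k)) _.
by rewrite sumr_const card_ord -[leLHS]mulr_natl !mulrA.
Qed.

Lemma guivarch_le t v : 1 <= t -> scaled_norm t v <= 1 -> guivarch a N v <= t.
Proof.
move=> t1 h; have t0 : 0 < t by exact: lt_le_trans t1.
apply: bigmax_le => [|i _]; first exact: ltW.
have Ni : 0 <= N i (pi i v) by rewrite (norm_ge0 (HN i)) ?component_mem.
have le : N i (pi i v) <= t ^+ i.+1.
  apply: le_trans (component_le_norm t1 v i) _.
  by rewrite ler_piMr // exprn_ge0 // ltW.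
have -> : t = (t ^+ i.+1) `^ (i.+1%:R)^-1.
  by rewrite -powR_mulrn ?ltW // -powRrM mulfV ?pnatr_eq0 // powRr1 // ltW.
by apply: ge0_ler_powR => //; rewrite ?nnegrE ?invr_ge0 // exprn_ge0 // ltW.
Qed.

Lemma scaled_norm_le_guivarch t v : 1 <= t -> guivarch a N v <= t -> scaled_norm t v <= c%:R.
Proof.
move=> t1 /bigmax_leP[_ h]; have t0 : 0 < t by exact: lt_le_trans t1.
rewrite -[c in c%:R]card_ord -sumr_const; apply: ler_sum => i _.
rewrite ler_pdivrMr ?exprn_gt0 // mul1r.
have Ni : 0 <= N i (pi i v) by rewrite (norm_ge0 (HN i)) ?component_mem.
have := h i isT; rewrite -/(component i v) => le.
have -> : N i (pi i v) = (N i (pi i v) `^ (i.+1%:R)^-1) `^ (i.+1%:R).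
  by rewrite -powRrM mulVf ?pnatr_eq0 // powRr1.
rewrite -powR_mulrn; last exact: ltW.
apply: ge0_ler_powR => //.
  by rewrite nnegrE powR_ge0.
by rewrite nnegrE ltW.
Qed.

Lemma guivarch_gt0 v : v <> 0 -> 0 < guivarch a N v.
Proof.
move=> v0; rewrite lt_neqAle; apply/andP; split; last exact: bigmax_ge_id.
apply/eqP => E; apply: v0; rewrite -(component_sum v) big1 // => i _.
have Ni : 0 <= N i (pi i v) by rewrite (norm_ge0 (HN i)) ?component_mem.
case: (HN i) => _ h _ _; apply: h; first exact: component_mem.
have le : N i (pi i v) `^ (i.+1%:R)^-1 <= 0.
  rewrite [leRHS]E /guivarch.
  exact: (@le_bigmax _ _ _ _ (fun i => N i (component i v) `^ (i.+1%:R)^-1) i).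
have : N i (pi i v) `^ (i.+1%:R)^-1 = 0.
  by apply/eqP; rewrite eq_le le powR_ge0.
by move=> /powR_eq0_eq0.
Qed.

End ScaledNorms.

(** * Short words have small scaled norm *)

Section LengthUpper.
Variables (R : realType) (gg : vectType R) (n : nat) (L : set 'M[rat]_n)
  (br : gg -> gg -> gg) (iota : 'M[rat]_n -> gg).
Hypotheses (Hgg : real_extension L br iota) (HL : LR_group L).
Variables (c : nat) (Hc : nilpotency_class br c)
  (a : 'I_c -> {vspace gg}) (Ha : lcs_splitting br a)
  (N : 'I_c -> gg -> R) (HN : forall i : 'I_c, is_norm_on (a i) (N i)).
Local Notation scaled_norm := (scaled_norm a N).

Let Lsu : L `<=` @strictly_upper n. Proof. by move=> x /(LR_upper HL). Qed.
Let Lz : zsub L := LR_zsub HL.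
Let LM x y : L x -> L y -> L (bch x y). Proof. by case: (LR_subgroup HL) => _ h _; exact: h. Qed.

Lemma iota_word x y w : L x -> L y -> L (word_eval (@mlie n) x y w) /\
  iota (word_eval (@mlie n) x y w) = word_eval br (iota x) (iota y) w.
Proof.
move=> Lx Ly; elim: w => [||u [Lu Eu] v [Lv Ev]] //=.
by split; [exact: (LR_lie HL)|rewrite -(rext_lie Hgg) // Eu Ev].
Qed.

Lemma iota_bch (l : seq (rat * lie_word)) x y : L x -> L y ->
  bch x y = x + y + lie_eval l x y ->
  iota (bch x y) = iota x + iota y +
    \sum_(cw <- l) ratr cw.1 *: word_eval br (iota x) (iota y) cw.2.
Proof.
move=> Lx Ly E; have Ll : L (lie_eval l x y).
  have -> : lie_eval l x y = bch x y - (x + y) by rewrite E addrC addKr.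
  by apply: zsub_sub => //; [exact: LM|exact: zsub_add].
rewrite E (rext_add Hgg) //; last exact: zsub_add.
rewrite (rext_add Hgg) //; congr (_ + _).
rewrite (iota_comb Hgg HL) //; last by move=> cw; have [] := iota_word cw.2 Lx Ly.
by apply: eq_bigr => cw _; have [_ ->] := iota_word cw.2 Lx Ly.
Qed.

Fixpoint word_bound (K : R) w : R :=
  if w is LB u v then K * (word_bound K u * word_bound K v) else 1.

Lemma word_bound_ge0 K w : 1 <= K -> 0 <= word_bound K w.
Proof.
move=> K1; elim: w => //= u hu v hv.
by rewrite mulr_ge0 ?mulr_ge0 // (le_trans ler01).
Qed.

(** A word other than a single letter that lacks X or lacks Y vanishes, being made of
brackets of a vector with itself; the others contain each letter, whose norm
can be factored out since the remaining letters have norm at most 1. *)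
Lemma scaled_norm_word K t X Y w : 1 <= K -> 1 <= t ->
  (forall x y, scaled_norm t (br x y) <= K * (scaled_norm t x * scaled_norm t y)) ->
  scaled_norm t X <= 1 -> scaled_norm t Y <= 1 ->
  let W := word_eval br X Y w in
  [/\ scaled_norm t W <= word_bound K w,
      w = LX \/ scaled_norm t W <= word_bound K w * scaled_norm t Y
    & w = LY \/ scaled_norm t W <= word_bound K w * scaled_norm t X].
Proof.
move=> K1 t1 hK hX hY /=; have nt0' x : 0 <= scaled_norm t x by exact: scaled_norm_ge0.
have K0 : 0 <= K by exact: le_trans ler01 K1.
elim: w => [||u [hu uY uX] v [hv vY vX]].
- by rewrite /= !mul1r; split=> //; [left|right].
- by rewrite /= !mul1r; split=> //; [right|left].
set U := word_eval _ _ _ u in hu uY uX; set V := word_eval _ _ _ v in hv vY vX.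
have bu := word_bound_ge0 u K1; have bv := word_bound_ge0 v K1.
rewrite /= -/U -/V.
have h Z : scaled_norm t U <= word_bound K u * Z \/ scaled_norm t V <= word_bound K v * Z -> 0 <= Z ->
    scaled_norm t (br U V) <= K * (word_bound K u * word_bound K v) * Z.
  move=> hZ Z0; apply: (le_trans (hK U V)); rewrite -mulrA; apply: ler_wpM2l => //.
  have [nU nV] := (nt0' U, nt0' V).
  case: hZ => hZ; [rewrite [leRHS]mulrAC|rewrite -[leRHS]mulrA].
    exact: (ler_pM nU nV hZ hv).
  exact: (ler_pM nU nV hu hZ).
have self : br U V = 0 \/ [/\ scaled_norm t U <= word_bound K u * scaled_norm t Y \/
    scaled_norm t V <= word_bound K v * scaled_norm t Y &
    scaled_norm t U <= word_bound K u * scaled_norm t X \/ scaled_norm t V <= word_bound K v * scaled_norm t X].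
  case: uY => [eu|uY]; case: vY => [ev|vY].
  - by left; rewrite /U /V eu ev (brxx Hgg HL).
  - right; split; first by right.
    by case: uX; [rewrite eu|left].
  - right; split; first by left.
    by case: vX; [rewrite ev|right].
  - case: uX => [eu|uX]; last by right; split; left.
    case: vX => [ev|vX]; last by right; split; right.
    by left; rewrite /U /V eu ev (brxx Hgg HL).
split.
- apply: (le_trans (hK U V)); apply: ler_wpM2l => //; exact: (ler_pM (nt0' U) (nt0' V) hu hv).
- right; case: self => [->|[hY' _]]; last exact: h.
  by rewrite (scaled_norm0 HN) !mulr_ge0.
- right; case: self => [->|[_ hX']]; last exact: h.
  by rewrite (scaled_norm0 HN) !mulr_ge0.
Qed.

(** The bracket terms are bounded by a multiple of either factor, so that a product with
one factor of small norm has a small increment. *)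
Lemma scaled_norm_bch : exists2 Phi, 1 <= Phi & forall t, 1 <= t ->
  forall x y, L x -> L y -> scaled_norm t (iota x) <= 1 -> scaled_norm t (iota y) <= 1 ->
  scaled_norm t (iota (bch x y)) <= scaled_norm t (iota x) + Phi * scaled_norm t (iota y) /\
  scaled_norm t (iota (bch x y)) <= Phi * scaled_norm t (iota x) + scaled_norm t (iota y).
Proof.
have [K K1 hK] := scaled_norm_br Hgg HL Hc Ha HN; have [l hl Ebch] := bch_lie n.
pose S := \sum_(cw <- l) `|ratr cw.1| * word_bound K cw.2.
have S0 : 0 <= S.
  by apply: sumr_ge0 => cw _; rewrite mulr_ge0 // word_bound_ge0.
exists (1 + S); first by rewrite lerDl.
move=> t t1 x y Lx Ly hx hy.
have E := iota_bch Lx Ly (Ebch _ _ (Lsu Lx) (Lsu Ly)).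
set T := (X in _ = _ + X) in E.
suff h Z : 0 <= Z -> (forall w, is_bracket w ->
    scaled_norm t (word_eval br (iota x) (iota y) w) <= word_bound K w * Z) -> scaled_norm t T <= S * Z.
  have h0 v : 0 <= scaled_norm t v by exact: scaled_norm_ge0.
  have tri : scaled_norm t (iota (bch x y)) <=
      scaled_norm t (iota x) + scaled_norm t (iota y) + scaled_norm t T.
    rewrite E; apply: le_trans (scaled_norm_add HN t1 _ _) _.
    by rewrite lerD2r; exact: (scaled_norm_add HN t1).
  have hw w := scaled_norm_word w K1 t1 (hK t t1) hx hy.
  split; apply: (le_trans tri).
    rewrite mulrDl mul1r addrA lerD2l; apply: h => // w bw.
    by have [_ [E'|//] _] := hw w; rewrite E' in bw.
  rewrite mulrDl mul1r [leRHS]addrAC lerD2l; apply: h => // w bw.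
  by have [_ _ [E'|//]] := hw w; rewrite E' in bw.
move=> Z0 hw; rewrite /T /S mulr_suml; apply: le_trans (scaled_norm_sum HN t1 _ _) _.
elim: l hl {E Ebch S S0 T} => [|cw l IH] /=; first by rewrite !big_nil.
move=> /andP[bw /IH h]; rewrite !big_cons lerD // (scaled_norm_scale HN) -mulrA.
by apply: ler_wpM2l => //; exact: hw.
Qed.

(** At the scale C t both elements have norm at most 1, so scaled_norm_bch applies;
going back to the scale t costs C^c. *)
Lemma scaled_norm_bch_coarse (C : R) : 1 <= C -> exists2 C', 1 <= C' & forall t, 1 <= t ->
  forall x y, L x -> L y -> scaled_norm t (iota x) <= C -> scaled_norm t (iota y) <= C ->
  scaled_norm t (iota (bch x y)) <= C'.
Proof.
move=> C1; have C0 : 0 < C by exact: lt_le_trans C1.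
have [Phi P1 h] := scaled_norm_bch; exists (C ^+ c * (1 + Phi)).
  rewrite -[leLHS]mulr1 ler_pM //; first exact: exprn_ege1.
  by rewrite lerDl (le_trans _ P1).
move=> t t1 x y Lx Ly hx hy.
have Ct : 1 <= C * t by rewrite -[leLHS]mulr1 ler_pM.
have small v : scaled_norm t v <= C -> scaled_norm (C * t) v <= 1.
  move=> hv; apply: le_trans (scaled_norm_coarsen HN t1 v C1) _.
  by rewrite ler_pdivrMr // mul1r.
apply: le_trans (scaled_norm_refine HN t1 _ C1) _; apply: ler_wpM2l; first by rewrite exprn_ge0 // ltW.
have [hb _] := h _ Ct x y Lx Ly (small _ hx) (small _ hy).
apply: (le_trans hb); apply: lerD; first exact: small.
by rewrite -[leRHS]mulr1; apply: ler_wpM2l; [exact: le_trans ler01 P1|exact: small].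
Qed.

Variable Sq : seq 'M[rat]_n.
Hypothesis gen : generates [set` Sq] L.

(** At the scale lam r each letter contributes at most 1/r, and the partial products
keep norm at most 1, as scaled_norm_bch requires. *)
Lemma word_scaled_norm : exists2 lam, 1 <= lam & forall r : R, 1 <= r ->
  forall s, is_word [set` Sq] s -> (size s)%:R <= r ->
  scaled_norm (lam * r) (iota (bch_prod s)) <= 1.
Proof.
have [Phi P1 h] := scaled_norm_bch; have P0 : 0 < Phi by exact: lt_le_trans P1.
pose M := 1 + \sum_(A <- Sq) scaled_norm 1 (iota A).
have nt0' A : 0 <= scaled_norm 1 (iota A) by exact: scaled_norm_ge0.
have M1 : 1 <= M by rewrite lerDl sumr_ge0.
have M0 : 0 < M by exact: lt_le_trans M1.
have hM A : A \in Sq -> scaled_norm 1 (iota A) <= M.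
  move=> AS; rewrite /M (big_rem A) //= addrCA lerDl addr_ge0 ?sumr_ge0 //.
exists (Phi * M); first by rewrite -[leLHS]mulr1 ler_pM.
move=> r r1 s hs sr; have r0 : 0 < r by exact: lt_le_trans r1.
set t := _ * r; have t1 : 1 <= t by rewrite -[leLHS]mulr1 ler_pM // -[leLHS]mulr1 ler_pM.
have t0 : 0 < t by exact: lt_le_trans t1.
have hA A : [set` Sq] A \/ [set` Sq] (- A) -> L A -> Phi * scaled_norm t (iota A) <= r^-1.
  move=> SA LA; have hA : scaled_norm 1 (iota A) <= M.
    case: SA => /hM // hA; rewrite -[A]opprK -sub0r (iotaB Hgg HL) ?(iota0 Hgg HL).
    - by rewrite sub0r (scaled_norm_opp HN).
    - exact: zsub_0.
    - exact: zsub_opp.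
  have := scaled_norm_coarsen HN (lexx 1) (iota A) t1; rewrite mulr1 => le.
  have -> : r^-1 = Phi * (M / t).
    by rewrite /t; field; rewrite !gt_eqF.
  apply: ler_wpM2l; first exact: ltW.
  by apply: (le_trans le); apply: ler_wpM2r => //; rewrite invr_ge0 ltW.
suff le : scaled_norm t (iota (bch_prod s)) <= (size s)%:R / r.
  by apply: (le_trans le); rewrite ler_pdivrMr // mul1r.
elim: s hs sr => [|A s IH] hs sr.
  by rewrite /= (iota0 Hgg HL) (scaled_norm0 HN) mul0r.
have hs' : is_word [set` Sq] s by move=> B Bs; apply: hs; rewrite inE Bs orbT.
have sr' : (size s)%:R <= r by apply: le_trans sr; rewrite ler_nat.
have {}IH := IH hs' sr'.
have LA : L A by apply: (word_L HL gen hs); exact: mem_head.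
have le1 : scaled_norm t (iota (bch_prod s)) <= 1.
  by apply: (le_trans IH); rewrite ler_pdivrMr // mul1r.
have hA' := hA A (hs A (mem_head _ _)) LA.
have leA : scaled_norm t (iota A) <= 1.
  have ntA : 0 <= scaled_norm t (iota A) by exact: scaled_norm_ge0.
  apply: (@le_trans _ _ (Phi * scaled_norm t (iota A))); first by rewrite ler_peMl.
  by apply: (le_trans hA'); rewrite invf_le1.
have [_ le] := h t t1 _ _ LA (prod_L HL gen hs') leA le1.
apply: (le_trans le); rewrite /= -nat1r mulrDl mul1r; exact: lerD.
Qed.

End LengthUpper.

(** * Elements of small scaled norm are short words *)

Section ShortWordSums.
Variables (n : nat) (L : set 'M[rat]_n) (Sq : seq 'M[rat]_n).
Hypotheses (HL : LR_group L) (gen : generates [set` Sq] L).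
Local Notation short_word := (short_word Sq).

Lemma short_word0 k q : short_word k 0 q 0.
Proof. by exists [::]; split=> //=; rewrite subrr mem0v. Qed.

Lemma short_word_scaled k e K : e \in gen_brackets Sq k -> exists C : nat,
  forall (q : nat) (z : int), (0 < q)%N -> (`|z| <= K * q ^ k.+1)%N ->
    short_word k C q (z%:~R *: e).
Proof.
move=> ek; have [C hC] := short_word_bracket HL gen ek.
exists (C * K.+1)%N => q z q0 hz.
have [||s [hs ss Es]] := hC (K.+1 * q)%N z; first by rewrite muln_gt0.
  rewrite (leq_trans hz) // expnMn leq_mul // expnS (leq_trans (leqnSn K)) //.
  by rewrite leq_pmulr // expn_gt0.
by exists s; split=> //; rewrite -mulnA.
Qed.

Lemma short_word_sum k K : exists C : nat,
  forall (q : nat) (z : 'I_(size (gen_brackets Sq k)) -> int),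
  (0 < q)%N -> (forall i, `|z i| <= K * q ^ k.+1)%N ->
  short_word k C q (\sum_i (z i)%:~R *: (gen_brackets Sq k)`_i).
Proof.
have h (i : 'I_(size (gen_brackets Sq k))) : (gen_brackets Sq k)`_i \in gen_brackets Sq k by rewrite mem_nth.
have hU (i : 'I_(size (gen_brackets Sq k))) : (gen_brackets Sq k)`_i \in bracket_span Sq k.
  exact: (bracket_span_mem HL gen (leqnn k)).
suff [C hC] : exists C : nat, forall q (z : 'I_(size (gen_brackets Sq k)) -> int),
    (0 < q)%N -> (forall i, `|z i| <= K * q ^ k.+1)%N ->
    short_word k C q (\sum_(i <- index_enum 'I_(size (gen_brackets Sq k))) (z i)%:~R *: (gen_brackets Sq k)`_i).
  by exists C.
elim: (index_enum _) => [|i r [C hC]].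
  by exists 0%N => q z q0 hz; rewrite big_nil; exact: short_word0.
have [C' hC'] := short_word_scaled K (h i).
exists (C' + C)%N => q z q0 hz; rewrite big_cons; apply: (short_word_add HL gen).
- by apply: memvZ.
- by apply: memv_suml => j _; apply: memvZ.
- exact: hC'.
- exact: hC.
Qed.

End ShortWordSums.

Lemma functional_bound (R : realType) (gg : vectType R) (V : {vspace gg}) N
  (f : gg -> R^o) : is_norm_on V N -> linear f ->
  exists2 K, 0 <= K & forall x, x \in V -> `|f x| <= K * N x.
Proof.
move=> HN hf; have [K K0 hK] := norm_coord HN.
exists (K * \sum_b `|f (vbasis V)`_(nat_of_ord (b : 'I_(\dim V)))|).
  by rewrite mulr_ge0 // sumr_ge0.
move=> x xV; rewrite {1}(coord_vbasis xV) (linear_sum _ _ hf).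
apply: le_trans (ler_norm_sum _ _ _) _.
rewrite mulrAC mulr_sumr; apply: ler_sum => b _.
rewrite (linear_scale _ _ hf) normrM; apply: ler_wpM2r => //; exact: hK.
Qed.

Lemma abs_floor_le (q : rat) (m : nat) : `|q| <= m%:R -> (`|Num.floor q| <= m.+1)%N.
Proof.
rewrite ler_norml => /andP[l u].
have h1 : (Num.floor q <= m%:Z)%R by rewrite -(ler_int rat); exact: le_trans (floor_le q) u.
have h2 : (- m%:Z < Num.floor q + 1)%R.
  by rewrite -(ltr_int rat) rmorphN; apply: (le_lt_trans l); exact: floorD1_gt.
move: h1 h2; clear; move: (Num.floor q) => y; lia.
Qed.

Lemma fractional_part (D : nat) (q : rat) : (0 < D)%N -> D%:R * q \is a Num.int ->
  exists m : 'I_D.+1, q - (Num.floor q)%:~R = m%:R / D%:R.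
Proof.
move=> D0 Dq; have Dn0 : D%:R != 0 :> rat by rewrite pnatr_eq0 -lt0n.
have [y Ey] : exists y : int, D%:R * (q - (Num.floor q)%:~R) = y%:~R.
  by apply/intrP; rewrite mulrBr rpredB // rpredM ?natr_int ?intr_int.
have y0 : (0 <= y)%R by rewrite -(ler_int rat) -Ey mulr_ge0 // subr_ge0 floor_le.
have f1 : q - (Num.floor q)%:~R < 1.
  by rewrite ltrBlDl -[1]/(1%:~R) -rmorphD floorD1_gt.
have yD : (y < D%:Z)%R.
  by rewrite -(ltr_int rat) -Ey -[ltRHS]mulr1 ltr_pM2l // ltr0n.
have yn : (`|y| < D.+1)%N by move: y0 yD; clear; case: y => // m; lia.
exists (Ordinal yn) => /=; apply: (mulfI Dn0); rewrite Ey mulrCA divff // mulr1.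
by rewrite -[in LHS](gez0_abs y0).
Qed.

Section LengthLower.
Variables (R : realType) (gg : vectType R) (n : nat) (L : set 'M[rat]_n)
  (br : gg -> gg -> gg) (iota : 'M[rat]_n -> gg).
Hypotheses (Hgg : real_extension L br iota) (HL : LR_group L).
Variables (c : nat) (Hc : nilpotency_class br c)
  (a : 'I_c -> {vspace gg}) (Ha : lcs_splitting br a)
  (N : 'I_c -> gg -> R) (HN : forall i : 'I_c, is_norm_on (a i) (N i)).
Variable Sq : seq 'M[rat]_n.
Hypothesis gen : generates [set` Sq] L.
Local Notation scaled_norm := (scaled_norm a N).
Local Notation bracket_span := (bracket_span Sq).

Let brl w : linear (br^~ w). Proof. exact: (rext_linl Hgg). Qed.
Let brr w : linear (br w). Proof. exact: (rext_linr Hgg). Qed.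
Let Lsu : L `<=` @strictly_upper n. Proof. by move=> x /(LR_upper HL). Qed.
Let Lz : zsub L := LR_zsub HL.
Let LM x y : L x -> L y -> L (bch x y). Proof. by case: (LR_subgroup HL) => _ h _; exact: h. Qed.
Let LN x : L x -> L (- x). Proof. by case: (LR_subgroup HL) => _ _; apply. Qed.

Lemma gen_brackets_lcs k e : e \in gen_brackets Sq k -> iota e \in lcs br k.+1.
Proof.
elim: k e => [|k IH] e; first by move=> _; exact: lcs1.
case/allpairsP => -[s f] [/= sS fk ->].
have Ls : L s by case: gen => h _; exact: h.
rewrite -(rext_lie Hgg) //; last exact: (gen_brackets_L HL gen fk).
rewrite (br_anti Hgg HL) rpredN; apply: (lcs_br1 Hgg); exact: IH.
Qed.

Lemma bracket_span_lcs k v : L v -> v \in bracket_span k -> iota v \in lcs br k.+1.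
Proof.
move=> Lv vU; have E := coord_span (X := in_tuple _) vU.
have hb (i : 'I_(size (gen_bracket_list Sq k))) : (gen_bracket_list Sq k)`_i \in gen_bracket_list Sq k.
  by rewrite mem_nth.
have hL (i : 'I_(size (gen_bracket_list Sq k))) : L (gen_bracket_list Sq k)`_i.
  by have /gen_bracket_listP[j _ /(gen_brackets_L HL gen)] := hb i.
rewrite E (iota_comb Hgg HL) //; last by rewrite -E.
apply: memv_suml => i _; apply: memvZ.
have /gen_bracket_listP[j /andP[kj _] hj] := hb i.
by apply: (subvP (lcs_le Hgg kj)); exact: gen_brackets_lcs.
Qed.

(** The image of the filtration of L spans the lower central series of the real Lie
algebra, in dual form: the induction replaces f by the functionals u |-> f [u, g]. *)
Lemma bracket_span_vanish k (f : gg -> R^o) : linear f ->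
  (forall v, L v -> v \in bracket_span k -> f (iota v) = 0) ->
  forall x, x \in lcs br k.+1 -> f x = 0.
Proof.
have zlin : linear (fun _ : gg => 0 : R^o) by move=> q u v; rewrite scaler0 addr0.
elim: k f => [|k IH] f hf h.
  move=> x _; apply: (lin_ext Hgg hf zlin) => v Lv.
  by apply: h => //; exact: (sub_bracket_span0 HL gen).
move=> x xl; apply/eqP; rewrite -memv0; move: x xl.
apply: (brv_ind hf) => u y ul _; rewrite memv0; apply/eqP.
have lin1 : linear (fun y => f (br u y)).
  by move=> q v w; rewrite (brr u) (linear_add _ _ hf) (linear_scale _ _ hf).
move: y; apply: (lin_ext Hgg lin1 zlin) => g Lg.
apply: (IH (fun u => f (br u (iota g)))) ul.
  by move=> q v w; rewrite (brl (iota g)) (linear_add _ _ hf) (linear_scale _ _ hf).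
move=> v Lv vU; rewrite (rext_lie Hgg) //; apply: h; first exact: (LR_lie HL).
rewrite mlieC rpredN; apply: (bracket_span_br HL gen) => //; exact: (sub_bracket_span0 HL gen).
Qed.

Lemma bracket_span_top v : L v -> v \in bracket_span c -> v = 0.
Proof.
move=> Lv /(bracket_span_lcs Lv); have [-> _] := Hc; rewrite memv0 => /eqP.
exact: (iota_inj Hgg Lv).
Qed.

(** An additive coordinate on L extends to a linear functional f on the real Lie algebra. The
element has no components of weight below k + 1, and f vanishes on those of
higher weight by bracket_span_vanish, so f only sees the component of weight k + 1. *)
Lemma coord_bound (k : nat) p (phi : {linear 'M[rat]_n -> 'rV[rat]_p}) : (k < c)%N ->
  (forall v, v \in bracket_span k.+1 -> phi v = 0) ->
  exists K : nat, forall (r : nat) v, (0 < r)%N -> L v -> v \in bracket_span k ->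
    scaled_norm r%:R (iota v) <= 1 -> forall i, `|phi v 0 i| <= (K * r ^ k.+1)%:R.
Proof.
move=> kc phi0; pose kk := Ordinal kc.
have /choice[K hK] : forall i : 'I_p, exists K : nat, forall (r : nat) v,
    (0 < r)%N -> L v -> v \in bracket_span k ->
    scaled_norm r%:R (iota v) <= 1 -> `|phi v 0 i| <= (K * r ^ k.+1)%:R.
  move=> i; have [|f hf] := extend_additive Hgg (f := fun v => ratr (phi v 0 i)).
    by move=> x y _ _; rewrite linearD mxE rmorphD.
  have flin : linear (f : gg -> R^o) by move=> q u v; rewrite linearP.
  have f0 x : x \in lcs br k.+2 -> f x = 0.
    apply: (@bracket_span_vanish k.+1 f flin) => v Lv vU.
    by rewrite hf // phi0 // mxE rmorph0.
  have [K0 K00 hK0] := functional_bound (HN kk) flin.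
  have [K hKK] : exists K : nat, K0 <= K%:R.
    by exists (Num.bound K0); apply: ltW; rewrite archi_boundP.
  exists K => r v r0 Lv vU hv.
  have r1 : 1 <= r%:R :> R by rewrite ler1n.
  have E : f (iota v) = f (component a kk (iota v)).
    rewrite -{1}(component_sum Hc Ha (iota v)) raddf_sum (bigD1 kk) //= big1 ?addr0 //.
    move=> j jk; have [jlk|jgk|jek] := ltngtP j k.
    - by rewrite (component_lcs Hgg Hc Ha (bracket_span_lcs Lv vU)) // linear0.
    - by apply/f0/(subvP (lcs_le Hgg jgk))/(a_lcs Ha); exact: component_mem.
    - by move/eqP: jk; case; apply: val_inj.
  have : `|ratr (phi v 0 i) : R| <= (K * r ^ k.+1)%:R.
    rewrite -hf // E; apply: (le_trans (hK0 _ (component_mem a kk _))).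
    rewrite natrM; apply: ler_pM => //.
      by rewrite (norm_ge0 (HN kk)) ?component_mem.
    apply: (le_trans (component_le_norm HN r1 (iota v) kk)).
    by rewrite natrX ler_piMr // exprn_ge0.
  by rewrite -ratr_norm -(ratr_nat R) ler_rat.
exists (\sum_i K i)%N => r v r0 Lv vU hv i; apply: (le_trans (hK i r v r0 Lv vU hv)).
by rewrite ler_nat leq_mul2r (bigD1 i) //= leq_addr orbT.
Qed.

Lemma scaled_norm_opp_iota t v : L v -> scaled_norm t (iota (- v)) = scaled_norm t (iota v).
Proof.
move=> Lv; rewrite -sub0r (iotaB Hgg HL) //; last exact: zsub_0.
by rewrite (iota0 Hgg HL) sub0r (scaled_norm_opp HN).
Qed.

(** The element v is divided by a word w for the integral parts of its leading
coordinates, then by one of finitely many fixed words for their fractional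
parts. The quotient v2 has higher weight and a norm bounded by a constant, hence
at most 1 at the scale C3 r. *)
Lemma scaled_norm_short_word_step k (C0 : nat) : (k < c)%N ->
  (forall (r : nat) v, (0 < r)%N -> L v -> v \in bracket_span k.+1 ->
     scaled_norm r%:R (iota v) <= 1 ->
     exists s, [/\ is_word [set` Sq] s, (size s <= C0 * r)%N & v = bch_prod s]) ->
  exists C : nat, forall (r : nat) v, (0 < r)%N -> L v -> v \in bracket_span k ->
    scaled_norm r%:R (iota v) <= 1 ->
    exists s, [/\ is_word [set` Sq] s, (size s <= C * r)%N & v = bch_prod s].
Proof.
move=> kc IH; have [phi [phiU phi0]] := bracket_span_coord HL gen k.
set p := size (gen_brackets Sq k) in phi phiU phi0; pose E i := (gen_brackets Sq k)`_(nat_of_ord (i : 'I_p)).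
have EU i : E i \in bracket_span k by apply: (bracket_span_mem HL gen (leqnn k)); rewrite mem_nth.
have [K hK] := coord_bound kc phi0.
have [D D0 hD] := coord_denom HL gen phi.
have Dn0 : D%:R != 0 :> rat by rewrite pnatr_eq0 -lt0n.
have [C1 hC1] := short_word_sum HL gen k K.+1.
(* A combination with fractional coefficients rho need not lie in L modulo the
   next step; when it does, one element of L congruent to it is fixed. *)
pose rho_vec (rho : {ffun 'I_p -> 'I_D.+1}) : 'M[rat]_n :=
  \sum_i ((rho i)%:R / D%:R) *: E i.
have /choice[us hus] : forall rho, exists us : 'M[rat]_n * seq 'M[rat]_n,
    [/\ L us.1, is_word [set` Sq] us.2, us.1 = bch_prod us.2 &
      forall u, L u -> u - rho_vec rho \in bracket_span k.+1 ->
        us.1 - rho_vec rho \in bracket_span k.+1].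
  move=> rho; have [[u [Lu hu]]|no] :=
      pselect (exists u, L u /\ u - rho_vec rho \in bracket_span k.+1).
    by have [_ /(_ u Lu)[s hs Es]] := gen; exists (u, s).
  exists (0, [::]); split=> //; first exact: zsub_0.
  by move=> u Lu hu; case: no; exists u.
pose len := (\max_rho size (us rho).2)%N.
pose M := 1 + \sum_rho scaled_norm 1 (iota (us rho).1).
have nt1 x : 0 <= scaled_norm 1 x by exact: scaled_norm_ge0.
have M1 : 1 <= M by rewrite lerDl sumr_ge0.
have hM rho : scaled_norm 1 (iota (us rho).1) <= M.
  by rewrite /M (bigD1 rho) //= addrCA lerDl addr_ge0 // sumr_ge0.
have [lam lam1 hlam] := word_scaled_norm Hgg HL Hc Ha HN gen.
pose s0 := lam * C1.+1%:R.
have C11 : 1 <= C1.+1%:R :> R by rewrite ler1n.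
have s01 : 1 <= s0 by rewrite -[leLHS]mulr1 ler_pM.
pose B1 := s0 ^+ c + M.
have B11 : 1 <= B1 by rewrite ler_wpDl ?exprn_ge0 // ?(le_trans _ s01).
have [B2 B21 hB2] := scaled_norm_bch_coarse Hgg HL Hc Ha HN B11.
have B3 : 1 <= Num.max B1 B2 by rewrite le_max B11.
have [B4 B41 hB4] := scaled_norm_bch_coarse Hgg HL Hc Ha HN B3.
have [C3 hC3] : exists C3 : nat, B4 <= C3%:R.
  by exists (Num.bound B4); apply: ltW; rewrite archi_boundP // (le_trans _ B41).
have C31 : 1 <= C3%:R :> R by exact: le_trans hC3.
exists (C1 + len + C0 * C3)%N => r v r0 Lv vU hv.
have r1 : 1 <= r%:R :> R by rewrite ler1n.
pose q i := phi v 0 i; pose z i := Num.floor (q i).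
have hz i : (`|z i| <= K.+1 * r ^ k.+1)%N.
  apply: leq_trans (abs_floor_le (hK r v r0 Lv vU hv i)) _.
  by rewrite mulSn -add1n leq_add2r expn_gt0 r0.
have [s1 [hs1 ss1 Es1]] := hC1 r z r0 hz.
set w := bch_prod s1 in Es1; have Lw : L w by exact: (prod_L HL gen).
set W := \sum_i _ in Es1.
have WU : W \in bracket_span k by apply: memv_suml => i _; apply: memvZ; exact: EU.
have le1 := subvP (bracket_span_le HL gen (leqnSn k)).
have wU : w \in bracket_span k by rewrite -[w](subrK W) rpredD //; exact: le1.
have LNw : L (- w) by exact: LN.
have NwU : - w \in bracket_span k by rewrite rpredN.
pose u := bch (- w) v; have Lu : L u by exact: LM.
have uU : u \in bracket_span k by exact: (bracket_span_bch_mem HL gen).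
have hfrac i : exists m : 'I_D.+1, q i - (z i)%:~R = m%:R / D%:R.
  by apply: fractional_part => //; exact: hD.
have /choice[rho0 hrho0] := hfrac.
pose rho : {ffun 'I_p -> 'I_D.+1} := [ffun i => rho0 i].
have urho : u - rho_vec rho \in bracket_span k.+1.
  have e1 : u - (- w + v) \in bracket_span k.+1 by exact: (bracket_span_bch_add HL gen).
  have e2 := phiU v vU.
  have -> : u - rho_vec rho = (u - (- w + v)) + ((v - \sum_i phi v 0 i *: E i) - (w - W)).
    have -> : rho_vec rho = \sum_i phi v 0 i *: E i - W.
      rewrite /rho_vec /W -sumrB; apply: eq_bigr => i _.
      by rewrite ffunE -hrho0 scalerBl.
    by apply/matrixP => x y; rewrite !mxE; ring.
  by rewrite rpredD // rpredB.
have [Lus hws Eus /(_ u Lu urho) hus'] := hus rho.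
set u0 := (us rho).1 in Lus Eus hus'.
have u0U : u0 \in bracket_span k.
  rewrite -[u0](subrK (rho_vec rho)) rpredD //; first exact: le1.
  by apply: memv_suml => i _; apply: memvZ; exact: EU.
pose v2 := bch (- u0) u; have Lv2 : L v2 by apply: LM => //; exact: LN.
have v2U : v2 \in bracket_span k.+1.
  have Nu0U : - u0 \in bracket_span k by rewrite rpredN.
  have e1 : v2 - (- u0 + u) \in bracket_span k.+1 by exact: (bracket_span_bch_add HL gen).
  have split4 (b d e f : 'M[rat]_n) : b = (b - (- d + e)) + ((e - f) - (d - f)).
    by apply/matrixP => x y; rewrite !mxE; ring.
  rewrite [v2](split4 _ u0 u (rho_vec rho)).
  by rewrite rpredD // rpredB.
(* The word w has O(r) letters, so w has bounded norm by word_scaled_norm; so do v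
   and u0, and products of elements of bounded norm have bounded norm. *)
have nw : scaled_norm r%:R (iota (- w)) <= B1.
  rewrite scaled_norm_opp_iota //.
  have Cr : 1 <= C1.+1%:R * r%:R :> R by rewrite -[leLHS]mulr1 ler_pM.
  have ss : (size s1)%:R <= C1.+1%:R * r%:R :> R.
    by rewrite -natrM ler_nat (leq_trans ss1) // leq_mul2r leqnSn orbT.
  have := hlam _ Cr s1 hs1 ss; rewrite mulrA -/s0 -/w => le.
  apply: (le_trans (scaled_norm_refine HN r1 _ s01)); rewrite /B1.
  rewrite -[leLHS]addr0 lerD // ?(le_trans _ M1) //.
  by rewrite -[leRHS]mulr1 ler_wpM2l // exprn_ge0 // (le_trans _ s01).
have nv : scaled_norm r%:R (iota v) <= B1 by exact: le_trans B11.
have nu : scaled_norm r%:R (iota u) <= Num.max B1 B2.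
  by rewrite le_max (hB2 _ r1 _ _ LNw Lv nw nv) orbT.
have nu0 : scaled_norm r%:R (iota (- u0)) <= Num.max B1 B2.
  rewrite scaled_norm_opp_iota // le_max; apply/orP; left.
  have := scaled_norm_coarsen HN (lexx 1) (iota u0) r1; rewrite mulr1 => /le_trans; apply.
  rewrite ler_pdivrMr ?(lt_le_trans ltr01 r1) //.
  apply: (le_trans (hM rho)); rewrite -[leLHS]mulr1 ler_pM //; first exact: le_trans M1.
  by rewrite /B1 lerDr exprn_ge0 // (le_trans _ s01).
have nv2 := hB4 _ r1 _ _ (LN Lus) Lu nu0 nu.
have C3r : (0 < C3 * r)%N.
  by rewrite muln_gt0 r0 andbT -(ltr0n R) (lt_le_trans ltr01 C31).
have nv2' : scaled_norm (C3 * r)%:R (iota v2) <= 1.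
  rewrite natrM; apply: (le_trans (scaled_norm_coarsen HN r1 _ C31)).
  rewrite ler_pdivrMr ?(lt_le_trans ltr01 C31) // mul1r.
  exact: le_trans hC3.
have [s2 [hs2 ss2 Es2]] := IH _ _ C3r Lv2 v2U nv2'.
have [h1 E1] := word_cat HL gen hws hs2; have [h2 E2] := word_cat HL gen hs1 h1.
exists (s1 ++ ((us rho).2 ++ s2)); split=> //.
  have lenr : (size (us rho).2 <= len)%N by exact: (leq_bigmax rho).
  rewrite !size_cat !mulnDl -addnA; apply: leq_add => //; apply: leq_add.
    by rewrite (leq_trans lenr) // leq_pmulr.
  by rewrite -mulnA.
rewrite E2 E1 -Eus -/u0 -Es2 /v2 -/w.
rewrite (bchNK (Lsu Lus)); last exact/Lsu.
by rewrite /u bchNK //; exact/Lsu.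
Qed.

Lemma scaled_norm_short_word : exists C : nat, forall (r : nat) v, (0 < r)%N -> L v ->
  scaled_norm r%:R (iota v) <= 1 ->
  exists s, [/\ is_word [set` Sq] s, (size s <= C * r)%N & v = bch_prod s].
Proof.
suff h j : (j <= c)%N -> exists C : nat, forall (r : nat) v, (0 < r)%N -> L v ->
    v \in bracket_span (c - j) -> scaled_norm r%:R (iota v) <= 1 ->
    exists s, [/\ is_word [set` Sq] s, (size s <= C * r)%N & v = bch_prod s].
  have [C hC] := h c (leqnn c); exists C => r v r0 Lv; apply: hC => //.
  by rewrite subnn; exact: (sub_bracket_span0 HL gen).
elim: j => [_|j IH jc].
  exists 0%N => r v r0 Lv; rewrite subn0 => vU _; exists [::]; split=> //.
  exact: (bracket_span_top Lv vU).
have [C hC] := IH (ltnW jc).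
have e : (c - j = (c - j.+1).+1)%N by lia.
by rewrite e in hC; apply: (scaled_norm_short_word_step _ hC); lia.
Qed.

End LengthLower.

(** * Comparison of the growth functions *)

Section Assembly.
Variable R : realType.

(** The value 1 of emax at the empty set is harmless because all detection indices are
at least 1. *)
Lemma emax_le (A B : set (\bar R)) (C : R) : 1 <= C ->
  (forall x, A x -> exists2 y, B y & (x <= C%:E * y)%E) ->
  (forall y, B y -> (1%:E <= y)%E) -> (emax A <= C%:E * emax B)%E.
Proof.
move=> C1 AB B1; have C0 : (0%:E <= C%:E :> \bar R)%E by rewrite lee_fin (le_trans _ C1).
have supB y : B y -> (y <= emax B)%E.
  move=> By; rewrite /emax; case: asboolP => [B0|_]; first by rewrite B0 in By.
  exact: ereal_sup_ubound.
have B1' : (1%:E <= emax B)%E.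
  have [[y By]|no] := pselect (exists y, B y).
    exact: le_trans (B1 y By) (supB y By).
  rewrite /emax asboolT //; apply/seteqP; split=> // y By; case: no; by exists y.
rewrite {1}/emax; case: asboolP => [_|_].
  apply: (le_trans B1'); rewrite -[X in (X <= _)%E]mul1e; apply: lee_wpmul2r => //.
  by apply: le_trans B1'; rewrite lee_fin.
apply: ge_ereal_sup => x /AB[y By]; move/le_trans; apply.
by apply: lee_wpmul2l => //; exact: supB.
Qed.

Variables (n : nat) (S : set 'M[rat]_n).

Lemma word_length_le s : is_word S s ->
  (word_length R S (bch_prod s) <= (size s)%:R%:E)%E.
Proof. by move=> hs; apply: ereal_inf_lbound; exists s. Qed.

(** The infimum is attained, as lengths are integers. *)
Lemma word_length_word g (r : R) : 0 <= r -> (word_length R S g <= r%:E)%E ->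
  exists s, [/\ is_word S s, g = bch_prod s & (size s)%:R <= r].
Proof.
move=> r0 h; apply: contrapT => no.
have : ((Num.truncn r).+1%:R%:E <= word_length R S g)%E.
  apply: le_ereal_inf_tmp => _ [s [hs Es] <-]; rewrite lee_fin ler_nat ltnNge.
  apply/negP => sr; apply: no; exists s; split=> //.
  by apply: (@le_trans _ _ (Num.truncn r)%:R); rewrite ?ler_nat // truncn_le.
move=> /le_trans/(_ h); rewrite lee_fin leNgt; apply/negP/negPn.
by rewrite -truncn_le_nat.
Qed.

Lemma word_length_gt0 g : g <> 0 -> (0 < word_length R S g)%E.
Proof.
move=> g0; rewrite ltNge; apply/negP => h.
have [s [_ Eg]] := word_length_word (lexx 0) h.
rewrite lern0 => /eqP/size0nil s0; apply: g0; by rewrite Eg s0.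
Qed.

Lemma word_length_neq0 g : (0 < word_length R S g)%E -> g <> 0.
Proof.
move=> + g0; rewrite g0 ltNge => /negP; apply.
have h : is_word S [::] by [].
exact: (word_length_le h).
Qed.

End Assembly.

Lemma guivarch0 (R : realType) (gg : vectType R) c (a : 'I_c -> {vspace gg})
  (N : 'I_c -> gg -> R) : (forall i, is_norm_on (a i) (N i)) -> guivarch a N 0 = 0.
Proof.
move=> HN; apply/le_anti/andP; split; last exact: bigmax_ge_id.
apply: bigmax_le => // i _.
by rewrite linear0 (norm0 (HN i)) powR0 // invr_eq0 pnatr_eq0.
Qed.

Theorem theorem4 (R : realType) (n : nat) (G : set 'M[rat]_n)
  (HG : LR_group G)
  (H : set ('M[rat]_n -> 'M[rat]_n)) (HH : aut_subgroup G H)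
  (S : set 'M[rat]_n) (finS : finite_set S) (genS : generates S G)
  (gg : vectType R) (br : gg -> gg -> gg) (iota : 'M[rat]_n -> gg)
  (Hgg : real_extension G br iota)
  (c : nat) (Hc : nilpotency_class br c)
  (a : 'I_c -> {vspace gg}) (Ha : lcs_splitting br a)
  (N : 'I_c -> gg -> R) (HN : forall i : 'I_c, is_norm_on (a i) (N i))
  (Hl : (exists2 v, G v & v <> 0) ->
        exists v, [/\ G v, v <> 0 & guivarch a N (iota v) <= 1]) :
  growth_eq (RF_group G S (invariant_normal G H))
            (RF_lie G (fun v => guivarch a N (iota v)) (invariant_ideal G H)).
Proof.
have [C0 C00 hC0] := detect_comparable HG HH R.
have /finite_seqP[Sq ESq] := finS; subst S.
have [lam lam1 hlam] := word_scaled_norm Hgg HG Hc Ha HN genS.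
have [Cw hCw] := scaled_norm_short_word Hgg HG Hc Ha HN genS.
have lam0 : 0 <= lam by exact: le_trans ler01 lam1.
have C01 : 1 <= C0%:R :> R by rewrite ler1n.
have scale (C : R) (x y : \bar R) : C0%:R <= C -> (1%:E <= y)%E ->
    (x <= C0%:R%:E * y)%E -> (x <= C%:E * y)%E.
  move=> CC y1 /le_trans; apply; apply: lee_wpmul2r; last by rewrite lee_fin.
  by apply: le_trans y1; rewrite lee_fin.
split.
  pose C : R := C0%:R + lam; have C1 : 1 <= C by rewrite /C (le_trans C01) // lerDl.
  exists C => [|r]; first exact: lt_le_trans C1.
  rewrite ge_max => /andP[r1 _]; have r0 : 0 <= r by exact: le_trans r1.
  apply: emax_le => // [_ [g [Gg /andP[g0 gr]] <-]|_ [v [Gv _] <-]]; last first.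
    exact: detect_ge1.
  have [s [hs Eg sr]] := word_length_word r0 gr.
  exists (detect R +%R G (invariant_ideal G H) g).
    exists g => //; split=> //; apply/andP; split.
      apply: (guivarch_gt0 Hc Ha HN) => ig; apply: (word_length_neq0 g0).
      exact: (iota_inj Hgg Gg).
    have lr : 1 <= lam * r by rewrite -[leLHS]mulr1 ler_pM.
    have := hlam r r1 s hs sr; rewrite -Eg => /(guivarch_le HN lr) h.
    by apply: (le_trans h); apply: ler_wpM2r => //; rewrite lerDr.
  apply: (scale C); [by rewrite lerDl|exact: detect_ge1|].
  by have [] := hC0 g Gg.
(* The ball of radius t has scaled norm at most c at t, hence at most 1 at
   (c + 1) t; the factor 2 is for rounding r up to an integer. *)
pose C : R := C0%:R + (Cw * c.+1 * 2)%:R; have C1 : 1 <= C by rewrite /C (le_trans C01) // lerDl.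
exists C => [|r]; first exact: lt_le_trans C1.
rewrite ge_max => /andP[r1 _]; have r0 : 0 <= r by exact: le_trans r1.
apply: emax_le => // [_ [v [Gv /andP[v0 vr]] <-]|_ [v [Gv _] <-]]; last first.
  exact: detect_ge1.
have vn0 : v <> 0.
  by move=> E; move: v0; rewrite E (iota0 Hgg HG) (guivarch0 HN) ltxx.
pose r' := (Num.truncn r).+1.
have rr' : r <= r'%:R by apply: ltW; rewrite -truncn_le_nat.
have r'r : r'%:R <= 2 * r.
  by rewrite /r' -natr1 mulr_natl mulr2n lerD // truncn_le.
have r'1 : 1 <= r'%:R :> R by rewrite ler1n.
have c1 : 1 <= c.+1%:R :> R by rewrite ler1n.
have hv : scaled_norm a N (c.+1 * r')%:R (iota v) <= 1.
  rewrite natrM; apply: (le_trans (scaled_norm_coarsen HN r'1 _ c1)).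
  rewrite ler_pdivrMr ?(lt_le_trans ltr01 c1) // mul1r.
  apply: (@le_trans _ _ c%:R); last by rewrite ler_nat.
  exact: (scaled_norm_le_guivarch HN r'1 (le_trans vr rr')).
have [s [hs ss Es]] := hCw _ v (isT : (0 < c.+1 * r')%N) Gv hv.
exists (detect R (@bch n) G (invariant_normal G H) v).
  exists v => //; split=> //; apply/andP; split; first exact: word_length_gt0.
  rewrite Es; apply: (le_trans (word_length_le R hs)); rewrite lee_fin.
  apply: (@le_trans _ _ (Cw * (c.+1 * r'))%:R); first by rewrite ler_nat.
  apply: (@le_trans _ _ ((Cw * c.+1 * 2)%:R * r)).
    rewrite mulnA natrM [in leRHS]natrM -mulrA; apply: ler_wpM2l => //.
  by apply: ler_wpM2r => //; rewrite lerDr.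
apply: (scale C); [by rewrite lerDl|exact: detect_ge1|].
by have [] := hC0 v Gv.
Qed.
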